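(* Let $K$ be a normal subgroup of $\Delta$ with $\Delta/K\cong L_2(q)$ for some prime power $q$. Then the normaliser $N(K)$ of $K$ in $\mathrm{Iso}\,\mathcal H^3$ is $\Omega$ if $K$ is normal in $\Gamma$, and is $\Omega^+$ if $K$ is not normal in $\Gamma$.
   Context: $L_2(q)=SL_2(q)/\{\pm I\}$ where $q\geq4$ is a prime power. $\mathcal H^3$ is hyperbolic $3$-space and $\mathrm{Iso}\,\mathcal H^3$ its full isometry group (including orientation-reversing isometries). $\Gamma=[3,5,3]$ is the Coxeter group $$\langle a,b,c,d\mid a^2=b^2=c^2=d^2=(ab)^3=(bc)^5=(cd)^3=(ac)^2=(ad)^2=(bd)^2=1\rangle,$$ realised as the discrete subgroup of $\mathrm{Iso}\,\mathcal H^3$ generated by the reflections $a,b,c,d$ in the faces opposite the vertices $A,B,C,D$ of a tetrahedron $ABCD$ with dihedral angles $\pi/2$ along $AC$, $BC$, $BD$, angles $\pi/3$ along $AB$, $CD$, and angle $\pi/5$ along $AD$. $\Delta=\Gamma^+=[3,5,3]^+$ is its even (orientation-preserving) subgroup of index $2$, with presentation $$\langle\alpha,\beta,\gamma\mid\alpha^3=\beta^5=\gamma^3=(\alpha\beta)^2=(\beta\gamma)^2=(\alpha\beta\gamma)^2=1\rangle,\quad \alpha=ab,\ \beta=bc,\ \gamma=cd.$$ $\Omega$ is the normaliser of $\Gamma$ in $\mathrm{Iso}\,\mathcal H^3$; it is the semidirect product $\Gamma\rtimes\langle r\rangle$, where $r$ is a half-turn about the axis through the mid-points of the edges $AD$ and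 $BC$ of the tetrahedron, and conjugation by $r$ transposes $a$ and $d$ and transposes $b$ and $c$. $\Omega^+$ is the orientation-preserving subgroup of $\Omega$; it is the semidirect product $\Delta\rtimes\langle r\rangle$, where conjugation by $r$ transposes $\alpha$ and $\gamma^{-1}$ and inverts $\beta$. *)

(* Defs.v *)
From HB Require Import structures.
From mathcomp Require Import all_boot all_order all_algebra all_fingroup.
From mathcomp Require Import all_classical all_reals all_analysis.

Set Implicit Arguments.
Unset Strict Implicit.
Unset Printing Implicit Defensive.

Import Order.TTheory GRing.Theory Num.Theory.
Local Open Scope classical_set_scope.
Local Open Scope ring_scope.

Section AbstractGroups.
Local Open Scope group_scope.
Variable G : groupType.
Implicit Types H K A B : set G.

Definition is_subgroup H : Prop :=
  H 1 /\ forall x y, H x -> H y -> H (x * y^-1).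

Definition subgroup_generated A : set G := smallest is_subgroup A.

Definition is_normal K H : Prop :=
  [/\ is_subgroup K, K `<=` H & forall h k, H h -> K k -> K (k ^ h)].

(* the normaliser in the whole of G *)
Definition normaliser_of K : set G := [set g | [set k ^ g | k in K] = K].

Definition left_cosets H K : set (set G) := [set [set x * k | k in K] | x in H].

Definition setprod A B : set G := [set x * y | x in A & y in B].

(* H / K, with its product of cosets, is isomorphic to L *)
Definition quotient_isomorphic (gT : groupType) H K (L : set gT) : Prop :=
  exists f : set G -> gT,
    set_bij (left_cosets H K) L f /\
    forall X Y, left_cosets H K X -> left_cosets H K Y -> f (setprod X Y) = f X * f Y.

End AbstractGroups.

Section PSL2.
Local Open Scope group_scope.
Variable F : finFieldType.

Definition SL2 : {set {'GL_2[F]}} :=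
  finset (fun u : {'GL_2[F]} => \det (GLval u) == 1%R).

Definition pmI : {set {'GL_2[F]}} :=
  finset (fun u : {'GL_2[F]} => (GLval u == 1%R) || (GLval u == - 1%R)%R).

Lemma SL2_group_set : group_set SL2.
Proof.
apply/group_setP; split=> [|u v]; first by rewrite inE GL_1E det1.
by rewrite !inE GL_MxE det_mulmx => /eqP-> /eqP->; rewrite mul1r.
Qed.
Canonical SL2_group := Group SL2_group_set.

Lemma pmI_group_set : group_set pmI.
Proof.
apply/group_setP; split=> [|u v]; first by rewrite inE GL_1E eqxx.
rewrite !inE GL_ME => /orP[]/eqP-> /orP[]/eqP->;
  by rewrite ?mulrNN ?mulrN ?mulNr ?mulr1 ?mul1r eqxx ?orbT.
Qed.
Canonical pmI_group := Group pmI_group_set.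

Definition PSL2 := SL2 / pmI.

End PSL2.

Section HyperbolicSpace.
Variable R : realType.

Definition lorentz (x y : 'rV[R]_4) : R :=
  - (x ord0 ord0 * y ord0 ord0)
  + \sum_(i < 3) x ord0 (lift ord0 i) * y ord0 (lift ord0 i).

(* the hyperboloid model *)
Definition H3 : Type :=
  {x : 'rV[R]_4 | (lorentz x x == - 1) && (0 < x ord0 ord0)}.

Definition pt (x : H3) : 'rV[R]_4 := sval x.

Definition arcosh (t : R) : R := ln (t + Num.sqrt (t ^+ 2 - 1)).

Definition hdist (x y : H3) : R := arcosh (- lorentz (pt x) (pt y)).

Record isoH3 : Type := IsoH3 {
  iso_fun :> H3 -> H3;
  iso_dist : forall x y, hdist (iso_fun x) (iso_fun y) = hdist x y;
  iso_bij : bijective iso_fun }.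

Lemma isoH3_eq (g h : isoH3) : iso_fun g =1 iso_fun h -> g = h.
Proof.
case: g h => [g gd gb] [h hd hb] /= /funext gh.
by case: _ / gh hd hb => hd hb; congr IsoH3; exact: Prop_irrelevance.
Qed.

Definition iso_one : isoH3 :=
  @IsoH3 idfun (fun _ _ => erefl) (Bijective (frefl _) (frefl _)).

Lemma iso_mul_dist (g h : isoH3) x y :
  hdist ((g \o h) x) ((g \o h) y) = hdist x y.
Proof. by rewrite /= !iso_dist. Qed.

Definition iso_mul (g h : isoH3) : isoH3 :=
  IsoH3 (@iso_mul_dist g h) (bij_comp (iso_bij g) (iso_bij h)).

Lemma iso_inv_ex (g : isoH3) :
  exists h : isoH3, cancel g h /\ cancel h g.
Proof.
case: (iso_bij g) => f gK fK.
have fd x y : hdist (f x) (f y) = hdist x y by rewrite -(iso_dist g) !fK.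
by exists (IsoH3 fd (Bijective fK gK)).
Qed.

Definition iso_inv (g : isoH3) : isoH3 := sval (cid (iso_inv_ex g)).

Lemma iso_mulA : associative iso_mul.
Proof. by move=> f g h; apply: isoH3_eq. Qed.

Lemma iso_mul1 : left_id iso_one iso_mul.
Proof. by move=> f; apply: isoH3_eq. Qed.

Lemma iso_mulr1 : right_id iso_one iso_mul.
Proof. by move=> f; apply: isoH3_eq. Qed.

Lemma iso_mulV : left_inverse iso_one iso_inv iso_mul.
Proof.
move=> f; apply: isoH3_eq => x /=.
by rewrite /iso_inv; case: cid => h /= [fK _]; exact: fK.
Qed.

Lemma iso_mulrV : right_inverse iso_one iso_inv iso_mul.
Proof.
move=> f; apply: isoH3_eq => x /=.
by rewrite /iso_inv; case: cid => h /= [_ hK]; exact: hK.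
Qed.

HB.instance Definition _ := gen_eqMixin isoH3.
HB.instance Definition _ := gen_choiceMixin isoH3.
HB.instance Definition _ := isGroup.Build isoH3
  iso_mulA iso_mul1 iso_mulr1 iso_mulV iso_mulrV.

(* The orientation of a 4-tuple of points is the sign of the determinant of
   their coordinate vectors; it is 0 exactly when the points are coplanar. *)
Definition orientation (P : 'I_4 -> H3) : R :=
  Num.sg (\det (\matrix_(i < 4) pt (P i))).

Definition orientation_preserving : set isoH3 :=
  [set g | forall P, orientation (fun i => g (P i)) = orientation P].

(* n is the unit normal of the plane of the face XYZ pointing away from the
   opposite vertex W; it exists only if W, X, Y, Z do not degenerate *)
Definition outward_normal (W X Y Z : H3) (n : 'rV[R]_4) : Prop :=
  [/\ lorentz n n = 1, lorentz n (pt X) = 0, lorentz n (pt Y) = 0,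
      lorentz n (pt Z) = 0 & lorentz n (pt W) < 0].

(* the interior angle at the edge XY of the tetrahedron XYZW is theta *)
Definition dihedral_angle (X Y Z W : H3) (theta : R) : Prop :=
  exists m n : 'rV[R]_4,
    [/\ outward_normal Z X Y W m, outward_normal W X Y Z n
      & theta = pi - acos (lorentz m n)].

(* g is the reflection in the face XYZ opposite W *)
Definition face_reflection (W X Y Z : H3) (g : isoH3) : Prop :=
  exists2 n : 'rV[R]_4, outward_normal W X Y Z n &
    forall x, pt (g x) = pt x - (2 * lorentz (pt x) n) *: n.

Definition tetrahedron353 (A B C D : H3) : Prop :=
  [/\ dihedral_angle A C B D (pi / 2) /\ dihedral_angle B C A D (pi / 2),
      dihedral_angle B D A C (pi / 2),
      dihedral_angle A B C D (pi / 3),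
      dihedral_angle C D A B (pi / 3)
    & dihedral_angle A D B C (pi / 5)].

Section Groups353.
Variables A B C D : H3.

Definition Gamma : set isoH3 :=
  subgroup_generated [set g | [\/ face_reflection A B C D g, face_reflection B A C D g,
                         face_reflection C A B D g | face_reflection D A B C g]].

Definition Delta : set isoH3 := Gamma `&` orientation_preserving.

Definition Omega : set isoH3 := normaliser_of Gamma.

Definition Omega_plus : set isoH3 := Omega `&` orientation_preserving.

End Groups353.

End HyperbolicSpace.

(* Main.v *)
Require Import Defs.
From HB Require Import structures.
From mathcomp Require Import all_boot all_order all_algebra all_fingroup.
From mathcomp Require Import all_classical all_reals all_analysis.
From mathcomp Require Import cyclic ring lra zify.

Set Implicit Arguments.
Unset Strict Implicit.
Unset Printing Implicit Defensive.

Local Open Scope classical_set_scope.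

(* Gamma consists of integral matrices over Z[phi] (phi the golden ratio) in the basis of the four face normals, and the
   Galois conjugate of their invariant form is positive definite; hence Gamma is discrete. An isometry normalising K is
   determined by its action on finitely many translations in K, so N(K) is discrete as well.

   The quotient map Delta -> L_2(q) lifts, on the generators, to matrices X, Y, Z of SL_2(q) with tr X = tr Z = 1,
   (tr Y)^2 = tr Y + 1 and XY, YZ, XYZ of trace 0. The triple (Z^-1, Y^-1, X^-1) has the same traces, so an algebra
   automorphism of M_2(q) carries one triple to the other, and K is invariant under the half-turn r.

   A discrete group N containing Delta and r has all points of the orbit of A at mutual distance at least |AD|. Indeed,
   two points P, Q of the orbit at minimal distance h < |AD| are joined by a 5-fold axis of each of their icosahedral
   stabilisers, since otherwise a rotation of order 5 about P would move Q by less than h; and then, up to the dihedral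
   group of the axis, an icosahedral neighbour of P around Q and one of Q around P are at distance less than h. This
   packing condition forces N A to be the set of vertices and cell centres of the honeycomb {3,5,3}, and then each
   element of N to lie in Gamma or r Gamma. *)

(** A priori an isometry normalising K need not respect the tessellation at all. Discreteness enters
    because a least distance in the orbit of A must be attained. For it only the order m of L_2(q)
    matters: K contains the m-th power of every element of Delta, and commuting with a power of a
    translation is as restrictive as commuting with the translation. The bound |AD|, of cosh phi +
    1/2, is the distance from a vertex of {3,5,3} to the centre of a cell containing it, so it is
    attained for N = Omega and some of the inequalities have no slack. The elements of Gamma that
    bring points to standard position need not lie in N, which is only known to contain Delta and r.
    The points so moved lie on mirrors, or the conjugates used are even, and this leads back to N.
    The traces are forced by the relations, once the images of the generators and of XY, YZ, XYZ are
    known to be nontrivial and the signs of the lifts satisfy X^3 = Y^5 = Z^3 = -1. The matrices 1,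
    X, Y, XY are a basis in every characteristic, which makes the automorphism explicit. *)

(** * Isometries of the hyperboloid model *)

Section Lorentz.
Import Order.TTheory GRing.Theory Num.Theory.
Local Open Scope ring_scope.
Variable R : realType.
Implicit Types (x y z : 'rV[R]_4) (p q : H3 R) (g h : isoH3 R).

Lemma lorentzE x y : lorentz x y =
  - (x 0 0 * y 0 0) + x 0 1 * y 0 1 + x 0 2%:R * y 0 2%:R + x 0 3%:R * y 0 3%:R.
Proof.
rewrite /lorentz !big_ord_recl big_ord0 addr0 !addrA.
by do ?congr (_ + _); do ?congr (_ * _); congr (_ _ _); apply: val_inj.
Qed.

Lemma lorentzC x y : lorentz x y = lorentz y x.
Proof. by rewrite !lorentzE; ring. Qed.

Lemma lorentzDl x y z : lorentz (x + y) z = lorentz x z + lorentz y z.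
Proof. by rewrite !lorentzE !mxE; ring. Qed.

Lemma lorentzZl a x z : lorentz (a *: x) z = a * lorentz x z.
Proof. by rewrite !lorentzE !mxE; ring. Qed.

Lemma lorentzNl x z : lorentz (- x) z = - lorentz x z.
Proof. by rewrite !lorentzE !mxE; ring. Qed.

Lemma lorentz0l z : lorentz 0 z = 0.
Proof. by rewrite !lorentzE !mxE; ring. Qed.

Lemma lorentzDr x y z : lorentz z (x + y) = lorentz z x + lorentz z y.
Proof. by rewrite !lorentzE !mxE; ring. Qed.

Lemma lorentzZr a x z : lorentz z (a *: x) = a * lorentz z x.
Proof. by rewrite !lorentzE !mxE; ring. Qed.

Lemma lorentzNr x z : lorentz z (- x) = - lorentz z x.
Proof. by rewrite !lorentzE !mxE; ring. Qed.

Lemma lorentz0r z : lorentz z 0 = 0.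
Proof. by rewrite lorentzC lorentz0l. Qed.

Definition lorentzL :=
  (lorentzDl, lorentzZl, lorentzNl, lorentz0l, lorentzDr, lorentzZr, lorentzNr, lorentz0r).

Definition metric_mx : 'M[R]_4 := diag_mx (\row_i (if i == 0 then -1 else 1)).

Lemma lorentz_mx x y : lorentz x y = (x *m metric_mx *m y^T) 0 0.
Proof.
rewrite lorentzE /metric_mx mul_mx_diag !mxE !big_ord_recl big_ord0 !mxE /=.
rewrite mulrN1 !mulr1 mulNr addr0 !addrA.
by do ?congr (_ + _); do ?congr (- _); do ?congr (_ * _); congr (_ _ _); apply: val_inj.
Qed.

Lemma metric_mxK : metric_mx *m metric_mx = 1%:M.
Proof.
rewrite /metric_mx mul_diag_mx; apply/matrixP=> i j; rewrite !mxE.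
by case: (i =P j) => [->|]; case: (_ == 0); rewrite ?mulr1n ?mulr0n ?mulr0 ?mulr1 // mulrNN mulr1.
Qed.

Lemma lorentz_nondeg x : (forall y, lorentz x y = 0) -> x = 0.
Proof.
move=> x0; have xJ : x *m metric_mx = 0.
  apply/rowP=> j; rewrite [RHS]mxE.
  by have := x0 (delta_mx 0 j); rewrite lorentz_mx trmx_delta -colE mxE.
by rewrite -[x]mulmx1 -metric_mxK mulmxA xJ mul0mx.
Qed.

Lemma lorentz_ext x y : (forall z, lorentz x z = lorentz y z) -> x = y.
Proof.
by move=> xy; apply/eqP; rewrite -subr_eq0; apply/eqP/lorentz_nondeg => z; rewrite !lorentzL xy subrr.
Qed.

Lemma pt_inj : injective (@pt R).
Proof. by move=> [x hx] [y hy] /= xy; apply: val_inj. Qed.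

Lemma lorentz_pt p : lorentz (pt p) (pt p) = -1.
Proof. by case: p => x /= /andP[/eqP]. Qed.

Lemma pt_gt0 p : 0 < pt p 0 0.
Proof. by case: p => x /= /andP[_]. Qed.

(** Lagrange's identity: the difference of the two sides is the squared length of the cross
    product. *)
Lemma cauchy3 (a b c u v w : R) :
  (a * u + b * v + c * w) ^+ 2 <= (a ^+ 2 + b ^+ 2 + c ^+ 2) * (u ^+ 2 + v ^+ 2 + w ^+ 2).
Proof.
rewrite -subr_ge0 (_ : _ - _ = (a * v - b * u) ^+ 2 + (a * w - c * u) ^+ 2 + (b * w - c * v) ^+ 2); last by ring.
by rewrite !addr_ge0 ?sqr_ge0.
Qed.

(** The spatial parts have squared lengths a^2 - 1 and b^2 - 1, and (ab - 1)^2 exceeds (a^2 - 1)(b^2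
    - 1) by (a - b)^2. *)
Lemma reverse_cauchy3 (a b x y z u v w : R) : 0 < a -> 0 < b ->
  - (a * a) + x * x + y * y + z * z = -1 -> - (b * b) + u * u + v * v + w * w = -1 ->
  - (a * b) + x * u + y * v + z * w <= -1.
Proof.
move=> a0 b0 hp hq; have := cauchy3 x y z u v w.
have -> : x ^+ 2 + y ^+ 2 + z ^+ 2 = a ^+ 2 - 1 by rewrite !expr2; lra.
have -> : u ^+ 2 + v ^+ 2 + w ^+ 2 = b ^+ 2 - 1 by rewrite !expr2; lra.
set s := (_ + _ + _) => hs; have ab0 : 0 < a * b by rewrite mulr_gt0.
have a1 : 1 <= a by nra.
have b1 : 1 <= b by nra.
have ab1 : 1 <= a * b by nra.
have : s <= a * b - 1.
  have [s0|s0] := leP s 0; first by lra.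
  rewrite -(@ler_pXn2r _ 2) ?nnegrE ?subr_ge0 ?(ltW s0) //.
  apply: le_trans hs _; rewrite -subr_ge0.
  by rewrite (_ : _ - _ = (a - b) ^+ 2) ?sqr_ge0 //; ring.
by rewrite /s; lra.
Qed.

(** Like [cauchy3_lb], a case of cosh (s + t) <= 2 cosh s cosh t in the triangle of two points and
    (1, 0, 0, 0), since coordinate 0 is the cosh of the distance to (1, 0, 0, 0). *)
Lemma cauchy3_ub (a b x y z u v w : R) : 0 < b -> 0 < a ->
  - (b * b) + u * u + v * v + w * w = -1 -> - (a * a) + x * x + y * y + z * z = -1 ->
  - (- (a * b) + x * u + y * v + z * w) <= 2 * a * b.
Proof.
move=> b0 a0 hq hp; have := reverse_cauchy3 a0 b0 hp (_ : - (b * b) + (- u) * (- u) + (- v) * (- v) + (- w) * (- w) = -1).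
rewrite !mulrNN => /(_ hq); lra.
Qed.

Lemma cauchy3_lb (a b x y z u v w : R) : 0 < b -> 0 < a ->
  - (b * b) + u * u + v * v + w * w = -1 -> - (a * a) + x * x + y * y + z * z = -1 ->
  a <= 2 * b * - (- (a * b) + x * u + y * v + z * w).
Proof.
move=> b0 a0 hq hp; have := cauchy3 x y z u v w.
have -> : x ^+ 2 + y ^+ 2 + z ^+ 2 = a ^+ 2 - 1 by rewrite !expr2; lra.
have E : u ^+ 2 + v ^+ 2 + w ^+ 2 = b ^+ 2 - 1 by rewrite !expr2; lra.
rewrite E; have b1 : 0 <= b ^+ 2 - 1 by rewrite -E !addr_ge0 ?sqr_ge0.
have -> : - (- (a * b) + x * u + y * v + z * w) = a * b - (x * u + y * v + z * w) by ring.
move: (x * u + y * v + z * w) => s hs.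
suff : 2 * b * s <= a * (2 * b ^+ 2 - 1) by rewrite !expr2; lra.
have [s0|s0] := leP s 0; first by nra.
rewrite -(@ler_pXn2r _ 2) ?nnegrE ?mulr_ge0 ?(ltW s0) ?(ltW b0) ?(ltW a0) //; try lra.
by nra.
Qed.

Lemma lorentz_pt_le p q : lorentz (pt p) (pt q) <= -1.
Proof.
have := lorentz_pt p; have := lorentz_pt q; have := pt_gt0 p; have := pt_gt0 q.
by rewrite !lorentzE => *; exact: reverse_cauchy3.
Qed.

Lemma pt_intro x : lorentz x x = -1 -> 0 < x 0 0 -> exists q, pt q = x.
Proof.
move=> xx x0; have hx : (lorentz x x == -1) && (0 < x ord0 ord0) by rewrite xx eqxx.
by exists (exist (fun x : 'rV[R]_4 => (lorentz x x == -1) && (0 < x ord0 ord0)) x hx).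
Qed.

(** A vector of norm -1 lies on one of two sheets, and on the lower one its product with p would be
    positive. *)
Lemma pt_sheet p x : lorentz x x = -1 -> lorentz (pt p) x < 0 -> exists q, pt q = x.
Proof.
move=> xx px; have [x0|x0|x0] := ltgtP (x 0 0) 0; last 1 first.
- by move: xx; rewrite lorentzE x0; nra.
- have [||q qE] := @pt_intro (- x); rewrite ?lorentzL ?opprK ?mxE ?oppr_gt0 //.
  by have := lorentz_pt_le p q; rewrite qE lorentzNr; lra.
- exact: pt_intro.
Qed.

Lemma arcosh_inj (s t : R) : 1 <= s -> 1 <= t -> arcosh s = arcosh t -> s = t.
Proof.
have step (s' t' : R) : 1 <= s' -> s' < t' -> arcosh s' < arcosh t'.
  move=> s1 st; rewrite /arcosh ltr_ln ?posrE; last 2 first.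
  - by rewrite ltr_pwDl ?sqrtr_ge0 //; lra.
  - by rewrite ltr_pwDl ?sqrtr_ge0 //; lra.
  by rewrite ltr_leD // ler_sqrt; nra.
move=> s1 t1 st.
by case: (ltgtP s t) => // [/(step _ _ s1)|/(step _ _ t1)]; rewrite st ltxx.
Qed.

Lemma iso_lorentz g p q : lorentz (pt (g p)) (pt (g q)) = lorentz (pt p) (pt q).
Proof.
have ge1 p' q' : 1 <= - lorentz (pt p') (pt q') by rewrite lerNr lorentz_pt_le.
exact: oppr_inj (arcosh_inj (ge1 _ _) (ge1 _ _) (iso_dist g p q)).
Qed.

(** Four points of the hyperboloid spanning the space: the origin and three points on the coordinate
    axes, with cosh 5/4 and sinh 3/4. *)
Definition base_mx : 'M[R]_4 := \matrix_(i, j)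
  (if i == 0 then (j == 0)%:R else if j == 0 then 5 / 4 else if i == j then 3 / 4 else 0).

Lemma base_mx_unit : base_mx \in unitmx.
Proof.
rewrite unitmxE det_trig.
  by rewrite !big_ord_recl big_ord0 !mxE /= unitfE; do ?rewrite mulf_neq0 //; lra.
apply/is_trig_mxP => i j ij; rewrite mxE.
case: eqP => [i0|_]; first by rewrite i0 in ij; case: eqP => [j0|//]; rewrite j0 in ij.
by case: eqP => [j0|_]; [rewrite j0 in ij|case: eqP => [e|//]; rewrite e ltnn in ij].
Qed.

Lemma base_row i : exists p, pt p = row i base_mx.
Proof.
by apply: pt_intro; rewrite ?lorentzE !mxE /=;
  case: i => [[|[|[|[|]]]] hi] //=; rewrite ?eqxx /=; lra.
Qed.

Definition base_pt i : H3 R := sval (cid (base_row i)).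

Lemma base_ptE i : pt (base_pt i) = row i base_mx.
Proof. by rewrite /base_pt; case: cid. Qed.

Definition lorentz_mx_group (M : 'M[R]_4) := M *m metric_mx *m M^T = metric_mx.

(** The images of the base points have the same invertible Gram matrix, hence form a basis, and g p
    is recovered from its products with them, which depend linearly on p. *)
Lemma iso_linear g : exists M, lorentz_mx_group M /\ forall p, pt (g p) = pt p *m M.
Proof.
pose C := \matrix_i pt (g (base_pt i)) : 'M[R]_4.
have gramE (x : 'rV[R]_4) (N : 'M[R]_4) i : (x *m metric_mx *m N^T) 0 i = lorentz x (row i N).
  by rewrite lorentz_mx !mxE; apply: eq_bigr => j _; rewrite !mxE.
have gramC : C *m metric_mx *m C^T = base_mx *m metric_mx *m base_mx^T.
  apply/row_matrixP => i; rewrite !row_mul; apply/rowP => j; rewrite !gramE.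
  by rewrite !rowK iso_lorentz !base_ptE.
have uJ : metric_mx \in unitmx by case/mulmx1_unit: metric_mxK.
have uC : C \in unitmx.
  have : base_mx *m metric_mx *m base_mx^T \in unitmx by rewrite !unitmx_mul unitmx_tr base_mx_unit uJ.
  by rewrite -gramC !unitmx_mul => /andP[/andP[]].
pose M := metric_mx *m base_mx^T *m invmx (metric_mx *m C^T).
have uJC : metric_mx *m C^T \in unitmx by rewrite unitmx_mul uJ unitmx_tr.
have gM p : pt (g p) = pt p *m M.
  rewrite /M !mulmxA; apply: (canRL (mulmxK uJC)).
  by rewrite mulmxA; apply/rowP => j; rewrite !gramE rowK iso_lorentz base_ptE.
clearbody M; exists M; split=> //; have CE : C = base_mx *m M.
  by apply/row_matrixP => i; rewrite rowK gM row_mul base_ptE.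
move: gramC; rewrite CE trmx_mul !mulmxA => E.
have uT : base_mx^T \in unitmx by rewrite unitmx_tr base_mx_unit.
have := congr1 (mulmx (invmx base_mx)) (can_inj (mulmxK uT) E).
by rewrite /lorentz_mx_group -!mulmxA !(mulKmx base_mx_unit).
Qed.


Definition iso_mx g : 'M[R]_4 := sval (cid (iso_linear g)).

Lemma iso_mx_lorentz g : lorentz_mx_group (iso_mx g).
Proof. by rewrite /iso_mx; case: cid => M []. Qed.

Lemma pt_iso g p : pt (g p) = pt p *m iso_mx g.
Proof. exact: (svalP (cid (iso_linear g))).2. Qed.

Lemma iso_mx_unique g M : (forall p, pt (g p) = pt p *m M) -> iso_mx g = M.
Proof.
move=> gM; apply: (can_inj (mulKmx base_mx_unit)).
by apply/row_matrixP => i; rewrite !row_mul -base_ptE -pt_iso gM.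
Qed.

Lemma iso_mx_inj : injective iso_mx.
Proof. by move=> g h gh; apply: isoH3_eq => p; apply: pt_inj; rewrite !pt_iso gh. Qed.

Lemma iso_mxM g h : iso_mx (g * h)%g = iso_mx h *m iso_mx g.
Proof. by apply: iso_mx_unique => p; rewrite mulmxA -!pt_iso. Qed.

Lemma iso_mx1 : iso_mx 1%g = 1%:M.
Proof. by apply: iso_mx_unique => p; rewrite mulmx1. Qed.

Definition vact g x := x *m iso_mx g.

Lemma vact_pt g p : vact g (pt p) = pt (g p).
Proof. by rewrite pt_iso. Qed.

Lemma vactM g h x : vact (g * h)%g x = vact g (vact h x).
Proof. by rewrite /vact iso_mxM mulmxA. Qed.

Lemma vact1 x : vact 1%g x = x.
Proof. by rewrite /vact iso_mx1 mulmx1. Qed.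

Lemma vactK g x : vact g^-1%g (vact g x) = x.
Proof. by rewrite -vactM mulVg vact1. Qed.

Lemma vactKV g x : vact g (vact g^-1%g x) = x.
Proof. by rewrite -vactM mulgV vact1. Qed.

Lemma vactD g x y : vact g (x + y) = vact g x + vact g y.
Proof. exact: mulmxDl. Qed.

Lemma vactZ g a x : vact g (a *: x) = a *: vact g x.
Proof. by rewrite /vact scalemxAl. Qed.

Lemma vactN g x : vact g (- x) = - vact g x.
Proof. exact: mulNmx. Qed.

Definition vactL := (vactD, vactZ, vactN).

Lemma vact_lorentz g x y : lorentz (vact g x) (vact g y) = lorentz x y.
Proof.
by rewrite !lorentz_mx /vact trmx_mul -[in RHS](iso_mx_lorentz g) !mulmxA.
Qed.

Lemma vact_lorentzV g x y : lorentz (vact g x) y = lorentz x (vact g^-1%g y).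
Proof. by rewrite -(vact_lorentz g x) vactKV. Qed.

Lemma vact_ext g h : (forall x, vact g x = vact h x) -> g = h.
Proof.
move=> gh; apply: iso_mx_inj; apply/row_matrixP => i.
by rewrite -[iso_mx g]mul1mx -[iso_mx h]mul1mx !row_mul; exact: gh.
Qed.

Definition isometry_mx (M : 'M[R]_4) := forall x y, lorentz (x *m M) (y *m M) = lorentz x y.

Lemma isometry_mx_unit M : isometry_mx M -> M \in unitmx.
Proof.
move=> MJ; rewrite -row_free_unit -kermx_eq0; apply/eqP/row_matrixP => i.
rewrite row0; apply: lorentz_nondeg => y.
by rewrite -MJ -row_mul mulmx_ker row0 lorentz0l.
Qed.

Lemma isometry_mx_fun M p0 p1 : isometry_mx M -> pt p0 *m M = pt p1 ->
  exists f : H3 R -> H3 R, forall p, pt (f p) = pt p *m M.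
Proof.
move=> MJ p01; have ex p : exists q, pt q = pt p *m M.
  apply: (@pt_sheet p1); first by rewrite MJ lorentz_pt.
  by rewrite -p01 MJ (le_lt_trans (lorentz_pt_le _ _)) ?oppr_lt0.
by exists (fun p => sval (cid (ex p))) => p; case: cid.
Qed.

(** A linear isometry preserves the sheet or exchanges it with the opposite one, so a single point
    decides. *)
Lemma iso_of_mx M p0 : isometry_mx M -> lorentz (pt p0) (pt p0 *m M) < 0 ->
  exists g, forall x, vact g x = x *m M.
Proof.
move=> MJ p0M; have uM := isometry_mx_unit MJ.
have [|p1 p01] := pt_sheet _ p0M; first by rewrite MJ lorentz_pt.
have [f fE] := isometry_mx_fun MJ (esym p01).
have [||f' f'E] := @isometry_mx_fun (invmx M) p1 p0.
- by move=> x y; rewrite -[LHS]MJ !mulmxKV.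
- by rewrite p01 mulmxK.
have fK : cancel f f' by move=> p; apply: pt_inj; rewrite f'E fE mulmxK.
have f'K : cancel f' f by move=> p; apply: pt_inj; rewrite fE f'E mulmxKV.
have fd p q : hdist (f p) (f q) = hdist p q by rewrite /hdist !fE MJ.
exists (IsoH3 fd (Bijective fK f'K)) => x; rewrite /vact.
by congr (_ *m _); apply: iso_mx_unique.
Qed.

Lemma det_iso g : \det (iso_mx g) = 1 \/ \det (iso_mx g) = -1.
Proof.
have := congr1 determinant (iso_mx_lorentz g).
rewrite !det_mulmx det_tr mulrAC -[RHS]mul1r => /mulIf; rewrite -expr2 => E.
have dJ : \det metric_mx != 0 by have [] := mulmx1_unit metric_mxK; rewrite unitmxE unitfE.
by move/eqP: (E dJ); rewrite sqrf_eq1 => /orP[]/eqP; [left|right].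
Qed.

Lemma orientation_act g (P : 'I_4 -> H3 R) :
  orientation (fun i => g (P i)) = orientation P * \det (iso_mx g).
Proof.
rewrite /orientation (_ : \matrix_i pt (g (P i)) = (\matrix_i pt (P i)) *m iso_mx g).
  rewrite det_mulmx sgrM; congr (_ * _).
  by case: (det_iso g) => ->; rewrite ?sgr1 ?sgrN1.
by apply/row_matrixP => i; rewrite row_mul !rowK pt_iso.
Qed.

Lemma orientation_preservingE g : @orientation_preserving R g <-> \det (iso_mx g) = 1.
Proof.
split=> [op|d1 P]; last by rewrite orientation_act d1 mulr1.
have := op base_pt; rewrite orientation_act => /eqP.
rewrite -[X in _ == X]mulr1 => /eqP/mulfI; apply.
rewrite sgr_eq0 (_ : (\matrix_i _) = base_mx); last first.
  by apply/row_matrixP => i; rewrite rowK base_ptE.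
by rewrite -unitfE -unitmxE base_mx_unit.
Qed.

Lemma det_isoM g h : \det (iso_mx (g * h)%g) = \det (iso_mx g) * \det (iso_mx h).
Proof. by rewrite iso_mxM det_mulmx mulrC. Qed.

Lemma det_isoV g : \det (iso_mx g^-1%g) = \det (iso_mx g).
Proof.
have := det_isoM g g^-1%g; rewrite mulgV iso_mx1 det1.
by case: (det_iso g) => ->; case: (det_iso g^-1%g) => ->; lra.
Qed.

Lemma det_isoJ g h : \det (iso_mx (g ^ h)%g) = \det (iso_mx g).
Proof.
rewrite conjgE !det_isoM det_isoV.
by case: (det_iso h) => ->; rewrite ?mul1r ?mulr1 // mulN1r mulrN1 opprK.
Qed.

Lemma lorentz_coord0_lb p q : pt p 0 0 <= 2 * pt q 0 0 * - lorentz (pt p) (pt q).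
Proof.
have := lorentz_pt p; have := lorentz_pt q; have := pt_gt0 p; have := pt_gt0 q.
rewrite !lorentzE; exact: cauchy3_lb.
Qed.

Lemma lorentz_coord0_ub p q : - lorentz (pt p) (pt q) <= 2 * pt p 0 0 * pt q 0 0.
Proof.
have := lorentz_pt p; have := lorentz_pt q; have := pt_gt0 p; have := pt_gt0 q.
rewrite !lorentzE; exact: cauchy3_ub.
Qed.

(* A weak form of the triangle inequality, hdist being the arcosh of -lorentz. *)
Lemma lorentz_triangle p q o : - lorentz (pt p) (pt q) <=
  8 * pt o 0 0 ^+ 2 * (lorentz (pt p) (pt o) * lorentz (pt o) (pt q)).
Proof.
apply: le_trans (lorentz_coord0_ub p q) _.
have := lorentz_coord0_lb p o; have := lorentz_coord0_lb q o; have := pt_gt0 p; have := pt_gt0 q.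
rewrite [lorentz (pt q) _]lorentzC; have := pt_gt0 o.
have := lorentz_pt_le p o; have := lorentz_pt_le o q.
move: (lorentz _ _) (lorentz (pt p) _) (pt o 0 0) (pt p 0 0) (pt q 0 0) => u v c a b.
move=> u1 v1 c0 b0 a0 hb ha.
have := ler_pM (ltW a0) (ltW b0) ha hb.
rewrite !expr2; lra.
Qed.

End Lorentz.

(** * The normals of the tetrahedron *)

Section Golden.
Import Order.TTheory GRing.Theory Num.Theory.
Local Open Scope ring_scope.
Variable R : realType.

Definition golden : R := 2 * cos (pi / 5).

Lemma golden_gt0 : 0 < golden.
Proof. by rewrite /golden mulr_gt0 // cos_gt0_pihalf //; have := @pi_gt0 R; lra. Qed.

(* cos (3 pi / 5) = - cos (2 pi / 5) is a cubic equation for cos (pi / 5) with the spurious root -1. *)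
Lemma golden_sqr : golden ^+ 2 = golden + 1.
Proof.
have := golden_gt0; rewrite /golden; set x : R := pi / 5; set c := cos x => c0.
have c2 : cos (x + x) = 2 * c ^+ 2 - 1.
  by rewrite -mulr2n cos_mulr2n /c; ring.
have s2 : sin (x + x) = 2 * sin x * c by rewrite sinD /c; ring.
have e : cos (x + (x + x)) = - cos (x + x).
  have -> : x + (x + x) = pi - (x + x) by rewrite /x; lra.
  by rewrite cosB cospi sinpi; ring.
move: e; rewrite cosD c2 s2 -/c.
have -> : c * (2 * c ^+ 2 - 1) - sin x * (2 * sin x * c) = c * (2 * c ^+ 2 - 1) - 2 * c * sin x ^+ 2 by ring.
rewrite sin2cos2 -/c => e.
have : (c + 1) * (4 * c ^+ 2 - 2 * c - 1) = 0 by nra.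
by move/eqP; rewrite mulf_eq0 => /orP[]/eqP; nra.
Qed.

Lemma golden_cube : golden ^+ 3 = 2 * golden + 1.
Proof. by ring: golden_sqr. Qed.

Lemma golden_pow4 : golden ^+ 4 = 3 * golden + 2.
Proof. by ring: golden_sqr. Qed.

Lemma golden_bounds : 3 / 2 < golden < 5 / 3.
Proof. by have := golden_sqr; have := golden_gt0 => g0 g2; apply/andP; split; nra. Qed.

Lemma cos_pi5 : cos (pi / 5) = golden / 2.
Proof. by rewrite /golden; field. Qed.

Lemma cos_pi3 : cos (pi / 3) = 1 / 2 :> R.
Proof.
set x : R := pi / 3; set c := cos x.
have c0 : 0 < c by rewrite /c /x cos_gt0_pihalf //; have := @pi_gt0 R; lra.
have c2 : cos (x + x) = 2 * c ^+ 2 - 1 by rewrite -mulr2n cos_mulr2n /c; ring.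
have : cos (x + x) = - c.
  have -> : x + x = pi - x by rewrite /x; lra.
  by rewrite cosB cospi sinpi /c; ring.
by rewrite c2; nra.
Qed.

(* For |x| > 1 the junk value of acos x is 0. *)
Lemma cos_dihedral (x theta : R) : theta != pi -> theta = pi - acos x -> x = - cos theta.
Proof.
move=> tpi tE; have [x1|x1] := boolP (-1 <= x <= 1).
  by rewrite tE cosB cospi sinpi acosK ?in_itv //; ring.
exfalso; move/eqP: tpi; apply; rewrite tE acos.unlock getPN ?subr0 // => y [_ yx].
by move: x1; rewrite -yx cos_geN1 cos_le1.
Qed.

End Golden.

Section Frame.
Import Order.TTheory GRing.Theory Num.Theory.
Local Open Scope ring_scope.
Variable R : realType.
Local Notation phi := (golden R).

Lemma biorthogonal_basis (e P : 'I_4 -> 'rV[R]_4) :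
  (forall i j, i != j -> lorentz (e i) (P j) = 0) -> (forall i, lorentz (e i) (P i) != 0) ->
  forall v, v = \sum_i (lorentz v (P i) / lorentz (e i) (P i)) *: e i.
Proof.
move=> eP0 eP1 v; pose E := \matrix_i e i; pose Q := metric_mx R *m (\matrix_i P i)^T.
have gramE x i : (x *m Q) 0 i = lorentz x (P i).
  by rewrite /Q mulmxA lorentz_mx !mxE; apply: eq_bigr => j _; rewrite !mxE.
clearbody Q; pose d := \row_i (lorentz (e i) (P i))^-1.
have EQ : E *m (Q *m diag_mx d) = 1%:M.
  apply/matrixP => i j; rewrite mulmxA mul_mx_diag [LHS]mxE.
  have -> : (E *m Q) i j = lorentz (e i) (P j).
    have eE : e i = row i E by rewrite rowK.
    by rewrite -gramE eE -row_mul [RHS]mxE.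
  rewrite !mxE; case: (i =P j) => [<-|/eqP ij]; first by rewrite divff.
  by rewrite eP0 // mul0r.
rewrite -[LHS]mulmx1 -(mulmx1C EQ) !mulmxA mul_mx_diag.
apply/rowP => k; rewrite mxE summxE; apply: eq_bigr => i _.
by rewrite [X in X * _]mxE gramE !mxE.
Qed.

Definition biorthogonal4 (A B C D : H3 R) (a b c d : 'rV[R]_4) :=
  [/\ outward_normal A B C D a, outward_normal B A C D b,
      outward_normal C A B D c & outward_normal D A B C d].

Lemma biorthogonal4_coord A B C D a b c d : biorthogonal4 A B C D a b c d ->
  forall v, v = (lorentz v (pt A) / lorentz a (pt A)) *: a + (lorentz v (pt B) / lorentz b (pt B)) *: b
              + (lorentz v (pt C) / lorentz c (pt C)) *: c + (lorentz v (pt D) / lorentz d (pt D)) *: d.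
Proof.
case=> [[_ aB aC aD aA] [_ bA bC bD bB] [_ cA cB cD cC] [_ dA dB dC dD]] v.
pose e := nth 0 [:: a; b; c; d]; pose P := nth 0 [:: pt A; pt B; pt C; pt D].
have := @biorthogonal_basis (fun i : 'I_4 => e i) (fun i => P i) _ _ v.
rewrite !big_ord_recl big_ord0 addr0 !addrA; apply.
  by case=> [[|[|[|[|]]]] hi] // [[|[|[|[|]]]] hj].
by case=> [[|[|[|[|]]]] hi] //=; rewrite lt_eqF.
Qed.

Lemma outward_normal_unique A B C D a b c d n : biorthogonal4 A B C D a b c d ->
  [/\ outward_normal A B C D n -> n = a, outward_normal B A C D n -> n = b,
      outward_normal C A B D n -> n = c & outward_normal D A B C n -> n = d].
Proof.
move=> bi; have nE := biorthogonal4_coord bi n.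
have uniq (u : 'rV[R]_4) (s t : R) : lorentz n n = 1 -> lorentz u u = 1 -> s < 0 -> t < 0 ->
    n = (s / t) *: u -> n = u.
  move=> nn uu s0 t0 E; have st : 0 < s / t by rewrite nmulr_rgt0 ?invr_lt0.
  move: nn; rewrite E !lorentzL uu mulr1 => e; suff -> : s / t = 1 by rewrite scale1r.
  by move: (s / t) st e => q; nra.
case: (bi) => [[aa _ _ _ aA] [bb _ _ _ bB] [cc _ _ _ cC] [dd _ _ _ dD]].
by split=> -[nn n1 n2 n3 n4]; move: nE; rewrite n1 n2 n3 !mul0r !scale0r ?add0r ?addr0; exact: uniq.
Qed.

Definition frame353 A B C D a b c d :=
  [/\ biorthogonal4 A B C D a b c d,
      [/\ lorentz a b = - (1 / 2), lorentz b c = - (phi / 2) & lorentz c d = - (1 / 2)]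
    & [/\ lorentz a c = 0, lorentz a d = 0 & lorentz b d = 0]].

(** Each dihedral angle comes with two normals of its own; uniqueness of outward normals identifies
    these twelve vectors with four. *)
Lemma tetrahedron353_frame A B C D : tetrahedron353 A B C D ->
  exists a b c d, frame353 A B C D a b c d.
Proof.
have p0 := @pi_gt0 R.
have ang X Y Z W (k : R) : 1 < k -> dihedral_angle X Y Z W (pi / k) -> exists m n,
    [/\ outward_normal Z X Y W m, outward_normal W X Y Z n & lorentz m n = - cos (pi / k)].
  move=> k1 [m [n [hm hn E]]]; exists m, n; split=> //; apply: cos_dihedral E.
  by rewrite lt_eqF // ltr_pdivrMr; nra.
case=> -[/ang[|b [d [hb hd bd]]]]; first by lra.
move=> /ang[|a' [d1 [ha' hd1 ad]]]; first by lra.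
move=> /ang[|a1 [c1 [ha1 hc1 ac]]]; first by lra.
move=> /ang[|c2 [d2 [hc2 hd2 cd]]]; first by lra.
move=> /ang[|a3 [b3 [ha3 hb3 ab]]]; first by lra.
move=> /ang[|b4 [c4 [hb4 hc4 bc]]]; first by lra.
have bi : biorthogonal4 A B C D a' b c1 d.
  split.
  - by case: ha'.
  - by case: hb.
  - by case: hc1.
  - by case: hd.
exists a', b, c1, d.
have na n : outward_normal A B C D n -> n = a' by have [] := outward_normal_unique n bi.
have nb n : outward_normal B A C D n -> n = b by have [] := outward_normal_unique n bi.
have nc n : outward_normal C A B D n -> n = c1 by have [] := outward_normal_unique n bi.
have nd n : outward_normal D A B C n -> n = d by have [] := outward_normal_unique n bi.
have e1 : d1 = d by apply: nd; case: hd1.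
have e2 : a1 = a' by apply: na; case: ha1.
have e3 : c2 = c1 by apply: nc; case: hc2.
have e4 : d2 = d by apply: nd; case: hd2.
have e5 : a3 = a' by apply: na; case: ha3.
have e6 : b3 = b by apply: nb; case: hb3.
have e7 : b4 = b by apply: nb; case: hb4.
have e8 : c4 = c1 by apply: nc; case: hc4.
subst; split=> //; split; rewrite ?bd ?ad ?ac ?ab ?bc ?cd ?cos_pihalf ?oppr0 ?cos_pi3 ?cos_pi5 //.
Qed.

End Frame.

(** * Reflections and the Coxeter group *)

Section Subgroups.
Local Open Scope group_scope.
Variable G : groupType.
Implicit Types (H K : set G).

Lemma subgroup1 H : is_subgroup H -> H 1.
Proof. by case. Qed.

Lemma subgroupV H x : is_subgroup H -> H x -> H x^-1.
Proof. by move=> [H1 HM] Hx; rewrite -[x^-1]mul1g; exact: HM. Qed.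

Lemma subgroupM H x y : is_subgroup H -> H x -> H y -> H (x * y).
Proof. by move=> sH Hx Hy; rewrite -[y]invgK; apply: sH.2 => //; exact: subgroupV. Qed.

Lemma subgroupJ H x y : is_subgroup H -> H x -> H y -> H (x ^ y).
Proof. by move=> sH Hx Hy; rewrite conjgE; do !apply: subgroupM => //; exact: subgroupV. Qed.

Lemma subgroup_generated_subgroup (S : set G) : is_subgroup (subgroup_generated S).
Proof.
split=> [H [sH _]|x y Sx Sy H HS]; first exact: subgroup1.
by apply: (HS.1).2; [exact: Sx|exact: Sy].
Qed.

Lemma subgroup_generated_ind (S H : set G) :
  is_subgroup H -> (forall x, S x -> H x) -> forall x, subgroup_generated S x -> H x.
Proof. by move=> sH SH x; apply. Qed.

Lemma subgroup_generated_sub (S : set G) x : S x -> subgroup_generated S x.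
Proof. by move=> Sx H [_ ]; apply. Qed.

(* The inverse of a word in involutions is the reversed word. *)
Lemma involution_words (I : Type) (s : I -> G) : (forall i, s i * s i = 1) ->
  is_subgroup [set x | exists l : seq I, x = \prod_(i <- l) s i].
Proof.
move=> ss; split=> [|_ _ [l ->] [m ->]]; first by exists [::]; rewrite big_nil.
exists (l ++ rev m); rewrite big_cat /=; congr (_ * _).
elim: m => [|i m IH]; first by rewrite !big_nil invg1.
rewrite rev_cons -cats1 big_cat big_cons invMg IH /= big_cons big_nil mulg1.
by congr (_ * _); apply: mulg1_eq.
Qed.

(** For infinite K, invariance under g alone would give an inclusion and not an equality. *)
Lemma normaliserP K g : normaliser_of K g <->
  (forall k, K k -> K (k ^ g)) /\ (forall k, K k -> K (k ^ g^-1)).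
Proof.
split=> [E|[h1 h2]].
  split=> k Kk; first by rewrite -E; exists k.
  by move: Kk; rewrite -[in K k]E => -[k' Kk' <-]; rewrite conjgK.
apply/seteqP; split=> [_ [k Kk <-]|k Kk]; first exact: h1.
by exists (k ^ g^-1); [exact: h2|rewrite conjgKV].
Qed.

Lemma normaliser_subgroup K : is_subgroup (normaliser_of K).
Proof.
split=> [|x y /normaliserP[x1 x2] /normaliserP[y1 y2]]; apply/normaliserP.
  by split=> k; rewrite ?invg1 conjg1.
split=> k Kk; rewrite ?invMg ?invgK conjgM.
  by apply: y2; apply: x1.
by apply: x2; apply: y1.
Qed.

End Subgroups.

Section Reflections.
Import Order.TTheory GRing.Theory Num.Theory.
Local Open Scope ring_scope.
Variable R : realType.
Implicit Types (x y n : 'rV[R]_4) (g : isoH3 R).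

Lemma linear_mx (f : 'rV[R]_4 -> 'rV[R]_4) : (forall k x y, f (k *: x + y) = k *: f x + f y) ->
  exists M, forall x, x *m M = f x.
Proof.
move=> fl; pose F : {linear 'rV[R]_4 -> 'rV[R]_4} := HB.pack f (GRing.isLinear.Build _ _ _ _ f fl).
by exists (lin1_mx F) => x; rewrite mul_rV_lin1.
Qed.

Definition is_reflection n g := forall x, vact g x = x - (2 * lorentz x n) *: n.

Lemma reflection_exists n : lorentz n n = 1 -> exists g, is_reflection n g.
Proof.
move=> nn; have [|M ME] := @linear_mx (fun x => x - (2 * lorentz x n) *: n).
  move=> k x y; rewrite !lorentzL scalerBr scalerA mulrDr scalerDl mulrCA.
  by rewrite opprD addrACA.
have [||g gE] := @iso_of_mx R M (base_pt R 0).
- by move=> x y; rewrite !ME !lorentzL nn [lorentz n _]lorentzC; ring.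
- by rewrite ME !lorentzL lorentz_pt; nra.
by exists g => x; rewrite gE ME.
Qed.

Definition reflection n : isoH3 R := xget 1%g [set g | is_reflection n g].

Lemma reflectionE n x : lorentz n n = 1 -> vact (reflection n) x = x - (2 * lorentz x n) *: n.
Proof. by move=> nn; have [g gn] := reflection_exists nn; exact: (xgetI _ gn). Qed.

Lemma reflectionDE n x : lorentz n n = 1 -> vact (reflection n) x = x + (- (2 * lorentz x n)) *: n.
Proof. by move=> nn; rewrite reflectionE // scaleNr. Qed.

Lemma reflection_sqr n : lorentz n n = 1 -> (reflection n * reflection n = 1)%g.
Proof.
move=> nn; apply: vact_ext => x; rewrite vactM vact1 !reflectionE // !lorentzL nn mulr1.
by rewrite -[RHS]addr0 -addrA; congr (_ + _); rewrite -opprD -scalerDl; apply/eqP;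
  rewrite oppr_eq0 (_ : _ + _ = 0) ?scale0r //; ring.
Qed.

Lemma reflectionV n : lorentz n n = 1 -> ((reflection n)^-1 = reflection n)%g.
Proof. by move=> /reflection_sqr; exact: mulg1_eq. Qed.

Lemma reflectionJ n g : lorentz n n = 1 -> (g * reflection n * g^-1 = reflection (vact g n))%g.
Proof.
move=> nn; have gnn : lorentz (vact g n) (vact g n) = 1 by rewrite vact_lorentz.
apply: vact_ext => x; rewrite !vactM !reflectionE // !vactL vactKV.
by rewrite -(vact_lorentz g (vact g^-1%g x)) vactKV.
Qed.

Lemma reflection_lorentz n x y : lorentz n n = 1 ->
  lorentz (vact (reflection n) x) y = lorentz x (vact (reflection n) y).
Proof. by move=> nn; rewrite vact_lorentzV reflectionV. Qed.

Lemma reflection_fix n x : lorentz n n = 1 -> lorentz x n = 0 -> vact (reflection n) x = x.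
Proof. by move=> nn xn; rewrite reflectionE // xn mulr0 scale0r subr0. Qed.

Lemma reflection_commute m n : lorentz m m = 1 -> lorentz n n = 1 -> lorentz m n = 0 ->
  (reflection m * reflection n = reflection n * reflection m)%g.
Proof.
move=> mm nn mn; apply: (mulIg (reflection m)^-1%g); rewrite reflectionJ //.
by rewrite reflection_fix ?mulgK // lorentzC.
Qed.

(** The matrix determinant lemma, from two triangular factorisations of one block matrix. *)
Lemma det_rank1_update (m : nat) (u : 'cV[R]_m) (v : 'rV[R]_m) :
  \det (1%:M - u *m v) = 1 - (v *m u) 0 0.
Proof.
have E : block_mx 1%:M v u 1%:M = block_mx 1%:M 0 u 1%:M *m block_mx 1%:M v 0 (1%:M - u *m v).
  by rewrite mulmx_block !(mul1mx, mulmx1, mul0mx, mulmx0, addr0, add0r) addrC subrK.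
have F : block_mx 1%:M v u 1%:M = block_mx (1%:M - v *m u) v 0 1%:M *m block_mx 1%:M 0 u 1%:M.
  by rewrite mulmx_block !(mul1mx, mulmx1, mul0mx, mulmx0, addr0, add0r) subrK.
have := congr1 determinant E; rewrite F !det_mulmx !det_lblock !det_ublock !det1 !mulr1 !mul1r => <-.
by rewrite det_mx11 !mxE eqxx.
Qed.

Lemma rank1_update_row x w n : x *m (1%:M - (metric_mx R *m w^T) *m n) = x - lorentz x w *: n.
Proof.
rewrite mulmxBr mulmx1 !mulmxA; congr (_ - _).
by rewrite [X in X *m _]mx11_scalar -lorentz_mx mul_scalar_mx.
Qed.

Lemma det_rank1_lorentz w n : \det (1%:M - (metric_mx R *m w^T) *m n) = 1 - lorentz n w.
Proof. by rewrite det_rank1_update mulmxA -lorentz_mx. Qed.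

Lemma det_reflection n : lorentz n n = 1 -> \det (iso_mx (reflection n)) = -1.
Proof.
move=> nn; have -> : iso_mx (reflection n) = 1%:M - (metric_mx R *m (2 *: n)^T) *m n.
  by apply: iso_mx_unique => p; rewrite -vact_pt reflectionE // rank1_update_row lorentzZr.
by rewrite det_rank1_lorentz lorentzZr nn; ring.
Qed.

End Reflections.

(** * Vertices in the basis of the normals *)

Section FrameGeometry.
Import Order.TTheory GRing.Theory Num.Theory.
Local Open Scope ring_scope.
Variables (R : realType) (A B C D : H3 R) (a b c d : 'rV[R]_4).
Hypothesis fr : frame353 A B C D a b c d.
Local Notation phi := (golden R).
Implicit Types (v : 'rV[R]_4).

Let gram1 : [/\ lorentz a a = 1, lorentz b b = 1, lorentz c c = 1 & lorentz d d = 1].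
Proof. by case: fr => -[[aa _ _ _ _] [bb _ _ _ _] [cc _ _ _ _] [dd _ _ _ _]]. Qed.

Lemma frame_gram :
  ((lorentz a a = 1) * (lorentz b b = 1) * (lorentz c c = 1) * (lorentz d d = 1)
  * (lorentz a b = - (1 / 2)) * (lorentz b a = - (1 / 2)) * (lorentz b c = - (phi / 2))
  * (lorentz c b = - (phi / 2)) * (lorentz c d = - (1 / 2)) * (lorentz d c = - (1 / 2))
  * (lorentz a c = 0) * (lorentz c a = 0) * (lorentz a d = 0) * (lorentz d a = 0)
  * (lorentz b d = 0) * (lorentz d b = 0))%type.
Proof.
case: gram1 => aa bb cc dd; case: fr => _ [ab bc cd] [ac ad bd].
by do 15?split; rewrite // lorentzC.
Qed.

Lemma frame_incidence :
  ((lorentz (pt A) b = 0) * (lorentz (pt A) c = 0) * (lorentz (pt A) d = 0)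
  * (lorentz (pt B) a = 0) * (lorentz (pt B) c = 0) * (lorentz (pt B) d = 0)
  * (lorentz (pt C) a = 0) * (lorentz (pt C) b = 0) * (lorentz (pt C) d = 0)
  * (lorentz (pt D) a = 0) * (lorentz (pt D) b = 0) * (lorentz (pt D) c = 0))%type.
Proof.
case: fr => -[[_ aB aC aD aA] [_ bA bC bD bB] [_ cA cB cD cC] [_ dA dB dC dD]] _ _.
by do 11?split; rewrite // lorentzC.
Qed.

Lemma frame_coord v : exists x y z w, v = x *: a + y *: b + z *: c + w *: d.
Proof. by case: fr => bi _ _; rewrite (biorthogonal4_coord bi v); do 4!eexists. Qed.

Lemma frame_ext u v : lorentz u a = lorentz v a -> lorentz u b = lorentz v b ->
  lorentz u c = lorentz v c -> lorentz u d = lorentz v d -> u = v.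
Proof.
move=> ua ub uc ud; apply: lorentz_ext => w.
by have [x [y [z [t ->]]]] := frame_coord w; rewrite !lorentzL ua ub uc ud.
Qed.

(* By [frame_A] the a-coordinate of pt A in the basis of normals is 1 / lambda; lambda is sinh of the height at A. *)
Definition frame_lambda := - lorentz (pt A) a.
Local Notation lam := frame_lambda.

Lemma frame_lambda_gt0 : 0 < lam.
Proof. by case: fr => -[[_ _ _ _ aA] _ _ _] _ _; rewrite /lam lorentzC oppr_gt0. Qed.

Let phi2 : phi ^+ 2 = phi + 1. Proof. exact: golden_sqr. Qed.

Let frame_A_lambda : lam ^+ 2 = (3 * phi - 1) / 4 /\
  lam *: pt A = a + (3 / 2 * (phi + 1)) *: b + (2 * phi + 1) *: c + (phi + 1 / 2) *: d.
Proof.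
have [x [y [z [w E]]]] := frame_coord (pt A).
have eb : lorentz (pt A) b = 0 by rewrite frame_incidence.
have ec : lorentz (pt A) c = 0 by rewrite frame_incidence.
have ed : lorentz (pt A) d = 0 by rewrite frame_incidence.
have ea : lorentz (pt A) a = - lam by rewrite /frame_lambda opprK.
have : lorentz (pt A) (pt A) = -1 by rewrite lorentz_pt.
rewrite [X in lorentz _ X]E !lorentzL ea eb ec ed => e1.
move: ea eb ec ed; rewrite E !lorentzL !frame_gram => ea eb ec ed.
have zE : z = 2 * w by lra.
(* Division in Q(phi) is multiplication by an inverse: phi (phi - 1) = 1 here, (phi + 1/2)(4 phi -
   6) = 1 for [wE]. *)
have yE : y = 3 * (phi - 1) * w.
  have -> : y = (phi ^+ 2 - phi) * y by rewrite phi2; ring.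
  rewrite (_ : _ * y = (phi - 1) * (phi * y)); last by ring.
  by rewrite (_ : phi * y = 3 * w); [ring|lra].
have wE : w = (phi + 1 / 2) * x.
  have -> : x = (4 * phi - 6) * w by rewrite yE zE in eb; lra.
  rewrite (_ : _ * _ = (4 * phi ^+ 2 - 4 * phi - 3) * w); last by field.
  by rewrite phi2; ring.
have lx : lam * x = 1 by lra.
have {}yE : y = 3 / 2 * (phi + 1) * x.
  rewrite yE wE (_ : _ * _ = 3 * (phi ^+ 2 - phi / 2 - 1 / 2) * x); last by field.
  by rewrite phi2; field.
split.
  have -> : lam ^+ 2 = lam * lam by rewrite expr2.
  have : lam = ((3 * phi - 1) / 4) * x by rewrite yE in ea; lra.
  by move=> lE; rewrite [X in _ * X]lE mulrCA lx mulr1.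
have ly : lam * y = 3 / 2 * (phi + 1) by rewrite yE mulrCA lx mulr1.
have lw : lam * w = phi + 1 / 2 by rewrite wE mulrCA lx mulr1.
have lz : lam * z = 2 * phi + 1 by rewrite zE mulrCA lw; field.
by rewrite !scalerDr !scalerA lx scale1r ly lz lw.
Qed.

Lemma frame_lambda_sqr : lam ^+ 2 = (3 * phi - 1) / 4.
Proof. by case: frame_A_lambda. Qed.

Lemma frame_A : lam *: pt A = a + (3 / 2 * (phi + 1)) *: b + (2 * phi + 1) *: c + (phi + 1 / 2) *: d.
Proof. by case: frame_A_lambda. Qed.

End FrameGeometry.

(** The Coxeter diagram is a palindrome, so computations at A carry over to D. *)
Lemma frame353_rev (R : realType) (A B C D : H3 R) a b c d :
  frame353 A B C D a b c d -> frame353 D C B A d c b a.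
Proof.
case=> -[hA hB hC hD] [ab bc cd] [ac ad bd].
split; first by split; [case: hD|case: hC|case: hB|case: hA] => *; split.
  by split; rewrite lorentzC.
by split; rewrite lorentzC.
Qed.

Section FrameSymmetry.
Import Order.TTheory GRing.Theory Num.Theory.
Local Open Scope ring_scope.
Variables (R : realType) (A B C D : H3 R) (a b c d : 'rV[R]_4).
Hypothesis fr : frame353 A B C D a b c d.
Local Notation phi := (golden R).
Local Notation lam := (frame_lambda A a).

Lemma frame_lambda_rev : frame_lambda D d = lam.
Proof.
have l0 := frame_lambda_gt0 fr; have l0' := frame_lambda_gt0 (frame353_rev fr).
by apply/eqP; rewrite -(eqrXn2 (n := 2)) ?ltW // (frame_lambda_sqr fr) (frame_lambda_sqr (frame353_rev fr)).
Qed.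

Lemma frame_D : lam *: pt D = (phi + 1 / 2) *: a + (2 * phi + 1) *: b + (3 / 2 * (phi + 1)) *: c + d.
Proof.
rewrite -frame_lambda_rev (frame_A (frame353_rev fr)).
by rewrite addrC (addrC d) [_ + d + _]addrAC (addrC _ (_ *: b)) !addrA.
Qed.

End FrameSymmetry.

(** * Relations between two reflections *)

Section CoxeterRelations.
Import Order.TTheory GRing.Theory Num.Theory.
Local Open Scope ring_scope.
Variable R : realType.
Implicit Types (m n : 'rV[R]_4).
Local Notation phi := (golden R).

Lemma reflections_order2 m n : lorentz m m = 1 -> lorentz n n = 1 -> lorentz m n = 0 ->
  ((reflection m * reflection n) ^+ 2 = 1)%g.
Proof.
move=> mm nn mn; rewrite expg2 {1}reflection_commute // mulgA -(mulgA (reflection n)).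
by rewrite reflection_sqr // mulg1 reflection_sqr.
Qed.

(** The cube is the product of two conjugates, of one reflection by the other and conversely, and
    both are the reflection in m + n. *)
Lemma reflections_order3 m n : lorentz m m = 1 -> lorentz n n = 1 -> lorentz m n = - (1 / 2) ->
  ((reflection m * reflection n) ^+ 3 = 1)%g.
Proof.
move=> mm nn mn; have nm : lorentz n m = - (1 / 2) by rewrite lorentzC.
have e : vact (reflection m) n = vact (reflection n) m.
  have k1 : - (2 * - (1 / 2)) = 1 :> R by field.
  by rewrite !reflectionDE // mn nm !k1 !scale1r addrC.
have -> : ((reflection m * reflection n) ^+ 3 = (reflection m * reflection n * (reflection m)^-1)
    * (reflection n * reflection m * (reflection n)^-1))%g.
  by rewrite !reflectionV // !expgS expg0 mulg1 !mulgA.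
by rewrite !reflectionJ // e reflection_sqr // vact_lorentz.
Qed.

(** As for order 3, the power is a product of two conjugate reflections; both have the root phi (m +
    n). *)
Lemma reflections_order5 m n : lorentz m m = 1 -> lorentz n n = 1 -> lorentz m n = - (phi / 2) ->
  ((reflection m * reflection n) ^+ 5 = 1)%g.
Proof.
move=> mm nn mn; have nm : lorentz n m = - (phi / 2) by rewrite lorentzC.
have act2 (u v : 'rV[R]_4) : lorentz u u = 1 -> lorentz v v = 1 -> lorentz u v = - (phi / 2) ->
    vact (reflection u * reflection v)%g u = phi *: (u + v).
  move=> uu vv uv; have vu : lorentz v u = - (phi / 2) by rewrite lorentzC.
  have k1 : - (2 * - (phi / 2)) = phi by field.
  have E : vact (reflection v) u = u + phi *: v by rewrite reflectionDE // uv k1.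
  rewrite vactM E !vactL !reflectionDE // uu vu k1.
  rewrite !scalerDr scalerA addrA addrAC -{1}[u]scale1r -!scalerDl.
  by congr (_ *: _ + _); have := golden_sqr R; lra.
have -> : ((reflection m * reflection n) ^+ 5 =
    (reflection m * reflection n * reflection m * (reflection m * reflection n)^-1)
    * (reflection n * reflection m * reflection n * (reflection n * reflection m)^-1))%g.
  by rewrite !invMg !reflectionV // !expgS expg0 mulg1 !mulgA.
rewrite !reflectionJ // !act2 // (addrC n) -(act2 m n) // reflection_sqr //.
by rewrite vact_lorentz.
Qed.

End CoxeterRelations.

(** * Gamma and Delta as groups of words *)

Section Groups.
Import Order.TTheory GRing.Theory Num.Theory.
Local Open Scope ring_scope.
Variables (R : realType) (A B C D : H3 R) (a b c d : 'rV[R]_4).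
Hypothesis fr : frame353 A B C D a b c d.
Local Notation phi := (golden R).
Local Notation lam := (frame_lambda A a).
Local Notation Gam := (Gamma A B C D).
Local Notation Del := (Delta A B C D).
Local Notation ra := (reflection a).
Local Notation rb := (reflection b).
Local Notation rc := (reflection c).
Local Notation rd := (reflection d).

Definition frame_gen (i : 'I_4) : isoH3 R := reflection (nth 0 [:: a; b; c; d] i).

Lemma frame_gen_unit (i : 'I_4) : let n := nth 0 [:: a; b; c; d] i in lorentz n n = 1.
Proof. by case: i => [[|[|[|[|]]]] hi] //=; rewrite (frame_gram fr). Qed.

Lemma face_reflectionE W X Y Z (n : 'rV[R]_4) g :
  outward_normal W X Y Z n -> (forall m, outward_normal W X Y Z m -> m = n) ->
  face_reflection W X Y Z g <-> g = reflection n.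
Proof.
move=> hn nu; have nn : lorentz n n = 1 by case: hn.
split=> [[m /nu-> gm]|->].
  by apply: isoH3_eq => x; apply: pt_inj; rewrite gm -[RHS]vact_pt reflectionE.
by exists n => // x; rewrite -vact_pt reflectionE.
Qed.

Lemma frame_gammaE : Gam = subgroup_generated [set g | exists i, g = frame_gen i].
Proof.
case: fr => bi _ _; case: (bi) => ha hb hc hd.
have Ea g := @face_reflectionE A B C D a g ha (fun m => let: And4 h _ _ _ := outward_normal_unique m bi in h).
have Eb g := @face_reflectionE B A C D b g hb (fun m => let: And4 _ h _ _ := outward_normal_unique m bi in h).
have Ec g := @face_reflectionE C A B D c g hc (fun m => let: And4 _ _ h _ := outward_normal_unique m bi in h).
have Ed g := @face_reflectionE D A B C d g hd (fun m => let: And4 _ _ _ h := outward_normal_unique m bi in h).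
congr subgroup_generated; apply/seteqP; split=> g /=.
  case=> [/Ea->|/Eb->|/Ec->|/Ed->].
  - by exists (Ordinal (isT : (0 < 4)%N)).
  - by exists (Ordinal (isT : (1 < 4)%N)).
  - by exists (Ordinal (isT : (2 < 4)%N)).
  - by exists (Ordinal (isT : (3 < 4)%N)).
case=> -[[|[|[|[|]]]] hi] // ->; rewrite /frame_gen /=.
- by constructor 1; apply/Ea.
- by constructor 2; apply/Eb.
- by constructor 3; apply/Ec.
- by constructor 4; apply/Ed.
Qed.

Lemma Gamma_subgroup : is_subgroup Gam.
Proof. exact: subgroup_generated_subgroup. Qed.

Lemma Gamma_ind (H : set (isoH3 R)) : is_subgroup H -> H ra -> H rb -> H rc -> H rd ->
  forall x, Gam x -> H x.
Proof.
move=> sH Ha Hb Hc Hd; rewrite frame_gammaE; apply: subgroup_generated_ind => // _ [[i hi] ->].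
by case: i hi => [|[|[|[|]]]].
Qed.

Lemma Gamma_gens : [/\ Gam ra, Gam rb, Gam rc & Gam rd].
Proof.
rewrite frame_gammaE; split; apply: subgroup_generated_sub.
- by exists (Ordinal (isT : (0 < 4)%N)).
- by exists (Ordinal (isT : (1 < 4)%N)).
- by exists (Ordinal (isT : (2 < 4)%N)).
- by exists (Ordinal (isT : (3 < 4)%N)).
Qed.

Lemma Delta_det x : Del x <-> Gam x /\ \det (iso_mx x) = 1.
Proof. by split=> -[Gx /orientation_preservingE]. Qed.

Lemma Delta_subgroup : is_subgroup Del.
Proof.
have sG := Gamma_subgroup.
split=> [|x y /Delta_det[Gx dx] /Delta_det[Gy dy]]; apply/Delta_det.
  by rewrite iso_mx1 det1; split=> //; exact: subgroup1.
by rewrite det_isoM det_isoV dx dy mulr1; split=> //; apply: sG.2.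
Qed.

Lemma reflections_Delta m n : lorentz m m = 1 -> lorentz n n = 1 ->
  Gam (reflection m) -> Gam (reflection n) -> Del (reflection m * reflection n)%g.
Proof.
move=> mm nn Gm Gn; apply/Delta_det; rewrite det_isoM !det_reflection // mulrNN mulr1.
by split=> //; exact: subgroupM Gamma_subgroup Gm Gn.
Qed.

Lemma Delta_gens : [/\ Del (ra * rb)%g, Del (rb * rc)%g & Del (rc * rd)%g].
Proof. by have [Ga Gb Gc Gd] := Gamma_gens; split; apply: reflections_Delta; rewrite ?(frame_gram fr). Qed.

Lemma Delta_conj x g : Del x -> Gam g -> Del (x ^ g)%g.
Proof.
move=> /Delta_det[Gx dx] Gg; apply/Delta_det; rewrite det_isoJ; split=> //.
exact: subgroupJ Gamma_subgroup Gx Gg.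
Qed.

Lemma Gamma_Delta x n : lorentz n n = 1 -> Gam (reflection n) -> Gam x ->
  Del x \/ Del (x * reflection n)%g.
Proof.
move=> nn Gn Gx; case: (det_iso x) => dx; [left|right]; apply/Delta_det; first by [].
rewrite det_isoM dx det_reflection // mulrNN mulr1; split=> //.
exact: subgroupM Gamma_subgroup Gx Gn.
Qed.

Lemma Gamma_word x : Gam x -> exists l : seq 'I_4, x = (\prod_(i <- l) frame_gen i)%g.
Proof.
rewrite frame_gammaE; move: x.
apply: (@subgroup_generated_ind _ _ [set x | exists l : seq 'I_4, x = (\prod_(i <- l) frame_gen i)%g])
  => [|_ [i ->]].
  by apply: involution_words => i; exact: reflection_sqr (frame_gen_unit i).
by exists [:: i]; rewrite big_cons big_nil mulg1.
Qed.

(** Elements of determinant 1 are words of even length, hence products of pairs of generators, and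
    every pair is a product of the three rotations and their inverses. *)
Lemma Delta_ind (H : set (isoH3 R)) : is_subgroup H ->
  H (ra * rb)%g -> H (rb * rc)%g -> H (rc * rd)%g -> forall x, Del x -> H x.
Proof.
move=> sH Hab Hbc Hcd x /Delta_det[/Gamma_word[l ->]].
have sq i : (frame_gen i * frame_gen i = 1)%g by exact: reflection_sqr (frame_gen_unit i).
have step (m n p : isoH3 R) : (n * n = 1)%g -> H (m * n)%g -> H (n * p)%g -> H (m * p)%g.
  by move=> nn Hmn Hnp; rewrite -[p]mul1g -nn -(mulgA n) (mulgA m); exact: subgroupM.
have bb := reflection_sqr (frame_gen_unit (Ordinal (isT : (1 < 4)%N))).
have cc := reflection_sqr (frame_gen_unit (Ordinal (isT : (2 < 4)%N))).
have Hac : H (ra * rc)%g by apply: step Hbc.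
have Had : H (ra * rd)%g by apply: step Hcd.
have Hbd : H (rb * rd)%g by apply: step Hcd.
have lt (i j : 'I_4) : (i < j)%N -> H (frame_gen i * frame_gen j)%g.
  rewrite /frame_gen; case: i j => [[|[|[|[|i]]]] hi] [[|[|[|[|j]]]] hj] ij;
    solve [by exfalso; clear -hi; move: hi | by exfalso; clear -hj; move: hj
      | by exfalso; clear -ij; move: ij | exact: Hab | exact: Hac | exact: Had | exact: Hbc | exact: Hbd | exact: Hcd].
have pairs i j : H (frame_gen i * frame_gen j)%g.
  case: (ltngtP i j) => [/lt //|/lt /(subgroupV sH)|/val_inj ->].
    by rewrite invMg !(mulg1_eq (sq _)).
  by rewrite sq; exact: subgroup1.
have [n] := ubnP (size l); elim: n l => // n IH [|i [|j l]] /=.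
- by rewrite big_nil => _ _; exact: subgroup1.
(* A single remaining letter would have determinant -1. *)
- by rewrite big_cons big_nil mulg1 det_reflection ?frame_gen_unit //; lra.
rewrite ltnS => ln; rewrite !big_cons mulgA det_isoM.
have -> : \det (iso_mx (frame_gen i * frame_gen j)%g) = 1.
  by rewrite det_isoM !det_reflection ?frame_gen_unit // mulrNN mulr1.
by rewrite mul1r => dl; apply: subgroupM => //; apply: IH => //; apply: ltn_trans ln.
Qed.

End Groups.

(** * The half-turn exchanging A and D *)

Section HalfTurn.
Import Order.TTheory GRing.Theory Num.Theory.
Local Open Scope ring_scope.
Variables (R : realType) (A B C D : H3 R) (a b c d : 'rV[R]_4).
Hypothesis fr : frame353 A B C D a b c d.
Local Notation phi := (golden R).
Local Notation lam := (frame_lambda A a).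
Local Notation Gam := (Gamma A B C D).
Local Notation Del := (Delta A B C D).
Local Notation ra := (reflection a).
Local Notation rb := (reflection b).
Local Notation rc := (reflection c).
Local Notation rd := (reflection d).

Definition half_turn r :=
  [/\ vact r a = d, vact r b = c, vact r c = b, vact r d = a & \det (iso_mx r) = 1].

(* r is the composite of the linear maps exchanging a with d and b with c, each of determinant -1. *)
Lemma half_turn_exists : exists r, half_turn r.
Proof.
have [bi _ _] := fr; case: (bi) => -[_ _ _ _ aA] [_ bA bC bD bB] [_ cA cB cD cC] [_ dA dB dC _].
have l0 := frame_lambda_gt0 fr.
(* [w1] and [w2] are the functionals with values 1, -1 on the exchanged pair of normals and 0 on the
   other pair; they are combinations of vertices, which are dual to the normals up to scale. *)
pose w1 := - lam^-1 *: (pt A - pt D); pose v1 := a - d.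
pose w2 := (lorentz b (pt B))^-1 *: pt B - (lorentz c (pt C))^-1 *: pt C; pose v2 := b - c.
have eaA : lorentz (pt A) a = - lam by rewrite /frame_lambda opprK.
have edD : lorentz (pt D) d = - lam by rewrite -(frame_lambda_rev fr) /frame_lambda opprK.
have aw1 : lorentz a w1 = 1.
  by rewrite lorentzC !lorentzL eaA (frame_incidence fr); field; rewrite gt_eqF.
have dw1 : lorentz d w1 = -1.
  by rewrite lorentzC !lorentzL edD (frame_incidence fr); field; rewrite gt_eqF.
have bw1 : lorentz b w1 = 0 by rewrite lorentzC !lorentzL !(frame_incidence fr); ring.
have cw1 : lorentz c w1 = 0 by rewrite lorentzC !lorentzL !(frame_incidence fr); ring.
have bw2 : lorentz b w2 = 1 by rewrite !lorentzL bC mulr0 subr0 mulVf // lt_eqF.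
have cw2 : lorentz c w2 = -1 by rewrite !lorentzL cB mulr0 sub0r mulVf // lt_eqF.
have aw2 : lorentz a w2 = 0 by rewrite lorentzC !lorentzL !(frame_incidence fr); ring.
have dw2 : lorentz d w2 = 0 by rewrite lorentzC !lorentzL !(frame_incidence fr); ring.
pose M := (1%:M - (metric_mx R *m w1^T) *m v1) *m (1%:M - (metric_mx R *m w2^T) *m v2).
have ME x : x *m M = x - lorentz x w1 *: v1 - lorentz (x - lorentz x w1 *: v1) w2 *: v2.
  by rewrite mulmxA !rank1_update_row.
have va : a - v1 = d by rewrite opprB addrC subrK.
have vd : d + v1 = a by rewrite addrC subrK.
have vb : b - v2 = c by rewrite opprB addrC subrK.
have vc : c + v2 = b by rewrite addrC subrK.
have Ma : a *m M = d by rewrite ME aw1 scale1r va dw2 scale0r subr0.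
have Md : d *m M = a by rewrite ME dw1 scaleN1r opprK vd aw2 scale0r subr0.
have Mb : b *m M = c by rewrite ME bw1 scale0r subr0 bw2 scale1r vb.
have Mc : c *m M = b by rewrite ME cw1 scale0r subr0 cw2 scaleN1r opprK vc.
have iM : isometry_mx M.
  move=> u v; have [x [y [z [t ->]]]] := frame_coord fr u; have [x' [y' [z' [t' ->]]]] := frame_coord fr v.
  rewrite !mulmxDl -!scalemxAl Ma Mb Mc Md !lorentzL !(frame_gram fr); ring.
have MA : pt A *m M = pt D.
  apply: (scalerI (lt0r_neq0 l0)); rewrite scalemxAl (frame_A fr) (frame_D fr).
  rewrite !mulmxDl -!scalemxAl Ma Mb Mc Md.
  by rewrite addrC [X in _ + X]addrC [X in _ + (_ + X)]addrC !addrA.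
have [|r rE] := @iso_of_mx R M A iM.
  by rewrite MA (le_lt_trans (lorentz_pt_le _ _)) ?oppr_lt0.
exists r; rewrite /half_turn !rE; split=> //.
have -> : iso_mx r = M by apply: iso_mx_unique => p; rewrite -vact_pt rE.
by rewrite det_mulmx !det_rank1_lorentz !lorentzDl !lorentzNl aw1 dw1 bw2 cw2; ring.
Qed.

Variable r : isoH3 R.
Hypothesis hr : half_turn r.

Lemma half_turn_sqr : (r * r = 1)%g.
Proof.
case: hr => rA rB rC rD _; apply: vact_ext => v; rewrite vactM vact1.
by have [x [y [z [t ->]]]] := frame_coord fr v; rewrite !vactL !(rA, rB, rC, rD).
Qed.

Lemma half_turnV : (r^-1 = r)%g.
Proof. exact: mulg1_eq half_turn_sqr. Qed.

Lemma half_turn_conj n : lorentz n n = 1 -> (reflection n ^ r = reflection (vact r n))%g.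
Proof. by move=> nn; rewrite -reflectionJ // half_turnV conjgE half_turnV !mulgA. Qed.

Lemma half_turn_gens : [/\ ra ^ r = rd, rb ^ r = rc, rc ^ r = rb & rd ^ r = ra]%g.
Proof. by case: hr => rA rB rC rD _; split; rewrite half_turn_conj ?(frame_gram fr) // ?rA ?rB ?rC ?rD. Qed.

Lemma half_turn_A : vact r (pt A) = pt D.
Proof.
case: hr => rA rB rC rD _; apply: (scalerI (lt0r_neq0 (frame_lambda_gt0 fr))).
rewrite -vactZ (frame_A fr) (frame_D fr) !vactL rA rB rC rD.
by rewrite addrC [X in _ + X]addrC [X in _ + (_ + X)]addrC !addrA.
Qed.

Lemma half_turn_Gamma x : Gam x -> Gam (x ^ r)%g.
Proof.
have sG := Gamma_subgroup A B C D; have [Ga Gb Gc Gd] := Gamma_gens fr.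
have [ea eb ec ed] := half_turn_gens.
apply: (Gamma_ind fr (H := [set x | Gam (x ^ r)%g])); rewrite /= ?ea ?eb ?ec ?ed //.
split=> [|y z Gy Gz] /=; first by rewrite conj1g; exact: subgroup1.
by rewrite conjMg conjVg; apply: sG.2.
Qed.

Lemma half_turn_Delta x : Del x -> Del (x ^ r)%g.
Proof.
by move=> /Delta_det[Gx dx]; apply/Delta_det; rewrite det_isoJ; split=> //; exact: half_turn_Gamma.
Qed.

Lemma half_turn_Omega : Omega A B C D r.
Proof. by apply/normaliserP; rewrite half_turnV; split; exact: half_turn_Gamma. Qed.

End HalfTurn.

(** * Discreteness *)

Section FiniteCodes.
Import Order.TTheory GRing.Theory Num.Theory.
Local Open Scope ring_scope.

(** Codes are attached by a relation since it is enough that each element has some code and that no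
    code serves two elements. *)
Lemma finite_code_fun (T : choiceType) (I : finType) (U : eqType) (X : set T) (Y : set U)
    (r : T -> (I -> U) -> Prop) : finite_set Y ->
  (forall x, X x -> exists2 f, (forall i, Y (f i)) & r x f) ->
  (forall x x' f, X x -> X x' -> r x f -> r x' f -> x = x') -> finite_set X.
Proof.
move=> /finite_seqP[s ->] ex inj.
have [->|/set0P[x0 Xx0]] := eqVneq X set0; first exact: finite_set0.
pose dec (k : {ffun I -> 'I_(size s)}) (i : I) := tnth (in_tuple s) (k i).
apply: (@sub_finite_set _ _ ((fun k => xget x0 [set x | X x /\ r x (dec k)]) @` [set: {ffun I -> 'I_(size s)}])).
  move=> x Xx; have [f fs rf] := ex x Xx.
  have idx i : (index (f i) s < size s)%N by rewrite index_mem; exact: fs.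
  exists [ffun i => Ordinal (idx i)] => //.
  have E : dec [ffun i => Ordinal (idx i)] = f.
    by apply/funext => i; rewrite /dec ffunE (tnth_nth (f i)) /= nth_index //; exact: fs.
  have [Xy ry] := xgetI x0 (conj Xx rf : [set x | X x /\ r x f] x).
  by rewrite E; exact: inj Xy Xx ry rf.
exact/finite_image/finite_finset.
Qed.

Lemma finite_int_ball (n : nat) : finite_set [set z : int | `|z| <= n%:Z].
Proof.
apply: (@sub_finite_set _ _ ((fun k : nat => k%:Z - n%:Z) @` `I_(2 * n).+1)); last first.
  by apply: finite_image; exact: finite_II.
move=> z /= zn; exists (absz (z + n%:Z)); first by rewrite /=; lia.
by lia.
Qed.

Lemma finite_set_argmin (T : eqType) (R : realDomainType) (X : set T) (F : T -> R) :
  X !=set0 -> (forall M, finite_set [set x | X x /\ F x <= M]) ->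
  exists2 x, X x & forall y, X y -> F x <= F y.
Proof.
move=> [x0 Xx0] /(_ (F x0)) /finite_seqP[s sE].
have [x xs xmin] : exists2 x, x \in s & forall y, y \in s -> F x <= F y.
  have : x0 \in s by have : [set` s] x0 by rewrite -sE.
  elim: s x0 {sE Xx0} => // y s IH x0 _.
  case: s IH => [_|z s IH]; first by exists y; rewrite ?mem_head // => t /[!inE]/eqP->.
  have [|x xs xmin] := IH z; first exact: mem_head.
  have [xy|yx] := leP (F x) (F y).
    by exists x => [|t]; rewrite inE ?xs ?orbT // => /predU1P[->|/xmin].
  exists y => [|t]; rewrite inE ?eqxx // => /predU1P[->//|/xmin].
  exact/le_trans/ltW.
have [Xx Fx] : X x /\ F x <= F x0 by have : [set` s] x by []; rewrite -sE.
exists x => // y Xy; have [yx|/ltW] := leP (F y) (F x0); last exact: le_trans.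
by apply: xmin; have : [set` s] y by rewrite -sE.
Qed.

End FiniteCodes.

(** * Discreteness of Gamma over Z[phi] *)

Section GammaDiscrete.
Import Order.TTheory GRing.Theory Num.Theory.
Local Open Scope ring_scope.
Variable R : realType.
Local Notation phi := (golden R).

(** On the hyperboloid no spatial coordinate exceeds coordinate 0 in absolute value. *)
Lemma lorentz_pt_bound (v : 'rV[R]_4) : exists2 k : R, 0 <= k &
  forall p, `|lorentz v (pt p)| <= k * pt p 0 0.
Proof.
exists (`|v 0 0| + `|v 0 1| + `|v 0 2%:R| + `|v 0 3%:R|); first by rewrite !addr_ge0.
move=> p; have p0 := pt_gt0 p; have := lorentz_pt p; rewrite !lorentzE => pp.
have bd i : pt p 0 i * pt p 0 i <= pt p 0 0 * pt p 0 0 -> `|v 0 i * pt p 0 i| <= `|v 0 i| * pt p 0 0.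
  move=> h; rewrite normrM ler_wpM2l // -(@ler_pXn2r _ 2) ?nnegrE ?(ltW p0) // real_normK ?num_real //.
have s1 := sqr_ge0 (pt p 0 1); have s2 := sqr_ge0 (pt p 0 2%:R); have s3 := sqr_ge0 (pt p 0 3%:R).
rewrite !expr2 in s1 s2 s3.
have b0 := bd 0 (lexx _); rewrite -normrN in b0.
have b1 : pt p 0 1 * pt p 0 1 <= pt p 0 0 * pt p 0 0 by lra.
have b2 : pt p 0 2%:R * pt p 0 2%:R <= pt p 0 0 * pt p 0 0 by lra.
have b3 : pt p 0 3%:R * pt p 0 3%:R <= pt p 0 0 * pt p 0 0 by lra.
rewrite !mulrDl; apply: le_trans (ler_normD _ _) (lerD _ (bd _ b3)).
apply: le_trans (ler_normD _ _) (lerD _ (bd _ b2)).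
exact: le_trans (ler_normD _ _) (lerD b0 (bd _ b1)).
Qed.

(* Used for the two roots t of t^2 = t + 1, so that the pairs of integer matrices encode matrices over Z[phi]. *)
Definition quad_mx (t : R) (N : 'M[int]_4 * 'M[int]_4) : 'M[R]_4 :=
  map_mx intr N.1 + t *: map_mx intr N.2.

Definition quad_mul (M N : 'M[int]_4 * 'M[int]_4) : 'M[int]_4 * 'M[int]_4 :=
  (M.1 *m N.1 + M.2 *m N.2, M.1 *m N.2 + M.2 *m N.1 + M.2 *m N.2).

Lemma quad_mxM t M N : t ^+ 2 = t + 1 -> quad_mx t M *m quad_mx t N = quad_mx t (quad_mul M N).
Proof.
move=> t2; apply/matrixP => i j; rewrite /quad_mx.
have E k : (map_mx intr M.1 + t *: map_mx intr M.2) i k * (map_mx intr N.1 + t *: map_mx intr N.2) k j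
  = (M.1 i k * N.1 k j + M.2 i k * N.2 k j)%:~R
    + t * (M.1 i k * N.2 k j + M.2 i k * N.1 k j + M.2 i k * N.2 k j)%:~R.
  rewrite !mxE !rmorphD !rmorphM /=; set x := _%:~R; set y := _%:~R; set z := _%:~R; set w := _%:~R.
  rewrite (_ : _ * _ = x * z + t ^+ 2 * (y * w) + t * (x * w + y * z)); last by ring.
  by rewrite t2; ring.
rewrite [LHS]mxE (eq_bigr _ (fun k _ => E k)) !mxE -!big_split /= !rmorph_sum /= mulr_sumr.
by rewrite -big_split.
Qed.

(** At t = phi this is twice the Gram matrix of the normals; doubling clears the denominators. *)
Definition coxeter_mx : 'M[int]_4 * 'M[int]_4 :=
  (\matrix_(i, j) (if i == j then 2 else if (i == 0) && (j == 1) || (i == 1) && (j == 0)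
     || (i == 2%:R) && (j == 3%:R) || (i == 3%:R) && (j == 2%:R) then -1 else 0),
   \matrix_(i, j) (if (i == 1) && (j == 2%:R) || (i == 2%:R) && (j == 1) then -1 else 0)).

Lemma coxeter_mx_sym t : (quad_mx t coxeter_mx)^T = quad_mx t coxeter_mx.
Proof.
apply/matrixP => i j; rewrite !mxE /=.
by case: i => [[|[|[|[|i]]]] hi] //; case: j => [[|[|[|[|j]]]] hj].
Qed.

Lemma coxeter_form t (v : 'rV[R]_4) : (v *m quad_mx t coxeter_mx *m v^T) 0 0 =
  2 * (v 0 0 ^+ 2 + v 0 1 ^+ 2 + v 0 2%:R ^+ 2 + v 0 3%:R ^+ 2
       - v 0 0 * v 0 1 - v 0 2%:R * v 0 3%:R - t * v 0 1 * v 0 2%:R).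
Proof.
rewrite mxE !big_ord_recl big_ord0 !mxE !big_ord_recl !big_ord0 !mxE /=.
have -> : lift ord0 ord0 = 1 :> 'I_4 by apply: val_inj.
have -> : lift ord0 (lift ord0 ord0) = 2%:R :> 'I_4 by apply: val_inj.
have -> : lift ord0 (lift ord0 (lift ord0 ord0)) = 3%:R :> 'I_4 by apply: val_inj.
move: (v 0 _) (v 0 1) (v 0 2%:R) (v 0 3%:R) => x y z w; ring.
Qed.

(** Completing the squares in x and w leaves 3/4 (y^2 + z^2) - t y z, and |t| <= 2/3 makes this at
    least 5/12 (y^2 + z^2). *)
Lemma form_bound (t x y z w : R) : - (2 / 3) <= t <= 0 ->
  2 * (x ^+ 2 + y ^+ 2 + z ^+ 2 + w ^+ 2 - x * y - z * w - t * y * z) = 2 ->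
  [/\ `|x| <= 2, `|y| <= 2, `|z| <= 2 & `|w| <= 2].
Proof.
move=> /andP[t1 t2] E.
have sx := sqr_ge0 (x - y / 2); have sw := sqr_ge0 (w - z / 2).
have tyz : - (t * y * z) >= - (1 / 3) * (y ^+ 2 + z ^+ 2).
  have h1 : 0 <= (t + 2 / 3) * (y - z) ^+ 2 by apply: mulr_ge0; [lra|exact: sqr_ge0].
  have h2 : 0 <= - t * (y + z) ^+ 2 by apply: mulr_ge0; [lra|exact: sqr_ge0].
  have h3 := sqr_ge0 (y + z); have h4 := sqr_ge0 (y - z).
  rewrite !expr2 in h1 h2 h3 h4 *; lra.
have y2 : (5 / 12) * (y ^+ 2 + z ^+ 2) + (x - y / 2) ^+ 2 + (w - z / 2) ^+ 2 <= 1 by rewrite !expr2 in E tyz *; lra.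
have hy := sqr_ge0 y; have hz := sqr_ge0 z.
have abs (u k : R) : 0 <= k -> u ^+ 2 <= k ^+ 2 -> - k <= u <= k.
  by move=> k0; rewrite -ler_norml -[u ^+ 2]real_normK ?num_real // ler_pXn2r ?nnegrE.
have /andP[yl yu] : - (8 / 5) <= y <= 8 / 5 by apply: abs; lra.
have /andP[zl zu] : - (8 / 5) <= z <= 8 / 5 by apply: abs; lra.
have /andP[xl xu] : - 1 <= x - y / 2 <= 1 by apply: abs; lra.
have /andP[wl wu] : - 1 <= w - z / 2 <= 1 by apply: abs; lra.
by split; rewrite ler_norml; apply/andP; split; lra.
Qed.

(* For t = 1 - phi, the Galois conjugate of phi, the Gram matrix is positive definite. *)
Lemma coxeter_conj_bound (v : 'rV[R]_4) j :
  (v *m quad_mx (1 - phi) coxeter_mx *m v^T) 0 0 = 2 -> `|v 0 j| <= 2.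
Proof.
rewrite coxeter_form; have /andP[p1 p2] := golden_bounds R.
have jE : [\/ j = 0, j = 1, j = 2%:R | j = 3%:R].
  by case: j => [[|[|[|[|j]]]] hj] //; [constructor 1|constructor 2|constructor 3|constructor 4]; apply: val_inj.
move=> /form_bound [] //; first by lra.
by move=> h0 h1 h2 h3; case: jE => ->.
Qed.

(** Row i holds the coordinates of the reflected normal e_i - 2 (e_i, e_k) e_k. *)
Definition coxeter_gen (k : 'I_4) : 'M[int]_4 * 'M[int]_4 :=
  (1%:M - coxeter_mx.1 *m delta_mx k k, - (coxeter_mx.2 *m delta_mx k k)).

Lemma quad_coxeter_gen t k :
  quad_mx t (coxeter_gen k) = 1%:M - quad_mx t coxeter_mx *m delta_mx k k.
Proof.
rewrite /quad_mx /= map_mxB map_mx1 map_mxN !map_mxM map_delta_mx mulmxDl -scalemxAl scalerN.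
by rewrite opprD addrA.
Qed.

(** Only the diagonal entries 2 of the form are used, so invariance holds for every t and in
    particular for the conjugate of phi. *)
Lemma coxeter_gen_form t k : let T := quad_mx t coxeter_mx in let N := quad_mx t (coxeter_gen k) in
  N *m T *m N^T = T.
Proof.
move=> T N; have TT : T^T = T by exact: coxeter_mx_sym.
have dTd : delta_mx k k *m T *m delta_mx k k = 2 *: delta_mx k k.
  have mid : delta_mx (0 : 'I_1) k *m T *m delta_mx k (0 : 'I_1) = 2%:M.
    apply/matrixP => i j; rewrite !ord1 -rowE -colE !mxE /= !eqxx mulr1n.
    by case: (k) => [[|[|[|[|k']]]] hk] //=; rewrite mulr0 addr0.
  rewrite -(mul_delta_mx (0 : 'I_1) k k) -!mulmxA (mulmxA T) (mulmxA (delta_mx 0 k)) (mulmxA (delta_mx 0 k)) mid.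
  by rewrite mul_scalar_mx -scalemxAr mul_delta_mx.
rewrite /N quad_coxeter_gen -/T linearB /= trmx1 trmx_mul trmx_delta TT.
rewrite mulmxBl mul1mx mulmxBr mulmx1 mulmxBl -!mulmxA (mulmxA (delta_mx k k)) (mulmxA (delta_mx k k *m T)).
rewrite dTd -scalemxAl -!scalemxAr scaler_nat mulr2n.
by rewrite opprB addrK subrK.
Qed.

Variables (A B C D : H3 R) (a b c d : 'rV[R]_4).
Hypothesis fr : frame353 A B C D a b c d.
Local Notation Gam := (Gamma A B C D).

Definition frame_mx : 'M[R]_4 := \matrix_(i < 4) nth 0 [:: a; b; c; d] i.

Definition vertex (i : 'I_4) : H3 R := nth A [:: A; B; C; D] i.

Lemma frame_mx_vertex (i j : 'I_4) : i != j -> lorentz (row i frame_mx) (pt (vertex j)) = 0.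
Proof.
have sym := frame_incidence fr; rewrite rowK /vertex lorentzC.
by case: i => [[|[|[|[|i]]]] hi] //; case: j => [[|[|[|[|j]]]] hj] // _; rewrite /= sym.
Qed.

Lemma frame_mx_vertex_lt0 i : lorentz (row i frame_mx) (pt (vertex i)) < 0.
Proof.
case: fr => -[[_ _ _ _ aA] [_ _ _ _ bB] [_ _ _ _ cC] [_ _ _ _ dD]] _ _; rewrite rowK /vertex.
by case: i => [[|[|[|[|i]]]] hi].
Qed.

Lemma frame_mx_full v : exists u : 'rV[R]_4, v = u *m frame_mx.
Proof.
have [x [y [z [w ->]]]] := frame_coord fr v.
exists (\row_(i < 4) nth 0 [:: x; y; z; w] i).
rewrite mulmx_sum_row !big_ord_recl big_ord0 addr0 !addrA.
by rewrite !rowK !mxE.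
Qed.

Lemma coxeter_mx_gram (i j : 'I_4) :
  quad_mx phi coxeter_mx i j = 2 * lorentz (row i frame_mx) (row j frame_mx).
Proof.
have sym := frame_gram fr; rewrite !rowK !mxE.
by case: i => [[|[|[|[|i]]]] hi] //; case: j => [[|[|[|[|j]]]] hj] //; rewrite /= sym; field.
Qed.

Lemma coxeter_gen_mx k : frame_mx *m iso_mx (frame_gen a b c d k) = quad_mx phi (coxeter_gen k) *m frame_mx.
Proof.
apply/row_matrixP => i; rewrite !row_mul quad_coxeter_gen linearB /= row1 mulmxBl -rowE.
rewrite -[LHS]/(vact (frame_gen a b c d k) (row i frame_mx)) /frame_gen reflectionE; last exact: frame_gen_unit fr k.
congr (_ - _); rewrite -(mul_delta_mx (0 : 'I_1)) mulmxA row_mul -colE -mulmxA -rowE.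
rewrite -{1}[nth _ _ _](rowK (fun i : 'I_4 => nth 0 [:: a; b; c; d] i) k) -/frame_mx -coxeter_mx_gram.
by rewrite [X in _ = X *m _]mx11_scalar mul_scalar_mx !mxE -/frame_mx [in RHS]rowK.
Qed.

(** One pair N serves both roots: at phi it is the matrix of x on the normals, at 1 - phi it
    preserves the positive definite conjugate form, which bounds its entries. *)
Lemma Gamma_quad x : Gam x -> exists N, frame_mx *m iso_mx x = quad_mx phi N *m frame_mx /\
  let T := quad_mx (1 - phi) coxeter_mx in quad_mx (1 - phi) N *m T *m (quad_mx (1 - phi) N)^T = T.
Proof.
have p2 := golden_sqr R; have q2 : (1 - phi) ^+ 2 = (1 - phi) + 1 by rewrite sqrrB p2; ring.
move=> /(Gamma_word fr)[l ->]; elim: l => [|k l [N [NE NT]]].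
  exists (1%:M, 0); rewrite big_nil iso_mx1 mulmx1 /quad_mx /= map_mx1 map_mx0 !scaler0 !addr0.
  by rewrite mul1mx trmx1 mulmx1 mul1mx.
exists (quad_mul N (coxeter_gen k)); rewrite big_cons iso_mxM -!quad_mxM // mulmxA NE; split.
  by rewrite -!mulmxA coxeter_gen_mx.
move=> T; rewrite trmx_mul -!mulmxA (mulmxA (quad_mx _ (coxeter_gen k))) (mulmxA (_ *m T)).
by rewrite coxeter_gen_form mulmxA.
Qed.

Theorem Gamma_discrete (M : R) :
  finite_set [set x | Gam x /\ - lorentz (vact x (pt A)) (pt A) <= M].
Proof.
have /andP[p1 p2] := golden_bounds R.
(* Pairing with vertex j reads off the coordinate of x e_i along e_j; moving x to the other side
   turns this into a product of e_i with a point at bounded distance from A. *)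
have bound (i j : 'I_4) : exists K : R, forall x N, Gam x -> - lorentz (vact x (pt A)) (pt A) <= M ->
    frame_mx *m iso_mx x = quad_mx phi N *m frame_mx -> `|quad_mx phi N i j| <= K.
  have [k k0 kP] := lorentz_pt_bound (row i frame_mx).
  pose e := lorentz (row j frame_mx) (pt (vertex j)); have e0 : e < 0 := frame_mx_vertex_lt0 j.
  exists (k * (2 * pt A 0 0 * (8 * pt A 0 0 ^+ 2 * (- lorentz (pt (vertex j)) (pt A) * M))) / - e).
  move=> x N Gx xM NE; rewrite ler_pdivlMr ?oppr_gt0 //.
  have -> : `|quad_mx phi N i j| * - e = `|lorentz (row i frame_mx) (pt ((x^-1)%g (vertex j)))|.
    rewrite -(ltr0_norm e0) -normrM -vact_pt -vact_lorentzV; congr `| _ |.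
    rewrite /vact -row_mul NE row_mul mulmx_sum_row.
    rewrite (bigD1 j) //= lorentzDl lorentzZl -/e.
    rewrite [lorentz (\sum_(_ | _) _) _](_ : _ = 0) ?addr0 1?[in RHS]mxE //.
    apply: (big_ind (fun y => lorentz y (pt (vertex j)) = 0)) => [|y z yE zE|l lj].
    - exact: lorentz0l.
    - by rewrite lorentzDl yE zE addr0.
    - by rewrite lorentzZl frame_mx_vertex ?mulr0.
  apply: le_trans (kP _) _; rewrite ler_wpM2l //.
  apply: le_trans (lorentz_coord0_lb _ A) _; rewrite ler_wpM2l ?mulr_ge0 ?(ltW (pt_gt0 _)) //.
  rewrite -vact_pt vact_lorentzV invgK vact_pt.
  apply: le_trans (lorentz_triangle _ _ A) _.
  rewrite ler_wpM2l ?mulr_ge0 ?exprn_ge0 ?(ltW (pt_gt0 _)) //.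
  rewrite -[X in X <= _]mulrNN ler_wpM2l //; last by rewrite lorentzC -vact_pt.
  by rewrite oppr_ge0 (le_trans (lorentz_pt_le _ _)) ?oppr_le0.
have [K KP] : exists K : R, forall i j x N, Gam x -> - lorentz (vact x (pt A)) (pt A) <= M ->
    frame_mx *m iso_mx x = quad_mx phi N *m frame_mx -> `|quad_mx phi N i j| <= K.
  have [f fP] := choice (fun ij : 'I_4 * 'I_4 => bound ij.1 ij.2).
  exists (\sum_ij `|f ij|) => i j x N Gx xM NE; apply: le_trans (fP (i, j) x N Gx xM NE) _.
  by rewrite (bigD1 (i, j)) //= (le_trans (ler_norm _)) // lerDl sumr_ge0.
pose n := Num.bound (3 * (`|K| + 2)).
pose r x (f : 'I_4 * 'I_4 * bool -> int) := exists N, [/\ frame_mx *m iso_mx x = quad_mx phi N *m frame_mx,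
  forall i j, N.1 i j = f (i, j, true) & forall i j, N.2 i j = f (i, j, false)].
apply: (finite_code_fun (r := r) (finite_int_ball n)) => [x [Gx xM]|x y f _ _ [N [NE N1 N2]] [N' [NE' N1' N2']]].
  have [N [NE NT]] := Gamma_quad Gx.
  exists (fun k => if k.2 then N.1 k.1.1 k.1.2 else N.2 k.1.1 k.1.2); last by exists N.
  have q1 i j := KP i j x N Gx xM NE.
  have q2 i j : `|quad_mx (1 - phi) N i j| <= 2.
    have entry (X : 'M[R]_4) : X i j = row i X 0 j by rewrite mxE.
    rewrite entry; apply: coxeter_conj_bound.
    have -> X : (row i X *m quad_mx (1 - phi) coxeter_mx *m (row i X)^T) 0 0
        = (X *m quad_mx (1 - phi) coxeter_mx *m X^T) i i.
      by rewrite -row_mul [LHS]mxE [RHS]mxE; apply: eq_bigr => l _; rewrite !mxE.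
    rewrite NT !mxE eqxx; case: (i) => [[|[|[|[|i']]]] hi] //=; ring.
  (* The integers P and Q are recovered from P + phi Q and P + (1 - phi) Q, whose difference is (2
     phi - 1) Q. *)
  have q3 i j : `|(N.2 i j)%:~R| <= `|K| + 2 :> R.
    have -> : (N.2 i j)%:~R = (quad_mx phi N i j - quad_mx (1 - phi) N i j) / (2 * phi - 1) :> R.
      by rewrite !mxE; field; rewrite gt_eqF //; lra.
    rewrite normrM normfV (gtr0_norm (_ : 0 < 2 * phi - 1)); last by lra.
    rewrite ler_pdivrMr; last by lra.
    apply: le_trans (ler_normB _ _) _; have h1 := q1 i j; have h2 := q2 i j.
    have h3 := ler_norm K; have h4 := normr_ge0 K.
    have : 0 <= `|K| * (2 * phi - 2) by apply: mulr_ge0; lra.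
    lra.
  have q4 i j : `|(N.1 i j)%:~R| <= 3 * (`|K| + 2) :> R.
    have -> : (N.1 i j)%:~R = quad_mx phi N i j - phi * (N.2 i j)%:~R :> R by rewrite !mxE; ring.
    apply: le_trans (ler_normB _ _) _; rewrite normrM (gtr0_norm (_ : 0 < phi)); last by lra.
    have h1 := q1 i j; have h2 := q3 i j; have h3 := ler_norm K; have h4 := normr_ge0 K.
    have : phi * `|(N.2 i j)%:~R| <= 5 / 3 * (`|K| + 2) by apply: ler_pM => //; lra.
    lra.
  move=> [[i j] l] /=; rewrite -(ler_int R) intr_norm.
  have nK : 3 * (`|K| + 2) < n%:~R :> R by rewrite -pmulrn archi_boundP // mulr_ge0 // addr_ge0.
  apply: ltW; apply: le_lt_trans nK; case: l => /=; first exact: q4.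
  by apply: le_trans (q3 i j) _; have h4 := normr_ge0 K; lra.
have NN : N = N' by case: N N' N1 N2 N1' N2' {NE NE'} => [P Q] [P' Q'] /= P1 Q1 P1' Q1';
  congr (_, _); apply/matrixP => i j; rewrite ?P1 ?P1' ?Q1 ?Q1'.
by apply: vact_ext => v; have [u ->] := frame_mx_full v; rewrite /vact -!mulmxA NE NE' NN.
Qed.

End GammaDiscrete.

(** * Centralisers of powers of translations *)

Section HyperbolicTranslations.
Import Order.TTheory GRing.Theory Num.Theory.
Local Open Scope ring_scope.
Variable R : realType.

(** A maximum principle: where |l| is largest, T |l| is at most the sum of the two neighbouring
    absolute values, so at most 2 |l|. *)
Lemma periodic_recurrence0 (T : R) (m : nat) (l : nat -> R) : 2 < T -> (0 < m)%N ->
  (forall n, l n.+2 = T * l n.+1 - l n) -> (forall n, l (n + m)%N = l n) -> l 0%N = 0.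
Proof.
case: m => // m T2 _ rec per.
have [i _ imax] := @Order.TotalTheory.arg_maxP _ _ 'I_m.+1 ord0 xpredT (fun i => `|l i|) isT.
have max n : `|l n| <= `|l i|.
  rewrite (divn_eq n m.+1); have -> q : l (q * m.+1 + n %% m.+1)%N = l (n %% m.+1)%N.
    by elim: q => // q IH; rewrite mulSn -addnA addnC per.
  exact: (imax (Ordinal (ltn_pmod n (ltn0Sn m))) isT).
(* The period is now [m.+1]; shifting by it gives i a predecessor even when i = 0. *)
have e : T * l i = l (i + m)%N + l (i + m).+2.
  by rewrite rec -addnS per addrC subrK.
have : T * `|l i| <= 2 * `|l i|.
  rewrite -(gtr0_norm (lt_trans (ltr0Sn R 1) T2)) -normrM e (le_trans (ler_normD _ _)) //.
  by have h1 := max (i + m)%N; have h2 := max (i + m).+2; lra.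
have h0 := max 0%N => h; have h1 := normr_ge0 (l i).
by apply/eqP; rewrite -normr_le0; nra.
Qed.

(* The product of the reflections in two ultraparallel planes is a translation, of trace T > 2 on span(u, v);
   (w^n y, u) is then both periodic and a solution of l_{n+2} = T l_{n+1} - l_n. *)
Lemma ultraparallel_fix (u v y : 'rV[R]_4) (m : nat) : lorentz u u = 1 -> lorentz v v = 1 ->
  lorentz u v < -1 -> (0 < m)%N -> vact ((reflection u * reflection v) ^+ m)%g y = y ->
  lorentz y u = 0 /\ lorentz y v = 0.
Proof.
move=> uu vv uv m0 fix_y; pose w := (reflection u * reflection v)%g; pose k := - lorentz u v.
have uvE : lorentz u v = - k by rewrite /k opprK.
have vuE : lorentz v u = - k by rewrite lorentzC.
have stepu x : lorentz (vact w x) u = - lorentz x u - 2 * k * lorentz x v.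
  by rewrite vactM !reflectionE // !lorentzL uu vuE; ring.
have stepv x : lorentz (vact w x) v = 2 * k * lorentz x u + (4 * k ^+ 2 - 1) * lorentz x v.
  by rewrite vactM !reflectionE // !lorentzL uvE vuE vv; ring.
have k1 : 1 < k by rewrite /k ltrNr.
have T2 : 2 < 4 * k ^+ 2 - 2 by nra.
pose o n := vact (w ^+ n)%g y.
have oS n : o n.+1 = vact w (o n) by rewrite /o expgS vactM.
have om n : o (n + m)%N = o n by rewrite /o expgnDr vactM fix_y.
have o0 : o 0%N = y by rewrite /o expg0 vact1.
have pu := @periodic_recurrence0 _ _ (fun n => lorentz (o n) u) T2 m0.
have pv := @periodic_recurrence0 _ _ (fun n => lorentz (o n) v) T2 m0.
rewrite /= o0 in pu pv; split; [apply: pu|apply: pv] => n; rewrite ?om // !oS.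
  by rewrite !stepu stepv; ring.
by rewrite !stepv stepu; ring.
Qed.

(** z preserves the fixed space of the power of the translation, which is the orthogonal complement
    of span(u, v), and therefore span(u, v) itself. *)
Lemma ultraparallel_centraliser (u v : 'rV[R]_4) (m : nat) z : lorentz u u = 1 -> lorentz v v = 1 ->
  lorentz u v < -1 -> (0 < m)%N ->
  (z * (reflection u * reflection v) ^+ m = (reflection u * reflection v) ^+ m * z)%g ->
  exists p q, vact z u = p *: u + q *: v.
Proof.
move=> uu vv uv m0 zw; pose w := (reflection u * reflection v)%g.
have zV : (z^-1 * w ^+ m = w ^+ m * z^-1)%g.
  by apply: (mulgI z); rewrite mulKVg mulgA zw mulgK.
have fix_perp y : lorentz y u = 0 -> lorentz y v = 0 -> lorentz (vact z u) y = 0.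
  move=> yu yv; rewrite vact_lorentzV lorentzC.
  have wy : vact w y = y by rewrite vactM !reflection_fix.
  have wmy n : vact (w ^+ n)%g y = y by elim: n => [|n IH]; rewrite ?vact1 // expgS vactM IH.
  suff [] : lorentz (vact z^-1%g y) u = 0 /\ lorentz (vact z^-1%g y) v = 0 by [].
  by apply: (ultraparallel_fix uu vv uv m0); rewrite -vactM -zV vactM wmy.
pose k := lorentz u v; have k1 : 1 - k ^+ 2 != 0 by rewrite lt_eqF //; rewrite /k; nra.
have vu : lorentz v u = k by rewrite lorentzC.
(* [cu] and [cv] are the coordinates of the orthogonal projection to span(u, v). *)
pose cu y := (lorentz y u - k * lorentz y v) / (1 - k ^+ 2).
pose cv y := (lorentz y v - k * lorentz y u) / (1 - k ^+ 2).
exists (cu (vact z u)), (cv (vact z u)); apply: lorentz_ext => y.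
have perp x : lorentz (x - (cu x *: u + cv x *: v)) u = 0 /\ lorentz (x - (cu x *: u + cv x *: v)) v = 0.
  by rewrite !lorentzL uu vv vu -/k /cu /cv; split; field.
have [yu yv] := perp y; have := fix_perp _ yu yv.
rewrite lorentzDr lorentzNr => /eqP; rewrite subr_eq0 => /eqP ->.
rewrite lorentzDl lorentzDr !lorentzZl !lorentzZr /cu /cv ![lorentz u y]lorentzC ![lorentz v y]lorentzC.
by field.
Qed.

End HyperbolicTranslations.

(** * Discreteness of the normaliser *)

Section NormaliserDiscrete.
Import Order.TTheory GRing.Theory Num.Theory.
Local Open Scope ring_scope.
Variables (R : realType) (A B C D : H3 R) (a b c d : 'rV[R]_4).
Hypothesis fr : frame353 A B C D a b c d.
Local Notation phi := (golden R).
Local Notation Gam := (Gamma A B C D).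
Local Notation Del := (Delta A B C D).
Local Notation ra := (reflection a).
Local Notation rb := (reflection b).
Local Notation rc := (reflection c).
Local Notation rd := (reflection d).

(** Normals joined in the diagram have a nonzero product, so their factors are equal signs; the
    diagram is connected, and -1 would exchange the sheets. *)
Lemma frame_scalar_iso z p q s t : vact z a = p *: a -> vact z b = q *: b -> vact z c = s *: c ->
  vact z d = t *: d -> z = 1%g.
Proof.
move=> za zb zc zd; have g := frame_gram fr; have /andP[p1 _] := golden_bounds R.
have pp : p * p = 1 by have := vact_lorentz z a a; rewrite za !lorentzL g; lra.
have pq : p * q = 1 by have := vact_lorentz z a b; rewrite za zb !lorentzL g; lra.
have qs : q * s = 1.
  have := vact_lorentz z b c; rewrite zb zc !lorentzL g mulrA => e.
  have f0 : - (phi / 2) != 0 by rewrite lt_eqF //; lra.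
  by apply: (mulIf f0); rewrite mul1r.
have st : s * t = 1 by have := vact_lorentz z c d; rewrite zc zd !lorentzL g; lra.
have p0 : p != 0 by apply/eqP => p0; move/eqP: pp; rewrite p0 mul0r eq_sym oner_eq0.
have qE : q = p by apply: (mulfI p0); rewrite pq.
have sE : s = p by apply: (mulfI p0); rewrite pp -qE.
have tE : t = p by apply: (mulfI p0); rewrite pp -{1}sE.
have zE v : vact z v = p *: v.
  have [x [y [w [k ->]]]] := frame_coord fr v; rewrite !vactL za zb zc zd qE sE tE !scalerDr !scalerA.
  by rewrite ![p * _]mulrC.
have pE : p = 1.
  have := lorentz_pt_le A (z A); rewrite -vact_pt zE lorentzZr lorentz_pt => h.
  by nra.
by apply: vact_ext => v; rewrite zE pE scale1r vact1.
Qed.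

(* Roots in the Gamma-orbit of b and c whose mirrors are ultraparallel to that of a. *)
Definition ultra_root (j : bool) : 'rV[R]_4 :=
  if j then (phi + 1) *: b + (phi + 1) *: c + d else (phi + 1) *: b + (phi + 1) *: c + phi *: d.

Lemma ultra_root_unit j : lorentz (ultra_root j) (ultra_root j) = 1.
Proof.
have p2 := golden_sqr R; have p3 := golden_cube R.
by case: j; rewrite /ultra_root !lorentzL !(frame_gram fr); lra.
Qed.

Lemma ultra_root_a j : lorentz a (ultra_root j) < -1.
Proof.
have /andP[p1 _] := golden_bounds R.
by case: j; rewrite /ultra_root !lorentzL !(frame_gram fr); lra.
Qed.

Lemma vect4_congr (x y z w x' y' z' w' : R) : x = x' -> y = y' -> z = z' -> w = w' ->
  x *: a + y *: b + z *: c + w *: d = x' *: a + y' *: b + z' *: c + w' *: d.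
Proof. by move=> -> -> -> ->. Qed.

Lemma vact_frame4 (x y z w : R) (v := x *: a + y *: b + z *: c + w *: d) :
  [/\ vact ra v = (y - x) *: a + y *: b + z *: c + w *: d,
      vact rb v = x *: a + (x + phi * z - y) *: b + z *: c + w *: d,
      vact rc v = x *: a + y *: b + (phi * y + w - z) *: c + w *: d
    & vact rd v = x *: a + y *: b + z *: c + (z - w) *: d].
Proof.
rewrite !reflectionDE ?(frame_gram fr) // /v !lorentzL !(frame_gram fr).
have add4 (k l m n : R) : x *: a + y *: b + z *: c + w *: d + (k *: a + l *: b + m *: c + n *: d)
    = (x + k) *: a + (y + l) *: b + (z + m) *: c + (w + n) *: d.
  by rewrite !scalerDl addrACA; congr (_ + _); rewrite addrACA; congr (_ + _); rewrite addrACA.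
have e1 k : k *: a = k *: a + 0 *: b + 0 *: c + 0 *: d by rewrite !scale0r !addr0.
have e2 k : k *: b = 0 *: a + k *: b + 0 *: c + 0 *: d by rewrite !scale0r !addr0 add0r.
have e3 k : k *: c = 0 *: a + 0 *: b + k *: c + 0 *: d by rewrite !scale0r !addr0 !add0r.
have e4 k : k *: d = 0 *: a + 0 *: b + 0 *: c + k *: d by rewrite !scale0r !add0r.
split; [rewrite [X in _ + X]e1|rewrite [X in _ + X]e2|rewrite [X in _ + X]e3|rewrite [X in _ + X]e4];
  rewrite add4; apply: vect4_congr; rewrite ?addr0 //; lra.
Qed.

Lemma frame_free4 (x y z w : R) : x *: a + y *: b + z *: c + w *: d = 0 ->
  [/\ x = 0, y = 0, z = 0 & w = 0].
Proof.
case: fr => -[[_ _ _ _ aA] [_ _ _ _ bB] [_ _ _ _ cC] [_ _ _ _ dD]] _ _ e.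
have cancel (k l : R) : l < 0 -> k * l = 0 -> k = 0.
  by move=> l0 /eqP; rewrite mulf_eq0 => /orP[/eqP//|]; rewrite lt_eqF.
split; [apply: cancel aA _|apply: cancel bB _|apply: cancel cC _|apply: cancel dD _]; rewrite lorentzC.
- by have := lorentz0r (pt A); rewrite -e !lorentzL !(frame_incidence fr) !mulr0 !addr0.
- by have := lorentz0r (pt B); rewrite -e !lorentzL !(frame_incidence fr) !mulr0 !addr0 add0r.
- by have := lorentz0r (pt C); rewrite -e !lorentzL !(frame_incidence fr) !mulr0 addr0 !add0r.
- by have := lorentz0r (pt D); rewrite -e !lorentzL !(frame_incidence fr) !mulr0 !add0r.
Qed.

Lemma frame_basis4 : [/\ a = 1 *: a + 0 *: b + 0 *: c + 0 *: d, b = 0 *: a + 1 *: b + 0 *: c + 0 *: d,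
  c = 0 *: a + 0 *: b + 1 *: c + 0 *: d & d = 0 *: a + 0 *: b + 0 *: c + 1 *: d].
Proof. by rewrite !scale0r !addr0 !add0r !scale1r. Qed.

Let vA x y z w := let: And4 h _ _ _ := vact_frame4 x y z w in h.
Let vB x y z w := let: And4 _ h _ _ := vact_frame4 x y z w in h.
Let vC x y z w := let: And4 _ _ h _ := vact_frame4 x y z w in h.
Let vD x y z w := let: And4 _ _ _ h := vact_frame4 x y z w in h.

Lemma ultra_root_orbit : ultra_root true = vact (rb * rc * rd * rb)%g c /\
  ultra_root false = vact (rb * rc * rd * rb * rc)%g b.
Proof.
have p2 := golden_sqr R; have p3 := golden_cube R; have p4 := golden_pow4 R.
have [_ eb ec _] := frame_basis4.
have ac : vact (rb * rc * rd * rb)%g (0 *: a + 0 *: b + 1 *: c + 0 *: d)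
    = 0 *: a + (phi + 1) *: b + (phi + 1) *: c + 1 *: d.
  by rewrite !vactM !(vB, vC, vD); apply: vect4_congr; lra.
have ab : vact (rb * rc * rd * rb * rc)%g (0 *: a + 1 *: b + 0 *: c + 0 *: d)
    = 0 *: a + (phi + 1) *: b + (phi + 1) *: c + phi *: d.
  by rewrite !vactM !(vB, vC, vD); apply: vect4_congr; lra.
by rewrite -ec scale1r in ac; rewrite -eb in ab; rewrite ac ab !scale0r !add0r.
Qed.

Lemma ultra_root_Gamma j : Gam (reflection (ultra_root j)).
Proof.
have sG := Gamma_subgroup A B C D; have [Ga Gb Gc Gd] := Gamma_gens fr.
have [e1 e2] := ultra_root_orbit.
have gb : lorentz b b = 1 by rewrite (frame_gram fr).
have gc : lorentz c c = 1 by rewrite (frame_gram fr).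
have conj g x : Gam g -> Gam x -> Gam (g * x * g^-1)%g.
  by move=> Gg Gx; apply: sG.2 => //; exact: subgroupM sG Gg Gx.
by case: j; rewrite ?e1 ?e2 -reflectionJ //; apply: conj => //; do !apply: (subgroupM sG) => //.
Qed.

(** Elements of Delta carrying a to each normal: across a bond of order 3 the rotation mn maps m to
    n, across the bond of order 5 its square does. *)
Definition base_move (i : 'I_4) : isoH3 R :=
  nth 1%g [:: 1; ra * rb; (rb * rc) ^+ 2 * (ra * rb); rc * rd * ((rb * rc) ^+ 2 * (ra * rb))]%g i.

Lemma base_moveE i : vact (base_move i) a = nth 0 [:: a; b; c; d] i.
Proof.
have p2 := golden_sqr R; have p3 := golden_cube R; have p4 := golden_pow4 R.
have [ea eb ec ed] := frame_basis4.
have mab : vact (ra * rb)%g (1 *: a + 0 *: b + 0 *: c + 0 *: d) = 0 *: a + 1 *: b + 0 *: c + 0 *: d.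
  by rewrite vactM !(vA, vB); apply: vect4_congr; lra.
have mbc : vact ((rb * rc) ^+ 2)%g (0 *: a + 1 *: b + 0 *: c + 0 *: d) = 0 *: a + 0 *: b + 1 *: c + 0 *: d.
  by rewrite expg2 !vactM !(vB, vC); apply: vect4_congr; lra.
have mcd : vact (rc * rd)%g (0 *: a + 0 *: b + 1 *: c + 0 *: d) = 0 *: a + 0 *: b + 0 *: c + 1 *: d.
  by rewrite vactM !(vC, vD); apply: vect4_congr; lra.
rewrite -ea -eb in mab; rewrite -eb -ec in mbc; rewrite -ec -ed in mcd.
rewrite /base_move; case: i => [[|[|[|[|i]]]] hi] //=; first by rewrite vact1.
  by rewrite vactM mab.
by rewrite vactM (vactM _ (ra * rb)%g) mab mbc.
Qed.

Lemma base_move_Delta i : Del (base_move i).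
Proof.
have sD := Delta_subgroup A B C D; have [Dab Dbc Dcd] := Delta_gens fr.
rewrite /base_move; case: i => [[|[|[|[|i]]]] hi] //=; first exact: subgroup1.
  by rewrite expg2; do !apply: (subgroupM sD) => //.
by rewrite expg2; do !apply: (subgroupM sD) => //.
Qed.

Definition translation (i : 'I_4) (j : bool) : isoH3 R :=
  (base_move i * (ra * reflection (ultra_root j)) * (base_move i)^-1)%g.

Lemma translation_Delta i j : Del (translation i j).
Proof.
have sD := Delta_subgroup A B C D; have Dm := base_move_Delta i.
apply: sD.2 => //; apply: (subgroupM sD) => //; have [Ga _ _ _] := Gamma_gens fr.
by apply: reflections_Delta; rewrite ?ultra_root_unit ?(frame_gram fr) //; exact: ultra_root_Gamma.
Qed.

(** Two translations are attached to each normal because z then maps the normal into two planes that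
    meet only in its line. *)
Lemma translation_centraliser z m : (0 < m)%N ->
  (forall i j, (z * translation i j ^+ m = translation i j ^+ m * z)%g) -> z = 1%g.
Proof.
move=> m0 zt; have /andP[p1 _] := golden_bounds R.
have line (i : 'I_4) : exists k, vact z (nth 0 [:: a; b; c; d] i) = k *: nth 0 [:: a; b; c; d] i.
  rewrite -(base_moveE i); set x := base_move i.
  have zx j : exists p q, vact (z ^ x)%g a = p *: a + q *: ultra_root j.
    have gu := ultra_root_unit j; have ga : lorentz a a = 1 by rewrite (frame_gram fr).
    apply: (ultraparallel_centraliser ga gu (ultra_root_a j) m0).
    have := zt i j; rewrite /translation -/x; move: (ra * reflection (ultra_root j))%g => w.
    have -> : (x * w * x^-1)%g = (w ^ x^-1)%g by rewrite conjgE invgK -mulgA.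
    by rewrite -conjXg => /(congr1 (fun y => y ^ x)%g); rewrite (conjMg z) (conjMg _ z) -!conjgM mulVg conjg1.
  have [p [q E]] := zx true; have [p' [q' E']] := zx false.
  have [_ eb _ ed] : [/\ p - p' = 0, (q - q') * (phi + 1) = 0, (q - q') * (phi + 1) = 0 & q - q' * phi = 0].
    apply: frame_free4; apply: (@etrans _ _ (p *: a + q *: ultra_root true - (p' *: a + q' *: ultra_root false))).
      by rewrite /ultra_root; apply/rowP => l; rewrite !mxE; ring.
    by rewrite -E E' subrr.
  have qq : q = q'.
    by move/eqP: eb; rewrite mulf_eq0 subr_eq0 => /orP[/eqP//|/eqP f0]; exfalso; lra.
  have q0 : q = 0.
    have /eqP : q * (1 - phi) = 0 by rewrite -qq in ed; rewrite mulrBr mulr1.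
    by rewrite mulf_eq0 => /orP[/eqP//|/eqP f0]; exfalso; lra.
  by exists p; rewrite -vactM conjgC vactM E q0 scale0r addr0 vactZ.
have [k0 e0] := line (Ordinal (isT : (0 < 4)%N)).
have [k1 e1] := line (Ordinal (isT : (1 < 4)%N)).
have [k2 e2] := line (Ordinal (isT : (2 < 4)%N)).
have [k3 e3] := line (Ordinal (isT : (3 < 4)%N)).
exact: frame_scalar_iso e0 e1 e2 e3.
Qed.

Theorem normaliser_discrete (K : set (isoH3 R)) (m : nat) : (0 < m)%N -> K `<=` Gam ->
  (forall x, Del x -> K (x ^+ m)%g) ->
  forall M, finite_set [set g | normaliser_of K g /\ - lorentz (vact g (pt A)) (pt A) <= M].
Proof.
move=> m0 KG Km M.
pose k ij := (translation ij.1 ij.2 ^+ m)%g.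
pose s (g : isoH3 R) := - lorentz (vact g (pt A)) (pt A).
pose c0 := 8 * pt A 0 0 ^+ 2; have c00 : 0 <= c0 by rewrite mulr_ge0 ?exprn_ge0 ?(ltW (pt_gt0 _)).
have s0 g : 0 <= s g by rewrite /s vact_pt oppr_ge0 (le_trans (lorentz_pt_le _ _)) ?oppr_le0.
have sV g : s g^-1%g = s g by rewrite /s vact_lorentzV invgK lorentzC.
(* [s] is the cosh of the displacement of A, so this is the triangle inequality up to the factor
   [c0]; it bounds the displacement of k ^ g by those of k and g. *)
have sM g h : s (g * h)%g <= c0 * (s h * s g).
  rewrite -[s g]sV /s vactM vact_lorentzV !vact_pt.
  by apply: le_trans (lorentz_triangle _ _ A) _; rewrite mulrNN [lorentz (pt A) _]lorentzC.
pose S := \sum_ij s (k ij).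
have kS ij : s (k ij) <= S by rewrite /S (bigD1 ij) //= lerDl sumr_ge0.
apply: (finite_code_fun (r := fun g f => forall ij, f ij = (k ij ^ g)%g)
  (Gamma_discrete fr (c0 * (c0 * (M * S) * M)))) => [g [Ng gM]|g g' f _ _ gf gf'].
  exists (fun ij => (k ij ^ g)%g) => // ij; split.
    by apply: KG; have /normaliserP[+ _] := Ng; apply; apply: Km; exact: translation_Delta.
  have M0 : 0 <= M := le_trans (s0 g) gM.
  rewrite -/(s _) conjgE; apply: le_trans (sM _ _) _; rewrite sV ler_wpM2l //.
  apply: ler_pM => //; apply: le_trans (sM _ _) _; rewrite ler_wpM2l //.
  exact: ler_pM.
suff : (g * g'^-1)%g = 1%g by move/divg1_eq.
apply: (translation_centraliser m0) => i j.
have /(congr1 (fun y => y ^ g'^-1)%g) := gf (i, j); rewrite gf' -!conjgM mulgV conjg1 /k /= => E.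
by rewrite [in LHS]E conjgE mulKVg.
Qed.

End NormaliserDiscrete.

(** * Orbits of discrete overgroups *)

Section Cones.
Import Order.TTheory GRing.Theory Num.Theory.
Local Open Scope ring_scope.
Variables (R : realType) (A B C D : H3 R) (a b c d : 'rV[R]_4).
Hypothesis fr : frame353 A B C D a b c d.
Local Notation phi := (golden R).
Local Notation lam := (frame_lambda A a).
Implicit Types (p q : 'rV[R]_4).

Let p2 : phi ^+ 2 = phi + 1 := golden_sqr R.
Let l2 : lam ^+ 2 = (3 * phi - 1) / 4 := frame_lambda_sqr fr.
Let l0 : 0 < lam := frame_lambda_gt0 fr.

Lemma lorentz_frame_A p : lam * lorentz p (pt A) = lorentz p a + 3 / 2 * (phi + 1) * lorentz p b
  + (2 * phi + 1) * lorentz p c + (phi + 1 / 2) * lorentz p d.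
Proof. by rewrite -(lorentzZr lam) (frame_A fr) !lorentzDr !lorentzZr. Qed.

Lemma lorentz_frame_D p : lam * lorentz p (pt D) = (phi + 1 / 2) * lorentz p a + (2 * phi + 1) * lorentz p b
  + 3 / 2 * (phi + 1) * lorentz p c + lorentz p d.
Proof. by rewrite -(lorentzZr lam) (frame_D fr) !lorentzDr !lorentzZr. Qed.

Lemma frame_ext_A p q : lorentz p (pt A) = lorentz q (pt A) -> lorentz p b = lorentz q b ->
  lorentz p c = lorentz q c -> lorentz p d = lorentz q d -> p = q.
Proof.
move=> eA eb ec ed; apply: (frame_ext fr) => //.
by have := lorentz_frame_A p; have := lorentz_frame_A q; rewrite eA eb ec ed; lra.
Qed.

(** The space splits orthogonally into the line of A and span(b, c, d); the form in y, z, w is given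
    by the inverse Gram matrix of b, c, d. *)
Lemma lorentz_frame_sqr p h y z w :
  lorentz p (pt A) = h -> lorentz p b = y -> lorentz p c = z -> lorentz p d = w ->
  lorentz p p = (phi + 1) * (3 * y ^+ 2 + 4 * phi * y * z + 2 * phi * y * w + 4 * z ^+ 2
    + 4 * z * w + (3 - phi) * w ^+ 2) - h ^+ 2.
Proof.
move=> <- <- <- <-; have [k [l [m [n E]]]] := frame_coord fr p.
have hE : lorentz p (pt A) = - lam * k.
  by rewrite E !lorentzL [lorentz a _]lorentzC [lorentz b _]lorentzC [lorentz c _]lorentzC [lorentz d _]lorentzC
     !(frame_incidence fr) /frame_lambda; ring.
rewrite hE exprMn sqrrN l2 E !lorentzL !(frame_gram fr).
by field: p2.
Qed.

(* The hyperbolic cosine of the length of AD. *)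
Local Notation H := (phi + 1 / 2).

Let H2 : H ^+ 2 = 2 * phi + 5 / 4.
Proof. by field: p2. Qed.

Lemma frame_lorentz_AD : lorentz (pt A) (pt D) = - H.
Proof.
apply: (mulfI (lt0r_neq0 l0)); rewrite lorentz_frame_D !(frame_incidence fr) /frame_lambda; ring.
Qed.

Lemma frame_D_incidence : lorentz (pt D) d = - lam.
Proof. by rewrite -(frame_lambda_rev fr) /frame_lambda opprK. Qed.

(* Written out: a point of the cone at A not on the axis AD is moved by the rotation of order 5 about AD by less
   than its distance to A. *)
Lemma cone_rotation q (h := - lorentz q (pt A)) : lorentz q q = -1 -> 0 < h < H ->
  lorentz q b <= 0 -> lorentz q c <= 0 -> lorentz q d <= 0 ->
  ~ (lorentz q b = 0 /\ lorentz q c = 0) ->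
  1 < - lorentz (vact (reflection b * reflection c)%g q) q < h.
Proof.
move=> qq /andP[h0 hH] y0 z0 w0 yz; have /andP[p1 p3] := golden_bounds R.
have gb : lorentz b b = 1 by rewrite (frame_gram fr).
have gc : lorentz c c = 1 by rewrite (frame_gram fr).
rewrite vactM reflection_lorentz // !reflectionDE // !lorentzL (frame_gram fr) [lorentz c q]lorentzC qq.
have hE : lorentz q (pt A) = - h by rewrite /h opprK.
have := lorentz_frame_sqr hE erefl erefl erefl; rewrite qq sqrrN; clearbody h => {hE}.
move: (lorentz q b) (lorentz q c) (lorentz q d) y0 z0 w0 yz => y z w y0 z0 w0 yz E.
have t0 : 0 < y ^+ 2 + phi * (y * z) + z ^+ 2.
  have yz0 : 0 <= y * z by nra.
  have pyz : 0 <= phi * (y * z) by apply: mulr_ge0 => //; lra.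
  have := sqr_ge0 y; have := sqr_ge0 z; rewrite le_eqVlt => /orP[/eqP z2|z2 y2]; last by lra.
  rewrite le_eqVlt => /orP[/eqP y2|y2]; last by lra.
  exfalso; apply: yz; split; apply/eqP; rewrite -sqrf_eq0 -?z2 -?y2 //.
have Q : (phi + 1) * 3 * (y ^+ 2 + phi * (y * z) + z ^+ 2) <= h ^+ 2 - 1.
  have -> : h ^+ 2 - 1 = (phi + 1) * (3 * y ^+ 2 + 4 * phi * y * z + 2 * phi * y * w + 4 * z ^+ 2
    + 4 * z * w + (3 - phi) * w ^+ 2) by lra.
  rewrite -mulrA ler_wpM2l //; first by lra.
  have yz0 : 0 <= phi * (y * z) by apply: mulr_ge0; nra.
  have yw0 : 0 <= phi * (y * w) by apply: mulr_ge0; nra.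
  have zw0 : 0 <= z * w by nra.
  have w2 : 0 <= (3 - phi) * w ^+ 2 by apply: mulr_ge0; [lra|exact: sqr_ge0].
  have z2 := sqr_ge0 z; lra.
set t := y ^+ 2 + phi * (y * z) + z ^+ 2 in t0 Q.
have -> : - (-1 + - (2 * y) * y + (- (2 * z) * z + - (2 * z) * (- (2 * y) * - (phi / 2)))) = 1 + 2 * t.
  by rewrite /t; field.
(* Then 2 t <= 4/15 (h - 1)(h + 1), which is below h - 1 since h + 1 < 15/4. *)
have Qt : 15 / 2 * t <= h ^+ 2 - 1.
  by apply: le_trans Q; rewrite ler_wpM2r ?(ltW t0) //; lra.
by apply/andP; split; [lra|nra].
Qed.

Lemma cone_axis q (h := - lorentz q (pt A)) : lorentz q q = -1 ->
  lorentz q b = 0 -> lorentz q c = 0 -> h ^+ 2 = 1 + (phi + 2) * lorentz q d ^+ 2.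
Proof.
move=> qq qb qc; have hE : lorentz q (pt A) = - h by rewrite /h opprK.
have := lorentz_frame_sqr hE qb qc erefl; rewrite qq sqrrN => E.
have -> : h ^+ 2 = (phi + 1) * (3 - phi) * lorentz q d ^+ 2 + 1 by lra.
by ring: p2.
Qed.

(** Among the directions of the cone at A the edge AB, where z = w = 0, makes the largest angle with
    AD; the factor 8 phi + 5 = (2 phi + 1)^2 gives equality there. *)
Lemma cone_form_bound (y z w : R) : y <= 0 -> z <= 0 -> w <= 0 ->
  (8 * phi + 5) * (3 * y ^+ 2 + 4 * phi * y * z + 2 * phi * y * w + 4 * z ^+ 2 + 4 * z * w + (3 - phi) * w ^+ 2)
  <= 3 * ((2 * phi + 1) * y + 2 * (phi + 1) * z + (phi + 2) * w) ^+ 2.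
Proof.
move=> y0 z0 w0; have /andP[p1 p3] := golden_bounds R.
rewrite -subr_ge0 (_ : _ - _ = (4 * phi + 4) * z ^+ 2 + (4 * phi + 8) * w ^+ 2
   + (8 * phi + 4) * (y * z) + (16 * phi + 8) * (y * w) + (16 * phi + 16) * (z * w)); last first.
  by ring: p2.
by do !apply: addr_ge0; apply: mulr_ge0; rewrite ?sqr_ge0 ?mulr_le0 //; lra.
Qed.

(* The linear form in [cone_form_bound] is a multiple of (p, u), with u in the plane of AD and orthogonal to A. *)
Lemma lorentz_axis p q : lorentz q b = 0 -> lorentz q c = 0 ->
  lorentz p q = - lorentz p (pt A) * lorentz q (pt A) + lorentz q d *
    ((2 * phi + 1) * lorentz p b + 2 * (phi + 1) * lorentz p c + (phi + 2) * lorentz p d).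
Proof.
move=> qb qc; have [k [l [m [n E]]]] := frame_coord fr p.
have qa := lorentz_frame_A q; rewrite qb qc in qa.
have pA : lorentz p (pt A) = - lam * k.
  by rewrite E !lorentzL [lorentz a _]lorentzC [lorentz b _]lorentzC [lorentz c _]lorentzC [lorentz d _]lorentzC
     !(frame_incidence fr) /frame_lambda; ring.
rewrite pA E !lorentzL ![lorentz _ q]lorentzC qb qc !(frame_gram fr).
have -> : - (- lam * k) * lorentz q (pt A) = k * (lam * lorentz q (pt A)) by ring.
by rewrite qa; field: p2.
Qed.

(* q is on the ray AD and p is the image of its mirror image [rd q] under an isometry exchanging A and q; p is then
   beyond the mirror of d, hence nearer to [rd q] than A is to q. The bound H is sharp here. *)
Lemma cone_swap p q (h := - lorentz q (pt A)) : lorentz p p = -1 -> lorentz q q = -1 ->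
  lorentz q b = 0 -> lorentz q c = 0 -> lorentz q d < 0 -> 0 < h < H ->
  lorentz p b <= 0 -> lorentz p c <= 0 -> lorentz p q = - h ->
  - lorentz p (pt A) = 1 + 2 * lorentz q d ^+ 2 -> 0 < lorentz p d.
Proof.
move=> pp qq qb qc qd /andP[h0 hH] y0 z0 pq pA; have /andP[p1 p3] := golden_bounds R.
have hE : lorentz q (pt A) = - h by rewrite /h opprK.
have := cone_axis qq qb qc; rewrite -/h => h2.
have {}pA : lorentz p (pt A) = - (1 + 2 * lorentz q d ^+ 2) by rewrite -pA opprK.
have := lorentz_axis p qb qc; rewrite pq hE pA.
have := lorentz_frame_sqr pA erefl erefl erefl; rewrite pp.
rewrite ltNge; move: h2 qd h0 hH y0 z0; clearbody h.
move: (lorentz q d) (lorentz p b) (lorentz p c) (lorentz p d) => e y z w h2 e0 h0 hH y0 z0 E L; apply/negP => w0.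
set l := (_ + _ + _ * w) in L; set Q := (X in (phi + 1) * X) in E.
have le : l = 2 * e * h.
  by apply: (mulfI (ltr0_neq0 e0)); rewrite !expr2 in L; lra.
have bd : (8 * phi + 5) * Q <= 3 * l ^+ 2 := cone_form_bound y0 z0 w0.
clearbody l Q; have e2 : 0 < e ^+ 2 by rewrite exprn_even_gt0 //= lt_eqF.
have QE : (phi + 1) * Q = 4 * e ^+ 2 * (1 + e ^+ 2).
  have : (1 + 2 * e ^+ 2) ^+ 2 = 1 + 4 * e ^+ 2 * (1 + e ^+ 2) by ring.
  by rewrite sqrrN in E; lra.
have b1 : (8 * phi + 5) * (1 + e ^+ 2) <= 3 * (phi + 1) * h ^+ 2.
  rewrite -(ler_pM2l (_ : 0 < 4 * e ^+ 2)); last by rewrite mulr_gt0.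
  have : (phi + 1) * ((8 * phi + 5) * Q) <= (phi + 1) * (3 * l ^+ 2) by rewrite ler_pM2l //; lra.
  have -> : (phi + 1) * ((8 * phi + 5) * Q) = (8 * phi + 5) * ((phi + 1) * Q) by ring.
  rewrite QE le; set f := e ^+ 2; rewrite !exprMn -/f; lra.
have hh : h ^+ 2 < 2 * phi + 5 / 4 by rewrite -H2 ltr_pXn2r ?nnegrE ?ltW //; lra.
have b2 : (8 * phi + 5) * (phi + 2 + (h ^+ 2 - 1)) <= 3 * (phi + 1) * (phi + 2) * h ^+ 2.
  have : (phi + 2) * ((8 * phi + 5) * (1 + e ^+ 2)) <= (phi + 2) * (3 * (phi + 1) * h ^+ 2) by rewrite ler_pM2l //; lra.
  have -> : (phi + 2) * ((8 * phi + 5) * (1 + e ^+ 2)) = (8 * phi + 5) * (phi + 2 + (h ^+ 2 - 1)) by rewrite h2; ring.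
  by rewrite mulrA [_ * (3 * _)]mulrC.
(* This says h^2 >= H^2, as 21 phi + 13 = (4 phi + 4) H^2. *)
have b3 : 21 * phi + 13 <= (4 * phi + 4) * h ^+ 2.
  rewrite -subr_ge0 (_ : _ - _ = 3 * (phi + 1) * (phi + 2) * h ^+ 2 - (8 * phi + 5) * (phi + 2 + (h ^+ 2 - 1))) ?subr_ge0 //.
  by ring: p2.
have b4 : (4 * phi + 4) * h ^+ 2 < 21 * phi + 13.
  have -> : 21 * phi + 13 = (4 * phi + 4) * (2 * phi + 5 / 4) by field: p2.
  by rewrite ltr_pM2l //; lra.
by move: (lt_le_trans b4 b3); rewrite ltxx.
Qed.

(** The angle of p and D at A is at most BAD by [cone_form_bound], too small for the isosceles
    triangle with legs |AD| to have base |AD|. Packing will then give p = D. *)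
Lemma cone_vertex_D p : lorentz p p = -1 -> - lorentz p (pt A) = H ->
  lorentz p b <= 0 -> lorentz p c <= 0 -> lorentz p d <= 0 -> - lorentz p (pt D) < H.
Proof.
move=> pp pA; have /andP[p1 p3] := golden_bounds R.
have {}pA : lorentz p (pt A) = - H by rewrite -pA opprK.
have Db : lorentz (pt D) b = 0 by rewrite (frame_incidence fr).
have Dc : lorentz (pt D) c = 0 by rewrite (frame_incidence fr).
rewrite (lorentz_axis p Db Dc) frame_D_incidence pA [lorentz (pt D) _]lorentzC frame_lorentz_AD.
have := lorentz_frame_sqr pA erefl erefl erefl; rewrite pp sqrrN H2.
move: (lorentz p b) (lorentz p c) (lorentz p d) => y z w E y0 z0 w0.
set l := (_ + _ + _ * w); set Q := (X in (phi + 1) * X) in E.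
have bd : (8 * phi + 5) * Q <= 3 * l ^+ 2 := cone_form_bound y0 z0 w0.
have ln : 0 <= - l.
  have -> : - l = (2 * phi + 1) * - y + 2 * (phi + 1) * - z + (phi + 2) * - w by rewrite /l; ring.
  by do !apply: addr_ge0; apply: mulr_ge0; lra.
clearbody l Q; have b1 : 28 * phi + 69 / 4 <= 3 * (phi + 1) * l ^+ 2.
  have : (phi + 1) * ((8 * phi + 5) * Q) <= (phi + 1) * (3 * l ^+ 2) by rewrite ler_pM2l //; lra.
  have -> : (phi + 1) * ((8 * phi + 5) * Q) = (8 * phi + 5) * ((phi + 1) * Q) by ring.
  rewrite (_ : (phi + 1) * Q = 2 * phi + 1 / 4); last by lra.
  have -> : (8 * phi + 5) * (2 * phi + 1 / 4) = 28 * phi + 69 / 4 by field: p2.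
  lra.
have b2 : 29 / 4 <= l ^+ 2 by have := sqr_ge0 l; nra.
have b3 : (phi + 3 / 4) ^+ 2 < (lam * - l) ^+ 2.
  have -> : (lam * - l) ^+ 2 = (3 * phi - 1) / 4 * l ^+ 2 by rewrite exprMn (sqrrN l) l2.
  nra.
have b4 : phi + 3 / 4 < lam * - l.
  by rewrite -(@ltr_pXn2r _ 2) ?nnegrE ?mulr_ge0 ?(ltW l0) //; lra.
have -> : - (- - H * - H + - lam * l) = 2 * phi + 5 / 4 - lam * - l by rewrite -H2; ring.
by lra.
Qed.

(** The distances to A and D place p on the circle of [rd D] around AD. Both lie in one sector of
    angle pi/5, and a rotation by at most this angle moves [rd D] by less than |AD|. *)
Lemma cone_neighbour p : lorentz p p = -1 -> - lorentz p (pt A) = H ->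
  lorentz p (pt D) = lorentz (vact (reflection d) (pt D)) (pt D) ->
  lorentz p b <= 0 -> lorentz p c <= 0 -> - lorentz p (vact (reflection d) (pt D)) < H.
Proof.
move=> pp pA; have /andP[p1 p3] := golden_bounds R.
have {}pA : lorentz p (pt A) = - H by rewrite -pA opprK.
have Db : lorentz (pt D) b = 0 by rewrite (frame_incidence fr).
have Dc : lorentz (pt D) c = 0 by rewrite (frame_incidence fr).
have gd : lorentz d d = 1 by rewrite (frame_gram fr).
rewrite reflectionDE // frame_D_incidence lorentzDl lorentzZl lorentz_pt [lorentz d _]lorentzC frame_D_incidence.
rewrite lorentzDr lorentzZr => pD; have L := pD; rewrite pD; move: L.
rewrite (lorentz_axis p Db Dc) frame_D_incidence pA [lorentz (pt D) _]lorentzC frame_lorentz_AD.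
have := lorentz_frame_sqr pA erefl erefl erefl; rewrite pp sqrrN H2.
move: (lorentz p b) (lorentz p c) (lorentz p d) => y z w E L y0 z0.
have {}E : (phi + 1) * (3 * y ^+ 2 + 4 * phi * y * z + 2 * phi * y * w + 4 * z ^+ 2 + 4 * z * w + (3 - phi) * w ^+ 2)
  = 2 * phi + 1 / 4 by lra.
pose t := y ^+ 2 + phi * y * z + z ^+ 2; pose l := (2 * phi + 1) * y + 2 * (phi + 1) * z + (phi + 2) * w.
pose s := (2 * phi + 1) * - y + 2 * (phi + 1) * - z.
have ll : lam * l = - (2 * phi + 3) / 4.
  have -> : lam * l = - (- - H * - H + - lam * l) - H ^+ 2 by ring.
  rewrite L H2 (_ : -1 + - (2 * - lam) * - lam = - (1 + 2 * lam ^+ 2)); last by ring.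
  by rewrite l2; field.
(* Up to a factor, t is the squared norm of the component of p orthogonal to A and D, hence
   determined by the distances to A and D. *)
have tE : t = lam ^+ 2.
  have f : l ^+ 2 + 4 * (phi + 1) * t = (phi + 2) * (2 * phi + 1 / 4) by rewrite -E /l /t; ring: p2.
  have f2 : lam ^+ 2 * l ^+ 2 = (2 * phi + 3) ^+ 2 / 16 by rewrite -exprMn ll; field.
  have f3 : lam ^+ 2 * t = lam ^+ 2 * lam ^+ 2.
    apply: (mulfI (_ : 4 * (phi + 1) != 0)); first by rewrite mulf_neq0 //; lra.
    have -> : 4 * (phi + 1) * (lam ^+ 2 * t) = lam ^+ 2 * (l ^+ 2 + 4 * (phi + 1) * t) - lam ^+ 2 * l ^+ 2 by ring.
    by rewrite f f2 l2; field: p2.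
  by apply: (mulfI _ f3); rewrite expf_neq0 // lt0r_neq0.
have s0 : 0 <= s by apply: addr_ge0; apply: mulr_ge0; lra.
have sl : (2 * phi + 1) * lam <= s.
  rewrite -(@ler_pXn2r _ 2) ?nnegrE ?mulr_ge0 ?(ltW l0) //; try lra.
  rewrite exprMn -tE -subr_ge0 (_ : _ - _ = (7 * phi + 4) * (y * z) + (4 * phi + 3) * z ^+ 2); last first.
    by rewrite /s /t; ring: p2.
  by apply: addr_ge0; apply: mulr_ge0; rewrite ?sqr_ge0 ?mulr_le0 //; lra.
have lw : (phi + 2) * (lam * w) = lam * l + lam * s by rewrite /l /s; ring.
have ls : lam * ((2 * phi + 1) * lam) <= lam * s by rewrite ler_pM2l.
have e : lam * ((2 * phi + 1) * lam) = (7 * phi + 5) / 4.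
  have -> : lam * ((2 * phi + 1) * lam) = (2 * phi + 1) * lam ^+ 2 by ring.
  by rewrite l2; field: p2.
rewrite {}e in ls.
have lww : (phi + 2) * (lam * w) >= (5 * phi + 2) / 4 by lra.
have -> : - (-1 + - (2 * - lam) * - lam + - (2 * - lam) * w) = 1 + 2 * lam ^+ 2 - 2 * (lam * w) by ring.
rewrite l2; nra.
Qed.

(** D is the farthest point of the tetrahedron from A: the face a bounds the linear form n below by
    lam h, while n^2 dominates a multiple of h^2 - 1. *)
Lemma chamber_far p : lorentz p p = -1 -> H <= - lorentz p (pt A) ->
  lorentz p a <= 0 -> lorentz p b <= 0 -> lorentz p c <= 0 -> lorentz p d <= 0 -> p = pt D.
Proof.
move=> pp hH; have /andP[p1 p3] := golden_bounds R.
pose h := - lorentz p (pt A); have pA : lorentz p (pt A) = - h by rewrite /h opprK.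
have := lorentz_frame_A p; have := lorentz_frame_sqr pA erefl erefl erefl; rewrite pp sqrrN pA.
rewrite -/h in hH; move=> E L a0 b0 c0 d0.
suff [eh [eb ec ed]] : h = H /\ [/\ lorentz p b = 0, lorentz p c = 0 & lorentz p d = - lam].
  by apply: frame_ext_A; rewrite ?eb ?ec ?ed ?frame_D_incidence ?(frame_incidence fr) // pA eh [RHS]lorentzC frame_lorentz_AD.
clearbody h; move: (lorentz p a) (lorentz p b) (lorentz p c) (lorentz p d) a0 b0 c0 d0 E L.
move=> x y z w x0 y0 z0 w0; set Q := (X in (phi + 1) * X) => E L.
pose n := 3 / 2 * (phi + 1) * y + (2 * phi + 1) * z + (phi + 1 / 2) * w.
have n0 : 0 <= - n.
  have -> : - n = 3 / 2 * (phi + 1) * - y + (2 * phi + 1) * - z + (phi + 1 / 2) * - w by rewrite /n; ring.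
  by do !apply: addr_ge0; apply: mulr_ge0; lra.
have nl : - n <= lam * h by rewrite /n; lra.
have n2 : n ^+ 2 <= lam ^+ 2 * h ^+ 2.
  by rewrite -exprMn -[n ^+ 2]sqrrN ler_pXn2r ?nnegrE // (le_trans n0).
(* The multiple of Q is the one that cancels w^2, because the inequality must be an equality at D,
   where y = z = 0. *)
have nE : 20 * n ^+ 2 = (11 * phi + 7) * ((phi + 1) * Q) + (phi + 1) * ((12 * phi + 24) * y ^+ 2
    + (16 * phi + 12) * z ^+ 2 + (48 * phi + 16) * (y * z) + (24 * phi + 8) * (y * w) + (16 * phi + 12) * (z * w)).
  by rewrite /n /Q; field: p2.
have Q0 : y = 0 -> z = 0 -> Q = (3 - phi) * w ^+ 2 by rewrite /Q => -> ->; ring.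
clearbody Q n.
have sq : (phi + 1) * (y ^+ 2 + z ^+ 2) <= (11 * phi + 7) - (12 - 4 * phi) * h ^+ 2.
  have QE : (phi + 1) * Q = h ^+ 2 - 1 by lra.
  rewrite l2 in n2; rewrite QE in nE.
  have y2 : 0 <= (12 * phi + 23) * y ^+ 2 by apply: mulr_ge0; [lra|exact: sqr_ge0].
  have z2 : 0 <= (16 * phi + 11) * z ^+ 2 by apply: mulr_ge0; [lra|exact: sqr_ge0].
  have yz : 0 <= (48 * phi + 16) * (y * z) by apply: mulr_ge0; [lra|exact: mulr_le0].
  have yw : 0 <= (24 * phi + 8) * (y * w) by apply: mulr_ge0; [lra|exact: mulr_le0].
  have zw : 0 <= (16 * phi + 12) * (z * w) by apply: mulr_ge0; [lra|exact: mulr_le0].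
  have : (phi + 1) * (y ^+ 2 + z ^+ 2) <= (phi + 1) * ((12 * phi + 24) * y ^+ 2
      + (16 * phi + 12) * z ^+ 2 + (48 * phi + 16) * (y * z) + (24 * phi + 8) * (y * w) + (16 * phi + 12) * (z * w)).
    by rewrite ler_pM2l; lra.
  lra.
have h2 : 2 * phi + 5 / 4 <= h ^+ 2 by rewrite -H2 ler_pXn2r ?nnegrE //; lra.
have h3 : 11 * phi + 7 <= (12 - 4 * phi) * h ^+ 2.
  have -> : 11 * phi + 7 = (12 - 4 * phi) * (2 * phi + 5 / 4) by field: p2.
  by rewrite ler_pM2l //; lra.
have yz0 : y ^+ 2 + z ^+ 2 <= 0 by rewrite -(pmulr_rle0 _ (_ : 0 < phi + 1)); lra.
have y2 := sqr_ge0 y; have z2 := sqr_ge0 z.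
have ey : y = 0 by apply/eqP; rewrite -sqrf_eq0; apply/eqP; lra.
have ez : z = 0 by apply/eqP; rewrite -sqrf_eq0; apply/eqP; lra.
have h4 : h ^+ 2 <= H ^+ 2.
  rewrite H2 -(ler_pM2l (_ : 0 < 12 - 4 * phi)); last by lra.
  have -> : (12 - 4 * phi) * (2 * phi + 5 / 4) = 11 * phi + 7 by field: p2.
  have : 0 <= (phi + 1) * (y ^+ 2 + z ^+ 2) by rewrite ey ez expr0n /= addr0 mulr0.
  by lra.
have eh : h = H by apply/eqP; rewrite eq_le hH andbT -(@ler_pXn2r _ 2) ?nnegrE //; lra.
split=> //; split=> //.
have w2 : w ^+ 2 = lam ^+ 2.
  apply: (mulfI (_ : phi + 2 != 0)); first by apply/eqP; lra.
  have -> : (phi + 2) * w ^+ 2 = (phi + 1) * ((3 - phi) * w ^+ 2) by ring: p2.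
  by rewrite -Q0 // l2 (_ : (phi + 1) * Q = h ^+ 2 - 1); [rewrite eh H2; field: p2|lra].
by move/eqP: w2; rewrite eqf_sqr => /orP[/eqP wl|/eqP //]; have := l0; rewrite -wl; lra.
Qed.

End Cones.

(** * Packing and rigidity of a discrete overgroup *)

Section Packing.
Import Order.TTheory GRing.Theory Num.Theory.
Local Open Scope ring_scope.
Variables (R : realType) (A B C D : H3 R) (a b c d : 'rV[R]_4).
Hypothesis fr : frame353 A B C D a b c d.
Local Notation phi := (golden R).
Local Notation lam := (frame_lambda A a).
Local Notation H := (phi + 1 / 2).
Local Notation Gam := (Gamma A B C D).
Local Notation Del := (Delta A B C D).
Local Notation ra := (reflection a).
Local Notation rb := (reflection b).
Local Notation rc := (reflection c).
Local Notation rd := (reflection d).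
Let l0 : 0 < lam := frame_lambda_gt0 fr.
Let sG := Gamma_subgroup A B C D.

(* Among the images of q under the stabiliser in Gamma of the vertices outside J, take one
   minimising the sum of the cosh-distances to the four vertices. *)
Lemma chamber_move (J : pred 'I_4) (q : H3 R) : exists g, [/\ Gam g,
  forall i, ~~ J i -> vact g (pt (vertex A B C D i)) = pt (vertex A B C D i) &
  forall j, J j -> lorentz (vact g (pt q)) (nth 0 [:: a; b; c; d] j) <= 0].
Proof.
pose P i := pt (vertex A B C D i); pose e (i : 'I_4) := nth 0 [:: a; b; c; d] i.
pose X := [set g | Gam g /\ forall i, ~~ J i -> vact g (P i) = P i].
pose F g := \sum_i - lorentz (vact g (pt q)) (P i).
have ge1 g i : 1 <= - lorentz (vact g (pt q)) (P i) by rewrite vact_pt lerNr lorentz_pt_le.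
have ee (i : 'I_4) : lorentz (e i) (e i) = 1 by exact: frame_gen_unit fr i.
have eP (i j : 'I_4) : i != j -> lorentz (P i) (e j) = 0.
  by move=> ij; rewrite lorentzC -[e j](rowK (fun j : 'I_4 => e j)) frame_mx_vertex // eq_sym.
have ePlt (i : 'I_4) : lorentz (P i) (e i) < 0.
  by rewrite lorentzC -[e i](rowK (fun j : 'I_4 => e j)) frame_mx_vertex_lt0.
have fin M : finite_set [set g | X g /\ F g <= M].
  pose k := 8 * pt q 0 0 ^+ 2; pose M' := k * (- lorentz (pt A) (pt q) * M).
  apply: sub_finite_set (Gamma_discrete fr M') => g [[Gg _] gM]; split=> //.
  rewrite vact_lorentzV vact_pt (le_trans (lorentz_triangle _ _ q)) // /M' -/k.
  rewrite ler_wpM2l ?mulr_ge0 ?exprn_ge0 ?(ltW (pt_gt0 _)) //.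
  rewrite -[X in X <= _]mulrNN ler_wpM2l //; first by rewrite oppr_ge0 (le_trans (lorentz_pt_le _ _)) ?oppr_le0.
  apply: le_trans gM; rewrite -vact_pt lorentzC vact_lorentzV invgK lorentzC.
  rewrite /F (bigD1 0) //= -[X in X <= _]addr0 lerD2l sumr_ge0 // => i _.
  exact: le_trans ler01 (ge1 g i).
have X0 : X !=set0 by exists 1%g; split=> [|i _]; [exact: subgroup1|rewrite vact1].
have [g [Gg gP] gmin] := finite_set_argmin X0 fin.
(* Otherwise the reflection in e_j, which fixes the other three vertices, would bring the image of q
   nearer to vertex j. *)
exists g; split=> // j Jj; rewrite leNgt; apply/negP => pos.
pose s := reflection (e j); have : F g <= F (s * g)%g.
  apply: gmin; split=> [|i Ji].
    apply: (subgroupM sG) => //; have [Ga Gb Gc Gd] := Gamma_gens fr.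
    by rewrite /s /e; case: (j) => [[|[|[|[|j']]]] hj].
  rewrite vactM gP // reflection_fix ?ee // eP //.
  by apply: contraNneq Ji => ->.
rewrite /F (bigD1 j) //= [X in _ <= X](bigD1 j) //= [X in _ <= _ + X](eq_bigr (fun i => - lorentz (vact g (pt q)) (P i))).
  rewrite lerD2r vactM reflectionDE ?ee // lorentzDl lorentzZl [lorentz (e j) _]lorentzC.
  by have := ePlt j; nra.
by move=> i ij; rewrite vactM reflection_lorentz ?ee // reflection_fix ?ee // eP.
Qed.

Lemma cone_move q : exists g, [/\ Gam g, vact g (pt A) = pt A, lorentz (vact g (pt q)) b <= 0,
  lorentz (vact g (pt q)) c <= 0 & lorentz (vact g (pt q)) d <= 0].
Proof.
have [g [Gg gP gJ]] := chamber_move (fun i => i != 0) q.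
exists g; split=> //; first by apply: (gP 0).
- exact: (gJ 1).
- exact: (gJ 2%:R).
- exact: (gJ 3%:R).
Qed.

Lemma sector_move q : exists g, [/\ Gam g, vact g (pt A) = pt A, vact g (pt D) = pt D,
  lorentz (vact g (pt q)) b <= 0 & lorentz (vact g (pt q)) c <= 0].
Proof.
have [g [Gg gP gJ]] := chamber_move (fun i => (i != 0) && (i != 3%:R)) q.
exists g; split=> //; first by apply: (gP 0).
- exact: (gP 3%:R).
- exact: (gJ 1).
- exact: (gJ 2%:R).
Qed.

Lemma full_move q : exists g, [/\ Gam g, lorentz (vact g (pt q)) a <= 0, lorentz (vact g (pt q)) b <= 0,
  lorentz (vact g (pt q)) c <= 0 & lorentz (vact g (pt q)) d <= 0].
Proof.
have [g [Gg _ gJ]] := chamber_move xpredT q.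
exists g; split=> //.
- exact: (gJ 0).
- exact: (gJ 1).
- exact: (gJ 2%:R).
- exact: (gJ 3%:R).
Qed.

Let ga : lorentz a a = 1. Proof. by rewrite (frame_gram fr). Qed.
Let gb : lorentz b b = 1. Proof. by rewrite (frame_gram fr). Qed.
Let gc : lorentz c c = 1. Proof. by rewrite (frame_gram fr). Qed.
Let gd : lorentz d d = 1. Proof. by rewrite (frame_gram fr). Qed.
Let raD : vact ra (pt D) = pt D. Proof. by rewrite reflection_fix // (frame_incidence fr). Qed.
Let rbA : vact rb (pt A) = pt A. Proof. by rewrite reflection_fix // (frame_incidence fr). Qed.
Let rdA : vact rd (pt A) = pt A. Proof. by rewrite reflection_fix // (frame_incidence fr). Qed.

(** Gamma and Delta have the same orbit through a vector on a mirror; this turns motions by Gamma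
    into motions by N. *)
Lemma Gamma_orbit x n v : lorentz n n = 1 -> Gam (reflection n) -> Gam x -> lorentz v n = 0 ->
  exists2 y, Del y & vact x v = vact y v.
Proof.
move=> nn Gn Gx vn; have [Dx|Dx] := Gamma_Delta nn Gn Gx; first by exists x.
by exists (x * reflection n)%g; rewrite // vactM reflection_fix.
Qed.

Variables (r : isoH3 R) (N : set (isoH3 R)).
Hypothesis hr : half_turn a b c d r.
Hypothesis sN : is_subgroup N.
Hypothesis DN : Del `<=` N.
Hypothesis rN : N r.
Hypothesis N_discrete : forall M, finite_set [set g | N g /\ - lorentz (vact g (pt A)) (pt A) <= M].

Let qq g : lorentz (vact g (pt A)) (vact g (pt A)) = -1.
Proof. by rewrite vact_lorentz lorentz_pt. Qed.

Section MinimalDistance.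
Variable h : R.
Hypothesis hH : 0 < h < H.
Hypothesis h_min : forall g, N g -> vact g (pt A) != pt A -> h <= - lorentz (vact g (pt A)) (pt A).

(** The isometry x only transports both points and need not lie in N. *)
Lemma orbit_min g k x : N g -> N k -> - lorentz (vact x (vact g (pt A))) (vact x (vact k (pt A))) < h ->
  vact x (vact g (pt A)) = vact x (vact k (pt A)).
Proof.
rewrite vact_lorentz => Ng Nk gk; congr vact; apply/eqP; apply: contraTT gk => gk.
rewrite -leNgt -(vactKV k (vact g (pt A))) vact_lorentz -vactM; apply: h_min.
  by apply: (subgroupM sN) => //; exact: subgroupV.
by apply: contraNneq gk => e; rewrite -[X in vact k X]e vactM vactKV.
Qed.

Lemma minimal_axis g : N g -> vact g (pt A) != pt A -> - lorentz (vact g (pt A)) (pt A) = h ->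
  exists x, [/\ Gam x, vact x (pt A) = pt A & let q := vact x (vact g (pt A)) in
   [/\ lorentz q b = 0, lorentz q c = 0, lorentz q d < 0 & lorentz q (pt A) = - h]].
Proof.
move=> Ng gA gh; have := cone_move (g A); rewrite -vact_pt => -[x [Gx xA xb xc xd]].
exists x; split=> //; set q := vact x _ in xb xc xd *.
have qA : lorentz q (pt A) = - h by rewrite -gh opprK -{1}xA vact_lorentz.
have q1 : lorentz q q = -1 by rewrite vact_lorentz qq.
have [qb qc] : lorentz q b = 0 /\ lorentz q c = 0.
  apply: contrapT => /(cone_rotation fr q1 _ xb xc xd); rewrite qA opprK => /(_ hH) /andP[m1 m2].
  (* x may be odd and outside N, but its conjugate of the rotation is in Delta. *)
  have Dbc : Del ((rb * rc) ^ x)%g by apply: (Delta_conj _ Gx); have [] := Delta_gens fr.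
  have E : vact (rb * rc)%g q = vact x (vact ((rb * rc) ^ x * g)%g (pt A)).
    by rewrite -vactM mulgA -conjgC !vactM.
  have : vact x (vact ((rb * rc) ^ x * g)%g (pt A)) = q.
    apply: orbit_min => //; last by rewrite -E.
    by apply: (subgroupM sN) => //; exact: DN.
  by move=> E'; move: m1; rewrite E E' q1 opprK ltxx.
split=> //; rewrite lt_neqAle xd andbT; apply/eqP => qd.
have := cone_axis fr q1 qb qc; rewrite qA qd opprK expr0n /= mulr0 addr0 => h1.
have {h1} h1 : h = 1 by apply/eqP; rewrite -(eqrXn2 (n := 2)) ?expr1n ?h1 //; case/andP: hH => /ltW.
have : q = pt A by apply: (frame_ext_A fr); rewrite ?qb ?qc ?qd ?(frame_incidence fr) ?qA ?h1 ?lorentz_pt.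
by rewrite -xA => /(congr1 (vact x^-1%g)); rewrite !vactK => /eqP; apply/negP.
Qed.

Lemma minimal_absurd g : N g -> vact g (pt A) != pt A -> - lorentz (vact g (pt A)) (pt A) = h -> False.
Proof.
move=> Ng gA gh; have /andP[p1 p3] := golden_bounds R.
have NgV : N g^-1%g by exact: subgroupV.
have gVA : vact g^-1%g (pt A) != pt A.
  by apply: contraNneq gA => e; rewrite -[X in vact g X]e vactKV.
have gVh : - lorentz (vact g^-1%g (pt A)) (pt A) = h by rewrite vact_lorentzV invgK lorentzC.
have [x [Gx xA /= [qb qc qd qA]]] := minimal_axis Ng gA gh.
have [y [Gy yA /= [q2b q2c q2d q2A]]] := minimal_axis NgV gVA gVh.
set q := vact x _ in qb qc qd qA; set q2 := vact y _ in q2b q2c q2d q2A.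
have q1 : lorentz q q = -1 by rewrite vact_lorentz qq.
have q21 : lorentz q2 q2 = -1 by rewrite vact_lorentz qq.
have h2 := cone_axis fr q1 qb qc; rewrite qA opprK in h2.
have q2E : q2 = q.
  apply: (frame_ext_A fr); rewrite ?qb ?qc ?qA //.
  have := cone_axis fr q21 q2b q2c; rewrite q2A opprK h2 => /addrI/mulfI e.
  have {}e : lorentz q d ^+ 2 = lorentz q2 d ^+ 2 by apply: e; apply/eqP; lra.
  by move/eqP: e; rewrite eqf_sqr => /orP[/eqP->//|/eqP e]; exfalso; lra.
(* f exchanges A and q. It carries [rd q], a neighbour of q around A, to a neighbour of A around q;
   z fixes the axis pointwise and brings the latter into the sector of [rd q]. *)
pose f := (x * g * y^-1)%g.
have yVA : vact y^-1%g (pt A) = pt A by rewrite -{1}yA vactK.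
have fA : vact f (pt A) = q by rewrite !vactM yVA.
have fq : vact f q = pt A by rewrite -q2E /f /q2 !vactM vactK vactKV.
have [z] := sector_move (f (rd (x (g A)))).
rewrite -!vact_pt -/q => -[Gz zA zD]; set p := vact z _ => pb pc.
have zq : vact z q = q.
  pose t := - (lorentz q d / lam); pose s := h - t * H.
  have -> : q = s *: pt A + t *: pt D.
    apply: (frame_ext_A fr); rewrite ?qb ?qc ?qA !lorentzL ?(frame_incidence fr) ?mulr0 ?addr0 ?add0r //.
      by rewrite lorentz_pt [lorentz (pt D) _]lorentzC (frame_lorentz_AD fr) /s; ring.
    by rewrite (frame_D_incidence fr) /t; field; exact: lt0r_neq0.
  by rewrite !vactL zA zD.
have pq : lorentz p q = - h.
  by rewrite -[X in lorentz _ X]zq /p vact_lorentz -[X in lorentz _ X]fA vact_lorentz reflection_lorentz // rdA.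
have pA : lorentz p (pt A) = - (1 + 2 * lorentz q d ^+ 2).
  rewrite -[X in lorentz _ X]zA /p vact_lorentz -[X in lorentz _ X]fq vact_lorentz reflectionDE // lorentzDl lorentzZl q1.
  by rewrite [lorentz d q]lorentzC; ring.
have p1' : lorentz p p = -1 by rewrite !vact_lorentz lorentz_pt.
have pd : 0 < lorentz p d.
  apply: (cone_swap fr p1' q1 qb qc qd); rewrite ?qA ?opprK //.
  by rewrite pA opprK.
have rdq : vact rd q = q + (- (2 * lorentz q d)) *: d by rewrite reflectionDE.
have near : - lorentz p (vact rd q) < h.
  by rewrite rdq lorentzDr lorentzZr pq; nra.
(* As q lies on the mirror of b, the odd [rd] acts on it like the even [rd rb]. *)
have rbq : vact rb q = q by rewrite reflection_fix.
have Dbd : Del (rd * rb)%g by have [_ Gb _ Gd] := Gamma_gens fr; exact: reflections_Delta.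
have pE : p = vact (z * x)%g (vact (g * ((rd * rb) ^ y) * g^-1)%g (pt A)).
  by rewrite /p -{1}rbq -q2E /f /q2 conjgE !vactM.
have rE : vact rd q = vact (z * x)%g (vact ((rd * rb) ^ (z * x) * g)%g (pt A)).
  by rewrite -{1}rbq -{1}zq /q conjgE invMg !vactM !vactKV.
have : p = vact rd q.
  rewrite pE rE; apply: orbit_min; last by rewrite -pE -rE.
    apply: sN.2 => //; apply: (subgroupM sN Ng).
    exact: DN (Delta_conj Dbd Gy).
  by apply: (subgroupM sN) Ng; exact: DN (Delta_conj Dbd (subgroupM sG Gz Gx)).
(* Coincidence would give h = 1 + 2 e^2 with e = (q, d), against h^2 = 1 + (phi + 2) e^2 and phi + 2
   < 4. *)
move=> pr; move: pq; rewrite pr rdq lorentzDl lorentzZl q1 [lorentz d q]lorentzC => hE.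
have e2 : 0 < lorentz q d ^+ 2 by rewrite exprn_even_gt0 //= lt_eqF.
have {}hE : h = 1 + 2 * lorentz q d ^+ 2 by rewrite expr2; lra.
by move: h2 e2; rewrite hE; move: (lorentz q d ^+ 2) => e; nra.
Qed.

End MinimalDistance.

Lemma orbit_packing g : N g -> vact g (pt A) != pt A -> H <= - lorentz (vact g (pt A)) (pt A).
Proof.
move=> Ng gA; rewrite leNgt; apply/negP => gH.
pose X := [set g | N g /\ vact g (pt A) != pt A].
have fin M : finite_set [set g | X g /\ - lorentz (vact g (pt A)) (pt A) <= M].
  by apply: sub_finite_set (N_discrete M) => x [[Nx _] xM].
have X0 : X !=set0 by exists g.
have [k [Nk kA] kmin] := finite_set_argmin X0 fin.
apply: (@minimal_absurd (- lorentz (vact k (pt A)) (pt A)) _ _ k) => //.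
  apply/andP; split; last exact: le_lt_trans (kmin g (conj Ng gA)) gH.
  by rewrite vact_pt oppr_gt0 (le_lt_trans (lorentz_pt_le _ _)) ?oppr_lt0.
by move=> y Ny yA; apply: kmin.
Qed.

Let gens : [/\ Gam ra, Gam rb, Gam rc & Gam rd] := Gamma_gens fr.

(** Since x may be outside N, both points are pulled back by it; the hypothesis on y says that the
    second one stays in the orbit of N. *)
Lemma packing_near x g k : Gam x -> N g -> N k ->
  - lorentz (vact x (vact g (pt A))) (vact k (pt A)) < H ->
  (exists2 y, Gam y & vact x^-1%g (vact k (pt A)) = vact (y * k)%g (pt A) /\ Del y) ->
  vact x (vact g (pt A)) = vact k (pt A).
Proof.
move=> Gx Ng Nk near [y Gy [yE Dy]]; apply/eqP; apply: contraTT near => ne.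
rewrite -leNgt -(vactKV x (vact k (pt A))) vact_lorentz yE.
have Nyk : N (y * k)%g by apply: (subgroupM sN) => //; exact: DN.
rewrite -(vactKV (y * k)%g (vact g (pt A))) vact_lorentz -vactM; apply: orbit_packing.
  by apply: (subgroupM sN) => //; exact: subgroupV.
apply: contraNneq ne => e; apply/eqP; rewrite -[RHS](vactKV x) yE; congr vact.
by rewrite -[X in vact (y * k)%g X]e (vactM (y * k)^-1%g) vactKV.
Qed.

Let rA : vact r (pt A) = pt D := half_turn_A fr hr.
Let rD : vact r (pt D) = pt A.
Proof. by rewrite -rA -vactM (half_turn_sqr fr hr) vact1. Qed.

Lemma packing_near_A x g : Gam x -> N g -> - lorentz (vact x (vact g (pt A))) (pt A) < H ->
  vact x (vact g (pt A)) = pt A.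
Proof.
move=> Gx Ng near; have [_ Gb _ _] := gens.
have Ab : lorentz (pt A) b = 0 by rewrite (frame_incidence fr).
have [y Dy yE] := Gamma_orbit gb Gb (subgroupV sG Gx) Ab.
have := @packing_near x g 1%g Gx Ng (subgroup1 sN); rewrite vact1; apply=> //.
by exists y; [case/Delta_det: Dy|rewrite mulg1].
Qed.

Lemma packing_near_D x g k : Gam x -> N g -> Gam k ->
  - lorentz (vact x (vact g (pt A))) (vact k (pt D)) < H ->
  vact x (vact g (pt A)) = vact k (pt D).
Proof.
move=> Gx Ng Gk near; have [Ga _ _ _] := gens.
have Da : lorentz (pt D) a = 0 by rewrite (frame_incidence fr).
have [y Dy yE] := Gamma_orbit ga Ga Gk Da.
have [z Dz zE] := Gamma_orbit ga Ga (subgroupM sG (subgroupV sG Gx) Gk) Da.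
rewrite yE -rA -(vactM y r); apply: (packing_near Gx Ng).
- by apply: (subgroupM sN) => //; exact: DN.
- by move: near; rewrite yE -rA -(vactM y r).
have Dzy : Del (z * y^-1)%g by apply: (Delta_subgroup A B C D).2.
exists (z * y^-1)%g; first by case/Delta_det: Dzy.
by split=> //; rewrite mulgA mulgVK !vactM rA -zE vactM yE.
Qed.

(** A point moved into the tetrahedron is A by packing if it is nearer to A than |AD|, and otherwise
    D by [chamber_far]. *)
Lemma orbit_chamber g : N g -> exists2 x, Gam x &
  vact x (vact g (pt A)) = pt A \/ vact x (vact g (pt A)) = pt D.
Proof.
move=> Ng; have [x] := full_move (g A); rewrite -vact_pt => -[Gx xa xb xc xd].
exists x => //; set q := vact x _ in xa xb xc xd *.
have [near|far] := ltP (- lorentz q (pt A)) H; first by left; exact: packing_near_A.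
by right; apply: (chamber_far fr); rewrite // vact_lorentz qq.
Qed.

(** The line of b is the orthogonal complement of A, D and d, so h multiplies b by a sign, and [rb]
    corrects the sign -1. *)
Lemma fix_flag h : vact h (pt A) = pt A -> vact h (pt D) = pt D -> vact h d = d ->
  h = 1%g \/ h = rb.
Proof.
move=> hA hD hd; have /andP[p1 p3] := golden_bounds R.
have dD := frame_D_incidence fr.
have dA : lorentz (pt A) a = - lam by rewrite opprK.
have [x [y [z [w E]]]] := frame_coord fr (vact h b).
have eA : lorentz (vact h b) (pt A) = 0 by rewrite -hA vact_lorentz lorentzC (frame_incidence fr).
have eD : lorentz (vact h b) (pt D) = 0 by rewrite -hD vact_lorentz lorentzC (frame_incidence fr).
have ed : lorentz (vact h b) d = 0 by rewrite -hd vact_lorentz (frame_gram fr).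
have ln : - lam != 0 by rewrite oppr_eq0 lt0r_neq0.
have x0 : x = 0.
  by apply: (mulIf ln); rewrite mul0r -eA lorentzC E !lorentzL !(frame_incidence fr) dA; ring.
have w0 : w = 0.
  by apply: (mulIf ln); rewrite mul0r -eD lorentzC E !lorentzL !(frame_incidence fr) dD; ring.
have z0 : z = 0.
  by move: ed; rewrite E x0 w0 !lorentzL !(frame_gram fr); lra.
have {}E : vact h b = y *: b by rewrite E x0 z0 w0 !scale0r !addr0 add0r.
have y2 : y ^+ 2 = 1.
  by have := vact_lorentz h b b; rewrite E !lorentzL gb mulr1 expr2.
have id_flag k : vact k (pt A) = pt A -> vact k (pt D) = pt D -> vact k d = d -> vact k b = b -> k = 1%g.
  move=> kA kD kd kb; apply: vact_ext => v; rewrite vact1.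
  have eqA : lorentz (vact k v) (pt A) = lorentz v (pt A) by rewrite -{1}kA vact_lorentz.
  have eqD : lorentz (vact k v) (pt D) = lorentz v (pt D) by rewrite -{1}kD vact_lorentz.
  have eqd : lorentz (vact k v) d = lorentz v d by rewrite -{1}kd vact_lorentz.
  have eqb : lorentz (vact k v) b = lorentz v b by rewrite -{1}kb vact_lorentz.
  apply: (frame_ext_A fr) => //.
  have := lorentz_frame_A fr v; have := lorentz_frame_A fr (vact k v).
  have := lorentz_frame_D fr v; have := lorentz_frame_D fr (vact k v).
  rewrite eqA eqD eqd eqb; set u := lorentz _ a; set u' := lorentz _ a.
  move: (lorentz _ c) (lorentz v c) => t t' h1 h2 h3 h4.
  have e1 : u - u' = - (2 * phi + 1) * (t - t') by lra.
  have e2 : (phi + 1 / 2) * (u - u') = - (3 / 2 * (phi + 1) * (t - t')) by lra.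
  have p2 := golden_sqr R; rewrite e1 in e2.
  have : (5 / 2 * phi + 1) * (t - t') = 0.
    rewrite (_ : _ * _ = 3 / 2 * - (phi + 1) * (t - t') - (phi + 1 / 2) * (- (2 * phi + 1) * (t - t'))); last by field: p2.
    by rewrite e2; ring.
  by move/eqP; rewrite mulf_eq0 subr_eq0 => /orP[/eqP|/eqP //]; lra.
move/eqP: y2; rewrite sqrf_eq1 => /orP[/eqP y1|/eqP y1]; [left|right].
  by apply: id_flag => //; rewrite E y1 scale1r.
have rbD : vact rb (pt D) = pt D by rewrite reflection_fix // (frame_incidence fr).
have : (rb * h)%g = 1%g.
  apply: id_flag; rewrite vactM ?hA ?hD ?hd //.
    by rewrite reflection_fix // (frame_gram fr).
  by rewrite E y1 scaleN1r vactN reflectionE // gb mulr1 scaler_nat mulr2n opprB addrK.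
by move/(mulg1_eq); rewrite reflectionV.
Qed.

(** Packing also controls the images of D and [rd D]: [cone_vertex_D] and [cone_neighbour] show
    that, after elements of Gamma, these are fixed too, so a flag is fixed. *)
Lemma stabiliser_rigid x g : Gam x -> N g -> vact x (vact g (pt A)) = pt A -> Gam g.
Proof.
move=> Gx Ng xgA; have [Ga Gb Gc Gd] := gens.
have AD : - lorentz (pt D) (pt A) = H by rewrite lorentzC (frame_lorentz_AD fr) opprK.
have [y] := cone_move (x (g D)); rewrite -!vact_pt => -[Gy yA]; set p := vact y _ => pb pc pd.
have Ngr : N (g * r)%g by exact: subgroupM.
have pE : p = vact (y * x)%g (vact (g * r)%g (pt A)) by rewrite /p !vactM rA.
have Gyx := subgroupM sG Gy Gx.
have p1 : lorentz p p = -1 by rewrite !vact_lorentz lorentz_pt.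
have pA : - lorentz p (pt A) = H by rewrite -[X in lorentz _ X]yA vact_lorentz -[X in lorentz _ X]xgA !vact_lorentz.
have pD : p = pt D.
  have := cone_vertex_D fr p1 pA pb pc pd; rewrite pE -[X in lorentz _ X]vact1.
  by move/(packing_near_D Gyx Ngr (subgroup1 sG)); rewrite vact1.
pose h := (y * x * g)%g.
have hA : vact h (pt A) = pt A by rewrite !vactM xgA.
have hD : vact h (pt D) = pt D by rewrite !vactM.
have [z] := sector_move (h (rd D)); rewrite -!vact_pt => -[Gz zA zD]; set s := vact z _ => sb sc.
have Dda : Del (rd * ra)%g by exact: reflections_Delta.
have Ngd : N (g * (rd * ra) * r)%g by do 2!apply: (subgroupM sN) => //; exact: DN.
have sE : s = vact (z * (y * x))%g (vact (g * (rd * ra) * r)%g (pt A)).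
  by rewrite /s /h !vactM rA raD.
have s1 : lorentz s s = -1 by rewrite !vact_lorentz lorentz_pt.
have sA : - lorentz s (pt A) = H.
  by rewrite -[X in lorentz _ X]zA vact_lorentz -[X in lorentz _ X]hA vact_lorentz reflection_lorentz // rdA.
have sD : lorentz s (pt D) = lorentz (vact rd (pt D)) (pt D).
  by rewrite -[X in lorentz _ X]zD vact_lorentz -[X in lorentz _ X]hD vact_lorentz.
have sd : s = vact rd (pt D).
  have := cone_neighbour fr s1 sA sD sb sc; rewrite sE.
  exact: packing_near_D (subgroupM sG Gz Gyx) Ngd Gd.
pose k := (z * h)%g.
have kA : vact k (pt A) = pt A by rewrite vactM hA.
have kD : vact k (pt D) = pt D by rewrite vactM hD.
have kd : vact k d = d.
  have : vact k (vact rd (pt D)) = vact rd (pt D) by rewrite vactM.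
  rewrite reflectionDE // (frame_D_incidence fr) vactD vactZ kD => /addrI/scalerI; apply.
  by rewrite oppr_eq0 mulf_neq0 // oppr_eq0 lt0r_neq0.
have gE : g = ((z * (y * x))^-1 * k)%g by rewrite /k /h (mulgA z (y * x)%g) mulKg.
rewrite gE; apply: (subgroupM sG); first by apply: (subgroupV sG); exact: subgroupM sG Gz Gyx.
by have [->|->] := fix_flag kA kD kd; [exact: subgroup1|].
Qed.

Theorem discrete_overgroup g : N g -> Gam g \/ Gam (r * g)%g.
Proof.
move=> Ng; have [x Gx [xA|xD]] := orbit_chamber Ng; first by left; exact: stabiliser_rigid xA.
right; apply: (@stabiliser_rigid (x ^ r)%g); first exact: half_turn_Gamma hr _ Gx.
  exact: subgroupM.
by rewrite conjgE (half_turnV fr hr) !vactM -(vactM r r) (half_turn_sqr fr hr) vact1 xD rD.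
Qed.

End Packing.

(** * Quotients isomorphic to PSL(2,q) *)

Section TraceAlgebra.
Import GRing.Theory.
Local Open Scope ring_scope.
Variable F : fieldType.
Implicit Types (M N X Y Z W : 'M[F]_2) (t : F).

Lemma det_mx2 M : \det M = M 0 0 * M 1 1 - M 0 1 * M 1 0.
Proof.
rewrite (expand_det_row _ 0) !big_ord_recl big_ord0 addr0 /cofactor !det_mx11 !mxE /=.
have -> : lift 0 0 = 1 :> 'I_2 by apply: val_inj.
have -> : lift 1 0 = 0 :> 'I_2 by apply: val_inj.
by rewrite /bump /=; ring.
Qed.

Lemma trace_mx2 M : \tr M = M 0 0 + M 1 1.
Proof.
rewrite /mxtrace !big_ord_recl big_ord0 addr0.
by have -> : lift 0 0 = 1 :> 'I_2 by apply: val_inj.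
Qed.

Lemma mul_mx2 M N i j : (M * N) i j = M i 0 * N 0 j + M i 1 * N 1 j.
Proof.
rewrite -mulmxE mxE !big_ord_recl big_ord0 addr0.
by have -> : lift 0 0 = 1 :> 'I_2 by apply: val_inj.
Qed.

Lemma eq_mx2 M N : M 0 0 = N 0 0 -> M 0 1 = N 0 1 -> M 1 0 = N 1 0 -> M 1 1 = N 1 1 -> M = N.
Proof.
move=> e00 e01 e10 e11; apply/matrixP => i j.
have E (k : 'I_2) : k = 0 \/ k = 1 by case: k => [[|[|]] hk] //; [left|right]; apply: val_inj.
by case: (E i) => ->; case: (E j) => ->.
Qed.

Lemma cayley_hamilton2 M : M * M = \tr M *: M - \det M *: 1.
Proof.
by rewrite det_mx2 trace_mx2; apply: eq_mx2; rewrite !(mul_mx2, mxE) /=; ring.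
Qed.

(** The linearisation of Cayley-Hamilton, used to reorder products. *)
Lemma polarised_cayley_hamilton2 M N :
  N * M = \tr M *: N + \tr N *: M + (\tr (M * N) - \tr M * \tr N) *: 1 - M * N.
Proof.
by rewrite !trace_mx2; apply: eq_mx2; rewrite !(mul_mx2, mxE) /=; ring.
Qed.

Lemma trace_mul2 M N : \tr (M * N) = \tr (N * M).
Proof. exact: mxtrace_mulC. Qed.

Definition scalar_pm1 M := M = 1 \/ M = -1.

(** The only scalar matrices of determinant 1 are 1 and -1. *)
Lemma sl2_linear_relation M (k l : F) : \det M = 1 -> ~ scalar_pm1 M -> k *: M = l *: 1 -> k = 0 /\ l = 0.
Proof.
move=> dM nM kl; have [k0|k0] := eqVneq k 0.
  split=> //; move: kl; rewrite k0 scale0r => /(congr1 (fun W : 'M[F]_2 => W 0 0)).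
  by rewrite !mxE mulr1.
case: nM; have ME : M = (k^-1 * l) *: 1 by rewrite -scalerA -kl scalerA mulVf ?scale1r.
have : (k^-1 * l) ^+ 2 = 1 by rewrite -dM ME det_mx2 !mxE /=; ring.
by move/eqP; rewrite sqrf_eq1 ME => /orP[]/eqP->; [left|right]; rewrite ?scale1r ?scaleN1r.
Qed.

Lemma sl2_order3_trace X : \det X = 1 -> ~ scalar_pm1 X -> X * X * X = -1 -> \tr X = 1.
Proof.
move=> dX nX; have CH := cayley_hamilton2 X; rewrite dX scale1r in CH; set s := \tr X in CH *.
have -> : X * X * X = (s ^+ 2 - 1) *: X - s *: 1.
  by rewrite CH mulrBl mul1r -scalerAl CH scalerBr scalerA -expr2 scalerBl scale1r addrAC.
move=> E; have [] := @sl2_linear_relation X (s ^+ 2 - 1) (s - 1) dX nX.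
  by move/eqP: E; rewrite subr_eq => /eqP ->; rewrite scalerBl scale1r addrC.
by move=> _ /eqP; rewrite subr_eq0 => /eqP.
Qed.

(** By Cayley-Hamilton X^5 = (s^4 - 3 s^2 + 1) X - (s^3 - 2 s) with s the trace. So s^4 - 3 s^2 + 1
    and s^3 - 2 s - 1 vanish, and s^2 - s - 1 is s times the second minus the first. *)
Lemma sl2_order5_trace X : \det X = 1 -> ~ scalar_pm1 X -> X * X * X * X * X = -1 ->
  \tr X ^+ 2 = \tr X + 1.
Proof.
move=> dX nX; have CH := cayley_hamilton2 X; rewrite dX scale1r in CH; set s := \tr X in CH *.
have CH' : X * X = s *: X + (-1) *: 1 by rewrite CH scaleN1r.
have step k l : (k *: X + l *: 1) * X = (k * s + l) *: X + (- k) *: 1.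
  by rewrite mulrDl -!scalerAl mul1r CH' scalerDr !scalerA mulrN1 scalerDl addrAC.
rewrite CH' !step => E.
have [|h1 h2] := @sl2_linear_relation X (((s * s - 1) * s - s) * s - (s * s - 1)) (((s * s - 1) * s - s) - 1) dX nX.
  by move/eqP: E; rewrite scaleNr subr_eq => /eqP ->; rewrite [RHS]scalerBl scale1r addrC.
have : s ^+ 2 - s - 1 = s * (((s * s - 1) * s - s) - 1) - (((s * s - 1) * s - s) * s - (s * s - 1)) by ring.
by rewrite h1 h2 mulr0 subr0 -addrA -opprD => /eqP; rewrite subr_eq0 => /eqP.
Qed.

Lemma sl2_order2_trace W : \det W = 1 -> ~ scalar_pm1 W -> scalar_pm1 (W * W) -> \tr W = 0.
Proof.
move=> dW nW; rewrite cayley_hamilton2 dW scale1r => -[]E.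
  by have [] := @sl2_linear_relation W (\tr W) 2 dW nW _; rewrite // -[LHS](subrK 1) E scaler_nat mulr2n.
by have [] := @sl2_linear_relation W (\tr W) 0 dW nW _; rewrite // scale0r -[LHS](subrK 1) E addNr.
Qed.

(* The trace form on the span of 1, X, Y, XY has determinant -(t - 2)^2, a unit as t^2 = t + 1. *)
Definition trace_data t X Y := [/\ \det X = 1, \det Y = 1, \tr X = 1, \tr Y = t & \tr (X * Y) = 0].

Definition span4 X Y (e : 'rV[F]_4) : 'M[F]_2 := e 0 0 *: 1 + e 0 1 *: X + e 0 2%:R *: Y + e 0 3%:R *: (X * Y).

Lemma trace_data_relations t X Y : trace_data t X Y ->
  [/\ X * X = X - 1, Y * Y = t *: Y - 1 & Y * X = t *: X + Y - t *: 1 - X * Y].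
Proof.
case=> dX dY tX tY tXY; split.
- by rewrite cayley_hamilton2 dX tX !scale1r.
- by rewrite cayley_hamilton2 dY tY !scale1r.
by rewrite polarised_cayley_hamilton2 tX tY tXY scale1r sub0r mul1r scaleNr [Y + _]addrC.
Qed.

Definition row4 (x y z w : F) : 'rV[F]_4 := \row_i nth 0 [:: x; y; z; w] i.

Lemma span4_row X Y x y z w :
  span4 X Y (row4 x y z w) = x *: 1 + y *: X + z *: Y + w *: (X * Y).
Proof. by rewrite /span4 !mxE. Qed.

Lemma span4D X Y e f : span4 X Y (e + f) = span4 X Y e + span4 X Y f.
Proof.
rewrite /span4; move: (X * Y) => XY; apply/matrixP => i j; rewrite !mxE; ring.
Qed.

Lemma span4Z X Y k e : span4 X Y (k *: e) = k *: span4 X Y e.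
Proof. by rewrite /span4 !mxE !scalerDr !scalerA. Qed.

Lemma span4_mulX t X Y e : trace_data t X Y ->
  span4 X Y e * X = span4 X Y (row4 (- e 0 1 - t * e 0 2%:R - t * e 0 3%:R) (e 0 0 + e 0 1 + t * e 0 2%:R)
     (e 0 2%:R + e 0 3%:R) (- e 0 2%:R)).
Proof.
move=> /trace_data_relations[XX YY YX]; rewrite span4_row /span4 !mulrDl -!scalerAl mul1r XX YX.
have -> : X * Y * X = Y - t *: 1.
  rewrite -mulrA YX !mulrDr !mulrN -!scalerAr mulr1 mulrA XX mulrBl mul1r scalerBr.
  by move: (X * Y) => XY; apply/matrixP => i j; rewrite !mxE; ring.
by move: (X * Y) => XY; apply/matrixP => i j; rewrite !mxE; ring.
Qed.

Lemma span4_mulY t X Y e : trace_data t X Y ->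
  span4 X Y e * Y = span4 X Y (row4 (- e 0 2%:R) (- e 0 3%:R) (e 0 0 + t * e 0 2%:R) (e 0 1 + t * e 0 3%:R)).
Proof.
move=> /trace_data_relations[XX YY YX]; rewrite span4_row /span4 !mulrDl -!scalerAl mul1r YY.
rewrite -[X * Y * Y]mulrA YY mulrBr mulr1 -scalerAr.
by move: (X * Y) => XY; apply/matrixP => i j; rewrite !mxE; ring.
Qed.

Lemma span4_trace t X Y e : trace_data t X Y -> let M := span4 X Y e in
  [/\ \tr M = 2 * e 0 0 + e 0 1 + t * e 0 2%:R,
      \tr (M * X) = e 0 0 - e 0 1 - t * e 0 3%:R &
      \tr (M * Y) = t * e 0 0 + (t ^+ 2 - 2) * e 0 2%:R - e 0 3%:R].
Proof.
move=> tXY M; have [_ _ tX tY tXY'] := tXY.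
have tr4 x y z w : \tr (span4 X Y (row4 x y z w)) = 2 * x + y + t * z.
  by rewrite span4_row !linearD !linearZ /= mxtrace1 tX tY tXY'; ring.
split; rewrite ?(span4_mulX _ tXY) ?(span4_mulY _ tXY) ?tr4; try ring.
by rewrite /M /span4 !linearD !linearZ /= mxtrace1 tX tY tXY'; ring.
Qed.

(** The inverse of the matrix of the trace form has entries in Z[t], because (2 - t)(1 + t) = 1; so
    the formula is valid in every characteristic. *)
Lemma span4_coord t X Y e : t ^+ 2 = t + 1 -> trace_data t X Y -> let M := span4 X Y e in
  let m0 := \tr M in let m1 := \tr (M * X) in let m2 := \tr (M * Y) in let m3 := \tr (M * (X * Y)) in
  e = row4 (- (1 + 2 * t) * m0 + (1 + t) * m1 + (1 + 2 * t) * m2 - (1 + 2 * t) * m3)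
           ((1 + t) * m0 - (2 + 2 * t) * m1 + (1 + 2 * t) * m3)
           ((1 + 2 * t) * m0 - (2 + 2 * t) * m2 + (1 + t) * m3)
           (- (1 + 2 * t) * m0 + (1 + 2 * t) * m1 + (1 + t) * m2 - (2 + 2 * t) * m3).
Proof.
move=> t2 tXY M m0 m1 m2 m3; have [e0 e1 e2] := span4_trace e tXY.
have e3 : m3 = - t * e 0 1 - e 0 2%:R - 2 * e 0 3%:R.
  rewrite /m3 mulrA /M (span4_mulX _ tXY).
  by have [_ _ ->] := span4_trace (row4 (- e 0 1 - t * e 0 2%:R - t * e 0 3%:R)
    (e 0 0 + e 0 1 + t * e 0 2%:R) (e 0 2%:R + e 0 3%:R) (- e 0 2%:R)) tXY; rewrite !mxE /=; ring.
rewrite /m0 /m1 /m2 e3 e0 e1 e2; apply/rowP => i; rewrite mxE.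
case: i => [[|[|[|[|i]]]] hi] //=.
- by rewrite (_ : Ordinal hi = 0); [ring: t2|exact: val_inj].
- by rewrite (_ : Ordinal hi = 1); [ring: t2|exact: val_inj].
- by rewrite (_ : Ordinal hi = 2%:R); [ring: t2|exact: val_inj].
- by rewrite (_ : Ordinal hi = 3%:R); [ring: t2|exact: val_inj].
Qed.

(** By [span4_coord] the zero matrix has zero coordinates, so the four matrices are independent in
    dimension 4. *)
Lemma span4_full t X Y M : t ^+ 2 = t + 1 -> trace_data t X Y -> exists e, M = span4 X Y e.
Proof.
move=> t2 tXY; pose V (i : 'I_4) : 'M[F]_2 := nth 0 [:: 1; X; Y; X * Y] i.
pose L : 'M[F]_4 := \matrix_(i < 4) (mxvec (V i) : 'rV[F]_4).
have LE e : vec_mx (e *m L : 'rV[F]_(2 * 2)) = span4 X Y e.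
  rewrite mulmx_sum_row !big_ord_recl big_ord0 addr0 !linearD !linearZ /= !rowK !mxvecK /span4 !addrA.
  by do 3?congr (_ + _); congr (_ *: _); congr (e _ _); apply: val_inj.
have uL : L \in unitmx.
  rewrite -row_free_unit -kermx_eq0; apply/eqP/row_matrixP => i; rewrite row0.
  have /(congr1 (fun u : 'rV[F]_(2 * 2) => vec_mx u)) : row i (kermx L) *m L = 0 by rewrite -row_mul mulmx_ker row0.
  rewrite LE linear0 => e0; rewrite [LHS](span4_coord _ t2 tXY) /= e0 !mul0r !linear0 !mulr0 !subr0 !addr0.
  by apply/rowP => j; rewrite !mxE; case: j => [[|[|[|[|j]]]] hj].
exists (mxvec M *m invmx L); rewrite -LE mulmxKV ?mxvecK //.
Qed.

(* The graph of the algebra isomorphism sending X to X' and Y to Y'. *)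
Definition same_coord X Y X' Y' M M' := exists e, M = span4 X Y e /\ M' = span4 X' Y' e.

Section SameCoord.
Variables (t : F) (X Y X' Y' : 'M[F]_2).
Hypotheses (t2 : t ^+ 2 = t + 1) (tXY : trace_data t X Y) (tXY' : trace_data t X' Y').
Local Notation same := (same_coord X Y X' Y').

Lemma same_coordD M N M' N' : same M M' -> same N N' -> same (M + N) (M' + N').
Proof. by move=> [e [-> ->]] [f [-> ->]]; exists (e + f); rewrite !span4D. Qed.

Lemma same_coordZ k M M' : same M M' -> same (k *: M) (k *: M').
Proof. by move=> [e [-> ->]]; exists (k *: e); rewrite !span4Z. Qed.

Lemma same_coord1 : same 1 1.
Proof. by exists (row4 1 0 0 0); rewrite !span4_row !scale0r !addr0 !scale1r. Qed.

Lemma same_coordX : same X X'.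
Proof. by exists (row4 0 1 0 0); rewrite !span4_row !scale0r !addr0 !add0r !scale1r. Qed.

Lemma same_coordY : same Y Y'.
Proof. by exists (row4 0 0 1 0); rewrite !span4_row !scale0r !addr0 !add0r !scale1r. Qed.

(** Right multiplication by X or Y acts on coordinates by a formula in t alone, the same for both
    pairs. *)
Lemma same_coordM M N M' N' : same M M' -> same N N' -> same (M * N) (M' * N').
Proof.
have mulX P P' : same P P' -> same (P * X) (P' * X').
  by move=> [e [-> ->]]; rewrite (span4_mulX _ tXY) (span4_mulX _ tXY'); eexists.
have mulY P P' : same P P' -> same (P * Y) (P' * Y').
  by move=> [e [-> ->]]; rewrite (span4_mulY _ tXY) (span4_mulY _ tXY'); eexists.
move=> sM [e [-> ->]]; rewrite /span4 !mulrDr -!scalerAr !mulr1 !mulrA.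
by do !apply: same_coordD; apply: same_coordZ => //; do ?[apply: mulY|apply: mulX].
Qed.

Lemma same_coord_trace M M' : same M M' -> \tr M = \tr M'.
Proof. by move=> [e [-> ->]]; have [-> _ _] := span4_trace e tXY; have [-> _ _] := span4_trace e tXY'. Qed.

Lemma same_coord_of_traces M M' : \tr M = \tr M' -> \tr (M * X) = \tr (M' * X') ->
  \tr (M * Y) = \tr (M' * Y') -> \tr (M * (X * Y)) = \tr (M' * (X' * Y')) -> same M M'.
Proof.
have [e ->] := span4_full M t2 tXY; have [e' ->] := span4_full M' t2 tXY' => h0 h1 h2 h3.
exists e; split=> //; congr span4.
by rewrite [LHS](span4_coord _ t2 tXY') [RHS](span4_coord _ t2 tXY) /= h0 h1 h2 h3.
Qed.

Lemma same_coord_scalar k M : same (k *: 1) M -> M = k *: 1.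
Proof.
move=> [e [E ->]]; have E' : span4 X Y (row4 k 0 0 0) = k *: 1 by rewrite span4_row !scale0r !addr0.
have -> : e = row4 k 0 0 0.
  by rewrite [LHS](span4_coord _ t2 tXY) [RHS](span4_coord _ t2 tXY) /= -E E'.
by rewrite span4_row !scale0r !addr0.
Qed.

End SameCoord.

End TraceAlgebra.

Section QuotientMorphism.
Local Open Scope group_scope.

Lemma quotient_morphism (G gT : groupType) (H K : set G) (L : set gT) :
  is_subgroup H -> is_normal K H -> quotient_isomorphic H K L -> exists theta : G -> gT,
  [/\ forall x, H x -> L (theta x), forall l, L l -> exists2 x, H x & theta x = l,
      forall x y, H x -> H y -> theta (x * y) = theta x * theta y &
      forall x, H x -> (theta x = 1 <-> K x)].
Proof.
move=> sH [sK KH Kn] [f [[fH finj fsurj] fM]].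
pose co x := [set x * k | k in K]; exists (fun x => f (co x)).
have coH x : H x -> left_cosets H K (co x) by exists x.
have coM x y : H x -> H y -> setprod (co x) (co y) = co (x * y).
  move=> Hx Hy; apply/seteqP; split=> [_ [_ [k Kk <-] [_ [l Kl <-] <-]]|_ [k Kk <-]].
    exists (k ^ y * l); first by apply: subgroupM => //; exact: Kn.
    by rewrite conjgE !mulgA mulgK.
  exists x; first by exists 1; [exact: subgroup1|rewrite mulg1].
  by exists (y * k); [exists k|rewrite mulgA].
have hM x y : H x -> H y -> f (co (x * y)) = f (co x) * f (co y).
  by move=> Hx Hy; rewrite -coM // fM //; exact: coH.
have H1 := subgroup1 sH.
have h1 : f (co 1) = 1.
  by apply: (mulgI (f (co 1))); rewrite -hM // !mulg1.
split=> //.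
- by move=> x Hx; apply: fH; exact: coH.
- by move=> l /fsurj[_ [x Hx <-] <-]; exists x.
move=> x Hx; rewrite -h1; split=> [e|Kx].
  have : co x = co 1 by apply: finj => //; rewrite inE; exact: coH.
  move=> e'; have : co x x by exists 1; [exact: subgroup1|rewrite mulg1].
  by rewrite e' => -[k Kk]; rewrite mul1g => <-.
congr f; apply/seteqP; split=> _ [k Kk <-].
  by exists (x * k); [exact: subgroupM|rewrite mul1g].
exists (x^-1 * k); last by rewrite mulVKg mul1g.
by apply: subgroupM => //; exact: subgroupV.
Qed.

End QuotientMorphism.

(** * Lifts from PSL_2 to SL_2 *)

Section PSL2Lifts.
Import GRing.Theory.
Local Open Scope ring_scope.
Variable F : finFieldType.
Implicit Types u v w : {'GL_2[F]}.
Local Notation pi := (coset (pmI F)).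

Definition sl2mx u : 'M[(F : fieldType)]_2 := GLval u.

Lemma sl2mxM u v : sl2mx (u * v)%g = sl2mx u * sl2mx v.
Proof. by []. Qed.

Lemma sl2mx1 : sl2mx 1%g = 1.
Proof. by []. Qed.

Lemma pmI_normalised u : u \in 'N(pmI F)%g.
Proof.
apply: (fintype.subsetP (cent_sub (pmI F))); apply/centP => v; rewrite inE => /orP[]/eqP vE;
  by apply: val_inj; rewrite -[LHS]/(GLval (u * v)%g) -[RHS]/(GLval (v * u)%g) !GL_ME vE ?(mulr1, mul1r, mulrN1, mulN1r).
Qed.

Lemma coset_pmM u v : pi (u * v)%g = (pi u * pi v)%g.
Proof. by rewrite morphM ?pmI_normalised. Qed.

Lemma coset_pm1 u : pi u = 1%g <-> scalar_pm1 (sl2mx u).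
Proof.
split=> [/(coset_idr (pmI_normalised u))|h].
  by rewrite inE => /orP[]/eqP; [left|right].
by apply: coset_id; rewrite inE -/(sl2mx u); case: h => ->; rewrite eqxx ?orbT.
Qed.

Lemma coset_pmV u : pi u^-1%g = ((pi u)^-1)%g.
Proof.
apply: (mulIg (pi u)); rewrite mulVg -coset_pmM mulVg.
by apply/coset_pm1; left.
Qed.

Lemma PSL2_lift x : x \in PSL2 F -> exists2 u, \det (sl2mx u) = 1%R & pi u = x.
Proof. by case/morphimP => u _; rewrite inE => /eqP du ->; exists u. Qed.

Lemma PSL2_coset u : \det (sl2mx u) = 1%R -> pi u \in PSL2 F.
Proof. by move=> du; apply: mem_quotient; rewrite inE du. Qed.

Lemma PSL2_nontrivial : exists2 x, x \in PSL2 F & x <> 1%g.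
Proof.
pose M : 'M[F]_2 := (1 + delta_mx 0 1)%R.
have dM : \det M = 1%R by rewrite det_mx2 !mxE /=; ring.
have uM : (M \is a GRing.unit)%R by rewrite -[_ \is a _]/(M \in unitmx) unitmxE dM GRing.unitr1.
exists (pi (FinRing.Unit uM : {'GL_2[F]})); first exact: PSL2_coset.
move/coset_pm1 => /= -[] /(congr1 (fun W : 'M[F]_2 => W 0%R 1%R)); rewrite !mxE /= ?oppr0 add0r;
  by move/eqP; rewrite oner_eq0.
Qed.

Lemma sl2_unitmx u : \det (sl2mx u) = 1 -> sl2mx u \in unitmx.
Proof. by move=> du; rewrite unitmxE du unitr1. Qed.

Lemma GL_opp u : \det (sl2mx u) = 1 -> exists2 v, sl2mx v = (- sl2mx u)%R & pi v = pi u.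
Proof.
move=> du; have uN : (- GLval u \is a GRing.unit)%R by rewrite GRing.unitrN GL_unit.
exists (FinRing.Unit uN : {'GL_2[F]}) => //.
apply/eqP; rewrite -(inj_eq (mulgI (pi u)^-1%g)) mulVg -coset_pmV -coset_pmM; apply/eqP/coset_pm1.
right; rewrite sl2mxM -[X in _ * X = _]/(- sl2mx u) -mulmxE mulmxN mulVmx //.
exact: sl2_unitmx.
Qed.

Lemma sl2_inv u : \det (sl2mx u) = 1%R -> sl2mx u^-1%g = (\tr (sl2mx u) *: 1 - sl2mx u)%R.
Proof.
move=> du; have uu := sl2_unitmx du.
rewrite -[LHS]mulmx1; apply: (canLR (mulKmx uu)).
have := cayley_hamilton2 (sl2mx u); rewrite du scale1r -mulmxE => E.
by rewrite mulmxBr -scalemxAr mulmx1 E opprB addrC subrK.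
Qed.

End PSL2Lifts.

Section PSL2Traces.
Import GRing.Theory.
Local Open Scope ring_scope.
Variable F : finFieldType.
Implicit Types u v w : {'GL_2[F]}.
Local Notation pi := (coset (pmI F)).

Lemma sl2M u v : \det (sl2mx u) = 1 -> \det (sl2mx v) = 1 -> \det (sl2mx (u * v)%g) = 1.
Proof. by move=> du dv; rewrite sl2mxM -mulmxE det_mulmx du dv mul1r. Qed.

Lemma sl2V u : \det (sl2mx u) = 1 -> \det (sl2mx u^-1%g) = 1.
Proof. by move=> du; rewrite -[sl2mx _]/(invmx (sl2mx u)) det_inv du invr1. Qed.

Lemma sl2_traceV u : \det (sl2mx u) = 1 -> \tr (sl2mx u^-1%g) = \tr (sl2mx u).
Proof. by move=> du; rewrite sl2_inv // linearB linearZ /= mxtrace1; ring. Qed.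

Lemma sl2_involution_trace u : \det (sl2mx u) = 1 -> pi u <> 1%g -> (pi u * pi u = 1)%g ->
  \tr (sl2mx u) = 0.
Proof.
move=> du u1 uu; apply: sl2_order2_trace du _ _; first by move/coset_pm1.
by rewrite -sl2mxM; apply/coset_pm1; rewrite coset_pmM.
Qed.

(** A lift is free up to sign; the sign making the cube -1 fixes the trace. *)
Lemma PSL2_lift_order3 x : x \in PSL2 F -> (x ^+ 3 = 1)%g -> x <> 1%g ->
  exists u, [/\ \det (sl2mx u) = 1, pi u = x & \tr (sl2mx u) = 1].
Proof.
move=> /PSL2_lift[u du <-] u3 u1; have nu : ~ scalar_pm1 (sl2mx u) by move/coset_pm1.
have : scalar_pm1 (sl2mx (u ^+ 3)%g).
  by apply/coset_pm1; rewrite !expgS expg0 mulg1 !coset_pmM -u3 !expgS expg0 mulg1.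
rewrite !expgS expg0 mulg1 !sl2mxM mulrA => -[E|E]; last first.
  by exists u; split=> //; apply: sl2_order3_trace.
have [v vE pv] := GL_opp du; have dv : \det (sl2mx v) = 1.
  by rewrite vE -scaleN1r detZ du mulr1 sqrrN expr1n.
exists v; split=> //; apply: sl2_order3_trace => //; first by move/coset_pm1; rewrite pv.
by rewrite vE mulrNN mulrN E.
Qed.

Lemma PSL2_lift_order5 x : x \in PSL2 F -> (x ^+ 5 = 1)%g -> x <> 1%g ->
  exists u, [/\ \det (sl2mx u) = 1, pi u = x & \tr (sl2mx u) ^+ 2 = \tr (sl2mx u) + 1].
Proof.
move=> /PSL2_lift[u du <-] u5 u1; have nu : ~ scalar_pm1 (sl2mx u) by move/coset_pm1.
have : scalar_pm1 (sl2mx (u ^+ 5)%g).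
  by apply/coset_pm1; rewrite !expgS expg0 mulg1 !coset_pmM -u5 !expgS expg0 mulg1.
rewrite !expgS expg0 mulg1 !sl2mxM !mulrA => -[E|E]; last first.
  by exists u; split=> //; apply: sl2_order5_trace.
have [v vE pv] := GL_opp du; have dv : \det (sl2mx v) = 1.
  by rewrite vE -scaleN1r detZ du mulr1 sqrrN expr1n.
exists v; split=> //; apply: sl2_order5_trace => //; first by move/coset_pm1; rewrite pv.
by rewrite vE !(mulrN, mulNr, opprK) E.
Qed.

End PSL2Traces.

(** * Invariance of the kernel under the half-turn *)

Section KernelInvariance.
Import GRing.Theory.
Local Open Scope ring_scope.
Variables (R : realType) (A B C D : H3 R) (a b c d : 'rV[R]_4).
Hypothesis fr : frame353 A B C D a b c d.
Local Notation phi := (golden R).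
Local Notation Gam := (Gamma A B C D).
Local Notation Del := (Delta A B C D).
Local Notation al := (reflection a * reflection b)%g.
Local Notation be := (reflection b * reflection c)%g.
Local Notation ga := (reflection c * reflection d)%g.
Variable r : isoH3 R.
Hypothesis hr : half_turn a b c d r.

Lemma Delta_relations : [/\ al ^+ 3 = 1, be ^+ 5 = 1 & ga ^+ 3 = 1]%g /\
  [/\ (al * be) ^+ 2 = 1, (be * ga) ^+ 2 = 1 & (al * be * ga) ^+ 2 = 1]%g.
Proof.
have g := frame_gram fr.
have cancel (m n p : 'rV[R]_4) : lorentz n n = 1 ->
    (reflection m * reflection n * (reflection n * reflection p) = reflection m * reflection p)%g.
  by move=> nn; rewrite mulgA -(mulgA (reflection m)) reflection_sqr // mulg1.
split; split; rewrite ?cancel ?g //.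
- by apply: reflections_order3; rewrite g.
- by apply: reflections_order5; rewrite g.
- by apply: reflections_order3; rewrite g.
- by apply: reflections_order2; rewrite g.
- by apply: reflections_order2; rewrite g.
- by apply: reflections_order2; rewrite g.
Qed.

Lemma half_turn_rotations : [/\ al ^ r = ga^-1, be ^ r = be^-1 & ga ^ r = al^-1]%g.
Proof.
have [ea eb ec ed] := half_turn_gens fr hr; have g := frame_gram fr.
by split; rewrite conjMg ?ea ?eb ?ec ?ed invMg !reflectionV ?g.
Qed.

Variables (F : finFieldType) (K : set (isoH3 R)) (theta : isoH3 R -> coset_of (pmI F)).
Hypothesis theta_PSL2 : forall x, Del x -> theta x \in PSL2 F.
Hypothesis theta_surj : forall l, l \in PSL2 F -> exists2 x, Del x & theta x = l.
Hypothesis thetaM : forall x y, Del x -> Del y -> theta (x * y)%g = (theta x * theta y)%g.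
Hypothesis theta_ker : forall x, Del x -> (theta x = 1%g <-> K x).

Let sD := Delta_subgroup A B C D.

Let theta1 : theta 1%g = 1%g.
Proof. by apply: (mulgI (theta 1%g)); rewrite -thetaM ?mulg1 //; exact: subgroup1. Qed.

Let thetaV x : Del x -> theta x^-1%g = ((theta x)^-1)%g.
Proof.
by move=> Dx; apply: (mulIg (theta x)); rewrite -thetaM ?mulVg ?theta1 //; exact: subgroupV.
Qed.

Lemma thetaX x n : Del x -> Del (x ^+ n)%g /\ theta (x ^+ n)%g = (theta x ^+ n)%g.
Proof.
move=> Dx; elim: n => [|n [Dn En]]; first by rewrite !expg0; split=> //; exact: subgroup1.
by rewrite !expgS thetaM // En; split=> //; exact: subgroupM.
Qed.

Lemma kernel_exponent x : Del x -> K (x ^+ #|PSL2 F|)%g.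
Proof.
move=> Dx; have [Dn En] := thetaX #|PSL2 F| Dx.
by apply/theta_ker; rewrite // En expg_cardG //; exact: theta_PSL2.
Qed.

(** If one of these were 1, relations of coprime exponents would kill the generators one after
    another, and the image would be trivial. *)
Lemma theta_generators_nontrivial : let x := theta al in let y := theta be in let z := theta ga in
  [/\ x <> 1, y <> 1, z <> 1 & [/\ x * y <> 1, y * z <> 1 & x * y * z <> 1]]%g.
Proof.
move=> x y z; have [Da Db Dc] := Delta_gens fr.
have [[a3 b5 c3] [ab bc abc]] := Delta_relations.
have Dab : Del (al * be)%g by exact: subgroupM.
have Dbc : Del (be * ga)%g by exact: subgroupM.
have Dabc : Del (al * be * ga)%g by exact: subgroupM.
have x3 : (x ^+ 3 = 1)%g by rewrite /x; have [_ <-] := thetaX 3 Da; rewrite a3.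
have y5 : (y ^+ 5 = 1)%g by rewrite /y; have [_ <-] := thetaX 5 Db; rewrite b5.
have z3 : (z ^+ 3 = 1)%g by rewrite /z; have [_ <-] := thetaX 3 Dc; rewrite c3.
have xy2 : ((x * y) ^+ 2 = 1)%g by rewrite /x /y -thetaM //; have [_ <-] := thetaX 2 Dab; rewrite ab.
have yz2 : ((y * z) ^+ 2 = 1)%g by rewrite /z /y -thetaM //; have [_ <-] := thetaX 2 Dbc; rewrite bc.
have xyz2 : ((x * y * z) ^+ 2 = 1)%g.
  by rewrite /x /y /z -!thetaM //; have [_ <-] := thetaX 2 Dabc; rewrite abc.
have coprime1 (g : coset_of (pmI F)) m n : coprime m n -> (g ^+ m = 1 -> g ^+ n = 1 -> g = 1)%g.
  move=> /eqP mn gm gn; have : (#[g]%g %| gcdn m n)%N by rewrite dvdn_gcd !order_dvdn gm gn eqxx.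
  by rewrite mn dvdn1 order_eq1 => /eqP.
have trivial : (x = 1 -> y = 1 -> z = 1 -> False)%g.
  move=> x1 y1 z1; have [l lL l1] := PSL2_nontrivial F; apply: l1.
  have [k Dk <-] := theta_surj lL.
  suff [] : Del k /\ theta k = 1%g by [].
  apply: (Delta_ind fr (H := [set x | Del x /\ theta x = 1%g])) Dk => //=.
  split=> [|k1 k2 [D1 t1] [D2 t2]] /=; first by split=> //; exact: subgroup1.
  have D2V : Del k2^-1%g by exact: subgroupV.
  by rewrite thetaM // thetaV // t1 t2 invg1 mulg1; split=> //; exact: (subgroupM sD D1 D2V).
have from_y : (y = 1 -> False)%g.
  move=> y1; rewrite y1 mulg1 in xy2; rewrite y1 mul1g in yz2.
  by apply: trivial => //; [exact: (@coprime1 x 3 2)|exact: (@coprime1 z 3 2)].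
have from_x : (x = 1 -> False)%g.
  by move=> x1; apply: from_y; rewrite x1 mul1g in xy2; exact: (@coprime1 y 5 2).
have from_z : (z = 1 -> False)%g.
  by move=> z1; apply: from_y; rewrite z1 mulg1 in yz2; exact: (@coprime1 y 5 2).
split=> //; split=> e.
- apply: from_x; apply: (@coprime1 x 3 5) => //.
  by rewrite -[x]invgK (mulg1_eq e) expVgn y5 invg1.
- apply: from_z; apply: (@coprime1 z 3 5) => //.
  by rewrite -(mulg1_eq e) expVgn y5 invg1.
- apply: from_z; apply: (@coprime1 z 3 2) => //.
  by rewrite -(mulg1_eq e) expVgn xy2 invg1.
Qed.

Theorem half_turn_kernel k : K k -> Del k -> K (k ^ r)%g.
Proof.
have [Da Db Dc] := Delta_gens fr; have [[a3 b5 c3] [ab bc abc]] := Delta_relations.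
have [ra rb rc] := half_turn_rotations.
have [x1 y1 z1 [xy1 yz1 xyz1]] := theta_generators_nontrivial.
have [u [du ux uX]] : exists u, [/\ \det (sl2mx u) = 1, coset (pmI F) u = theta al & \tr (sl2mx u) = 1].
  by apply: PSL2_lift_order3 => //; [exact: theta_PSL2|have [_ <-] := thetaX 3 Da; rewrite a3].
have [v [dv vy vY]] : exists v, [/\ \det (sl2mx v) = 1, coset (pmI F) v = theta be
    & \tr (sl2mx v) ^+ 2 = \tr (sl2mx v) + 1].
  by apply: PSL2_lift_order5 => //; [exact: theta_PSL2|have [_ <-] := thetaX 5 Db; rewrite b5].
have [w [dw wz wZ]] : exists w, [/\ \det (sl2mx w) = 1, coset (pmI F) w = theta ga & \tr (sl2mx w) = 1].
  by apply: PSL2_lift_order3 => //; [exact: theta_PSL2|have [_ <-] := thetaX 3 Dc; rewrite c3].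
have Dab : Del (al * be)%g by exact: subgroupM.
have Dbc : Del (be * ga)%g by exact: subgroupM.
have Dabc : Del (al * be * ga)%g by exact: subgroupM.
have tuv : \tr (sl2mx (u * v)%g) = 0.
  apply: sl2_involution_trace; rewrite ?coset_pmM ?ux ?vy //; first exact: sl2M.
  by rewrite -!thetaM // -expg2 ab.
have tvw : \tr (sl2mx (v * w)%g) = 0.
  apply: sl2_involution_trace; rewrite ?coset_pmM ?wz ?vy //; first exact: sl2M.
  by rewrite -!thetaM // -expg2 bc.
have tuvw : \tr (sl2mx (u * v * w)%g) = 0.
  apply: sl2_involution_trace; rewrite ?coset_pmM ?ux ?wz ?vy //; first by do !apply: sl2M.
  by rewrite -!thetaM // -expg2 abc.
set t := \tr (sl2mx v) in vY.
have tXY : trace_data t (sl2mx u) (sl2mx v) by split.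
have tXY' : trace_data t (sl2mx w^-1%g) (sl2mx v^-1%g).
  split; rewrite ?sl2V ?sl2_traceV //.
  by rewrite -sl2mxM -invMg sl2_traceV //; exact: sl2M.
pose same := same_coord (sl2mx u) (sl2mx v) (sl2mx w^-1%g) (sl2mx v^-1%g).
(* The isomorphism is defined by X and Y, so the image of Z has to be checked. The trace of ZX,
   which the relations leave free, occurs on both sides, since inverses in SL_2 have equal
   traces. *)
have same_w : same (sl2mx w) (sl2mx u^-1%g).
  apply: (same_coord_of_traces vY tXY tXY').
  - by rewrite sl2_traceV // uX.
  - rewrite -!sl2mxM -invMg sl2_traceV //; exact: sl2M.
  - rewrite -!sl2mxM -invMg sl2_traceV; last exact: sl2M.
    by rewrite !sl2mxM trace_mul2 [RHS]trace_mul2 -!sl2mxM tvw tuv.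
  - rewrite -!sl2mxM -!invMg sl2_traceV; last by do !apply: sl2M.
    by rewrite [in LHS]sl2mxM [LHS]trace_mul2 [in RHS]sl2mxM [RHS]trace_mul2 -!sl2mxM mulgA tuvw.
have same_inv p q : \det (sl2mx p) = 1 -> \det (sl2mx q) = 1 -> same (sl2mx p) (sl2mx q) ->
    same (sl2mx p^-1%g) (sl2mx q^-1%g).
  move=> dp dq pq; rewrite !sl2_inv // (same_coord_trace tXY tXY' pq) -!scaleN1r.
  apply: same_coordD; first by apply: same_coordZ; exact: same_coord1.
  exact: same_coordZ.
(* x and x ^ r have corresponding lifts. For x in K the lift is 1 or -1, and the isomorphism fixes
   scalars. *)
pose good x := exists p q, [/\ \det (sl2mx p) = 1, \det (sl2mx q) = 1, same (sl2mx p) (sl2mx q),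
  coset (pmI F) p = theta x & coset (pmI F) q = theta (x ^ r)%g].
have Dr x : Del x -> Del (x ^ r)%g := half_turn_Delta fr hr (x := x).
suff all_good x : Del x -> Del x /\ good x.
  move=> Kk Dk; have [_ [p [q [dp dq pq pk qk]]]] := all_good k Dk.
  apply/(theta_ker (Dr k Dk)); rewrite -qk; apply/coset_pm1.
  have /(theta_ker Dk) := Kk; rewrite -pk => /coset_pm1[E|E]; rewrite E in pq.
    by left; rewrite -(scale1r 1) in pq; rewrite (same_coord_scalar vY tXY pq) scale1r.
  by right; rewrite -(scaleN1r 1) in pq; rewrite (same_coord_scalar vY tXY pq) scaleN1r.
apply: (Delta_ind fr (H := [set x | Del x /\ good x])) => /=.
- split=> [|y z [Dy [p [q [dp dq pq py qy]]]] [Dz [p' [q' [dp' dq' pq' pz qz]]]]] /=.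
    split; first exact: subgroup1.
    exists 1%g, 1%g; rewrite conj1g theta1; split; rewrite ?det1 ?sl2mx1 //; last 2 first.
    - by apply/coset_pm1; left.
    - by apply/coset_pm1; left.
    exact: same_coord1.
  split; first exact: sD.2.
  exists (p * p'^-1)%g, (q * q'^-1)%g; rewrite !coset_pmM !coset_pmV py qy pz qz.
  have DzV := subgroupV sD Dz.
  have Dyr := Dr _ Dy; have Dzr := Dr _ Dz; have DzrV := subgroupV sD Dzr.
  rewrite conjMg conjVg (thetaM Dy DzV) (thetaM Dyr DzrV) (thetaV Dz) (thetaV Dzr).
  split=> //; rewrite ?sl2M ?sl2V // !sl2mxM; apply: (same_coordM tXY tXY') => //.
  exact: same_inv.
- split=> //; exists u, w^-1%g; rewrite ra thetaV // coset_pmV ux wz sl2V //; split=> //.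
  exact: same_coordX.
- split=> //; exists v, v^-1%g; rewrite rb thetaV // coset_pmV vy sl2V //; split=> //.
  exact: same_coordY.
- by split=> //; exists w, u^-1%g; rewrite rc thetaV // coset_pmV ux wz sl2V.
Qed.

End KernelInvariance.

(** * Normalisers *)

Section Normalisers.
Local Open Scope group_scope.
Variables (R : realType) (A B C D : H3 R) (a b c d : 'rV[R]_4).
Hypothesis fr : frame353 A B C D a b c d.
Local Notation Gam := (Gamma A B C D).
Local Notation Del := (Delta A B C D).
Variable r : isoH3 R.
Hypothesis hr : half_turn a b c d r.

Let sG := Gamma_subgroup A B C D.
Let sD := Delta_subgroup A B C D.

Lemma normal_sub_normaliser (G : groupType) (K H : set G) : is_subgroup H -> is_normal K H ->
  H `<=` normaliser_of K.
Proof.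
move=> sH [_ _ KH] h Hh; apply/normaliserP; split=> k Kk; first exact: KH.
by apply: KH => //; exact: subgroupV.
Qed.

(** Stated with an exponent m so as to serve both K, with m the order of L_2(q), and Delta itself,
    with m = 1. *)
Lemma normaliser_sub_Gamma (K : set (isoH3 R)) (m : nat) g : (0 < m)%N -> is_normal K Del ->
  (forall x, Del x -> K (x ^+ m)) -> (forall k, K k -> K (k ^ r)) ->
  normaliser_of K g -> Gam g \/ Gam (r * g).
Proof.
move=> m0 nK Km Kr; have [_ KD _] := nK.
have sN := normaliser_subgroup K.
have rN : normaliser_of K r by apply/normaliserP; rewrite (half_turnV fr hr).
have KG : K `<=` Gam by move=> k /KD /Delta_det[].
have fin := normaliser_discrete fr m0 KG Km.
exact: (discrete_overgroup fr hr sN (normal_sub_normaliser sD nK) rN fin).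
Qed.

(** Conjugation preserves determinants, so an isometry normalising Gamma normalises Delta, and the
    discreteness argument applies to the normaliser of Delta. *)
Lemma OmegaP g : Omega A B C D g <-> Gam g \/ Gam (r * g).
Proof.
have sO : is_subgroup (Omega A B C D) := normaliser_subgroup Gam.
have rO := half_turn_Omega fr hr.
have GO x : Gam x -> Omega A B C D x.
  by move=> Gx; apply/normaliserP; split=> y Gy; apply: (subgroupJ sG) => //; exact: subgroupV sG Gx.
split=> [Og|[/GO //|/GO Org]]; last first.
  by rewrite -(mulKg r g); exact: (subgroupM sO (subgroupV sO rO) Org).
apply: (@normaliser_sub_Gamma Del 1) => //.
- by split=> // h k Dh Dk; exact: subgroupJ sD Dk Dh.
- by move=> k; apply: (half_turn_Delta fr hr).
have [Gg GgV] := (normaliserP _ _).1 Og.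
by apply/normaliserP; split=> x /Delta_det[Gx dx]; apply/Delta_det; rewrite det_isoJ; split=> //; [exact: Gg|exact: GgV].
Qed.

End Normalisers.

Theorem corollary1p4 (R : realType) (A B C D : H3 R)
    (hT : tetrahedron353 A B C D)
    (F : finFieldType) (hq : 4 <= #|F|)
    (K : set (isoH3 R))
    (hK : is_normal K (Delta A B C D))
    (hL : quotient_isomorphic (Delta A B C D) K [set` PSL2 F]) :
  (is_normal K (Gamma A B C D) -> normaliser_of K = Omega A B C D) /\
  (~ is_normal K (Gamma A B C D) -> normaliser_of K = Omega_plus A B C D).
Proof.
have [a [b [c [d fr]]]] := tetrahedron353_frame hT.
have [r hr] := half_turn_exists fr.
have sG := Gamma_subgroup A B C D; have sD := Delta_subgroup A B C D.
have sN := normaliser_subgroup K.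
have [theta [tL tS tM tK]] := quotient_morphism sD hK hL.
have [sK KD _] := hK.
have Kr k : K k -> K (k ^ r)%g by move=> Kk; exact: (half_turn_kernel fr hr tL tS tM tK Kk (KD k Kk)).
have rN : normaliser_of K r by apply/normaliserP; rewrite (half_turnV fr hr).
have DN := normal_sub_normaliser sD hK.
have NO g : normaliser_of K g -> Gamma A B C D g \/ Gamma A B C D (r * g)%g.
  by apply: (normaliser_sub_Gamma fr hr (cardG_gt0 _) hK (kernel_exponent tL tM tK) Kr).
have shift g : normaliser_of K (r * g)%g -> normaliser_of K g.
  by move=> Nrg; rewrite -(mulKg r g); exact: (subgroupM sN (subgroupV sN rN) Nrg).
split=> nK.
  apply/seteqP; split=> g; first by move/NO/(OmegaP fr hr).
  have GN := normal_sub_normaliser sG nK.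
  by move/(OmegaP fr hr) => [/GN|/GN/shift].
have [_ _ _ _ dr] := hr.
have det_shift g : (\det (iso_mx (r * g)%g) = \det (iso_mx g))%R by rewrite det_isoM dr GRing.mul1r.
apply/seteqP; split=> g.
  move=> Ng; split; first by apply/(OmegaP fr hr)/NO.
  apply/orientation_preservingE; case: (det_iso g) => // dg; exfalso; apply: nK.
  (* As r is even, an odd element of the normaliser yields an odd one in Gamma; with Delta it
     generates Gamma, so K would be normal in Gamma. *)
  have [x [Gx Nx dx]] : exists x, [/\ Gamma A B C D x, normaliser_of K x & (\det (iso_mx x) = -1)%R].
    case: (NO g Ng) => Gg; first by exists g.
    by exists (r * g)%g; rewrite det_shift; split=> //; exact: (subgroupM sN rN Ng).
  have GN y : Gamma A B C D y -> normaliser_of K y.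
    move=> Gy; case: (det_iso y) => dy; first by apply: DN; apply/Delta_det.
    rewrite -(mulgK x y); apply: sN.2 Nx; apply: DN; apply/Delta_det.
    by rewrite det_isoM dx dy GRing.mulrNN GRing.mulr1; split=> //; exact: (subgroupM sG Gy Gx).
  split=> [||h k Gh Kk]; first exact: sK.
    by move=> k /KD/Delta_det[].
  by have [+ _] := (normaliserP _ _).1 (GN h Gh); exact.
move=> [/(OmegaP fr hr)[Gg|Grg] /orientation_preservingE dg].
  by apply: DN; apply/Delta_det.
by apply: shift; apply: DN; apply/Delta_det; rewrite det_shift.
Qed.
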